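(* Let $\xi$ be a Lévy process with $\psi(u)=\log\mathbb E e^{u\xi(1)}<\infty$ for all $u\in\mathbb R$, $\xi(1)$ not a.s. constant, and let $\xi_i$, $i\in\mathbb N$, be independent copies of $\xi$. Let $(s_N)$ be a non-negative sequence with \[ \lim_{N\to\infty}s_N=\infty,\qquad \liminf_{N\to\infty}\frac{\log N}{s_N}>\lambda_2:=2\psi'(2)-\psi(2). \] Let $Z_N(t)=\sum_{i=1}^N e^{\xi_i(s_N+t)}$, $t\ge -s_N$. Then for every $T>0$, weakly on the Skorokhod space $D[-T,T]$, \[ \frac{Z_N(\cdot)-\mathbb E Z_N(\cdot)}{\sqrt{\operatorname{Var} Z_N(\cdot)}}\Longrightarrow \mathcal X(\cdot),\qquad N\to\infty, \] where $\{\mathcal X(t),t\in\mathbb R\}$ is a zero-mean Gaussian process with covariance $\operatorname{Cov}(\mathcal X(t_1),\mathcal X(t_2))=e^{(\psi(1)-\psi(2)/2)|t_2-t_1|}$, $t_1,t_2\in\mathbb R$.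
   Context: A Lévy process is a process with stationary independent increments and càdlàg sample paths, started at $0$. The left-hand side is well defined on $[-T,T]$ for $N$ large enough (once $s_N\ge T$). *)

(* Defs.v *)
From HB Require Import structures.
From mathcomp Require Import all_boot all_order all_algebra.
From mathcomp Require Import all_classical all_reals all_analysis.
Set Implicit Arguments. Unset Strict Implicit. Unset Printing Implicit Defensive.
Import Order.TTheory GRing.Theory Num.Theory.
Import numFieldNormedType.Exports.
Local Open Scope classical_set_scope.
Local Open Scope ring_scope.

Section Defs.
Context {R : realType}.

Definition cadlag_from (a : R) (f : R -> R) : Prop :=
  (forall t, a <= t -> f @ t^'+ --> f t) /\
  (forall t, a < t -> cvg (f @ t^'-)).

Definition cadlag_on (T : R) (f : R -> R) : Prop :=
  (forall t, -T <= t < T -> f @ t^'+ --> f t) /\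
  (forall t, -T < t <= T -> cvg (f @ t^'-)).

Definition time_change (T : R) (l : R -> R) : Prop :=
  l (- T) = - T /\ l T = T /\
  {within [set t | -T <= t <= T], continuous l} /\
  (forall x y, -T <= x -> y <= T -> x < y -> l x < l y).

Definition J1_cvg (T : R) (x : nat -> R -> R) (y : R -> R) : Prop :=
  forall e : R, 0 < e -> \forall n \near \oo, exists l, time_change T l /\
    (forall t, -T <= t <= T -> `|l t - t| <= e /\ `|x n (l t) - y t| <= e).

Context {d : measure_display} {Omega : measurableType d} (P : probability Omega R).

Definition indep_rvs (n : nat) (X : 'I_n -> Omega -> R) : Prop :=
  forall B : 'I_n -> set R, (forall k, measurable (B k)) ->
  P (\bigcap_(k in [set: 'I_n]) (X k @^-1` B k)) =
  (\prod_(k < n) P (X k @^-1` B k))%E.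

Definition process_sigma (X : R -> Omega -> R) : set (set Omega) :=
  <<s [set A | exists (t : R) (B : set R), 0 <= t /\ measurable B /\ A = X t @^-1` B] >>.

Definition indep_processes (X : nat -> R -> Omega -> R) : Prop :=
  forall (n : nat) (idx : 'I_n -> nat), injective idx ->
  forall A : 'I_n -> set Omega, (forall k, process_sigma (X (idx k)) (A k)) ->
  P (\bigcap_(k in [set: 'I_n]) A k) = (\prod_(k < n) P (A k))%E.

Definition same_fdd (X Y : R -> Omega -> R) : Prop :=
  forall (n : nat) (ts : 'I_n -> R) (B : 'I_n -> set R),
  (forall k, 0 <= ts k) -> (forall k, measurable (B k)) ->
  P (\bigcap_(k in [set: 'I_n]) (X (ts k) @^-1` B k)) =
  P (\bigcap_(k in [set: 'I_n]) (Y (ts k) @^-1` B k)).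

Definition levy_process (X : R -> Omega -> R) : Prop :=
  (forall t, 0 <= t -> measurable_fun setT (X t)) /\
  (forall w, X 0 w = 0) /\
  (forall w, cadlag_from 0 (fun t => X t w)) /\
  (forall s t, 0 <= s -> 0 <= t -> forall B, measurable B ->
     P ((fun w => X (s + t) w - X s w) @^-1` B) = P (X t @^-1` B)) /\
  (forall (n : nat) (ts : 'I_n.+1 -> R), (forall k, 0 <= ts k) ->
     (forall i j : 'I_n.+1, (i < j)%N -> ts i < ts j) ->
     indep_rvs (fun k : 'I_n => fun w =>
        X (ts (lift ord0 k)) w - X (ts (widen_ord (leqnSn n) k)) w)).

Definition mean (f : Omega -> R) : R := fine (\int[P]_w (f w)%:E).
Definition var (f : Omega -> R) : R := fine (\int[P]_w ((f w - mean f) ^+ 2)%:E).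

End Defs.

Section Gauss.
Context {R : realType} {d : measure_display} {Omega : measurableType d}
  (Q : probability Omega R).

Definition centered_gaussian_process (X : R -> Omega -> R) (C : R -> R -> R) : Prop :=
  (forall t, measurable_fun setT (X t)) /\
  forall (n : nat) (ts : 'I_n -> R) (a : 'I_n -> R),
    let L := fun w => \sum_(k < n) a k * X (ts k) w in
    let v := \sum_(j < n) \sum_(k < n) a j * a k * C (ts j) (ts k) in
    (0 < v -> forall B, measurable B -> Q (L @^-1` B) = normal_prob 0 (Num.sqrt v) B) /\
    (v = 0 -> Q (L @^-1` [set 0]) = 1%E).
End Gauss.

Definition D_weak_cvg {R : realType}
  {d : measure_display} {Omega : measurableType d} (P : probability Omega R)
  {d' : measure_display} {Omega' : measurableType d'} (Q : probability Omega' R)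
  (T : R) (Y : nat -> Omega -> R -> R) (X : Omega' -> R -> R) : Prop :=
  forall f : (R -> R) -> R,
    (exists M : R, forall x, cadlag_on T x -> `|f x| <= M) ->
    (forall (x : nat -> R -> R) (y : R -> R), (forall n, cadlag_on T (x n)) ->
        cadlag_on T y -> J1_cvg T x y -> f (x n) @[n --> \oo] --> f y) ->
    (\int[P]_w (f (Y N w))%:E)%E @[N --> \oo] --> (\int[Q]_w (f (X w))%:E)%E.

(* Main.v *)
Require Import Defs.
From HB Require Import structures.
From mathcomp Require Import all_boot all_order all_algebra.
From mathcomp Require Import all_classical all_reals all_analysis.
From mathcomp Require Import measurable_realfun ring lra.
Import Order.TTheory GRing.Theory Num.Theory.
Import numFieldNormedType.Exports.
Local Open Scope classical_set_scope.
Local Open Scope ring_scope.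
Set Implicit Arguments. Unset Strict Implicit. Unset Printing Implicit Defensive.

(** Dividing [exp (xi_i (s_N + t))] by its mean makes the normalized sum a deterministic
    multiple of a sum [M_N] of i.i.d. centered martingales, whose covariances converge to
    [exp ((psi 2 - 2 psi 1) min (t1, t2))].

    Since [2 psi' 2 - psi 2] is below the growth rate of [ln N / s_N], differentiating the
    cumulant function at 2 gives an exponent [p > 2] satisfying the Lyapunov condition, hence
    [E cos (b + l (M_N))] converges for every linear form [l] of finitely many values.
    Approximating truncated coordinates by sines and functions of them by Bernstein polynomials
    extends this to bounded Lipschitz functions.

    For tightness, Doob's inequality is applied to the convex function [x^2 / 2 - 1 + cos x]:
    only second moments are needed, yet under a centered normal law of variance [v] its mean is
    [O (v^2)], so a cell of length [h] is bad with probability [O (h^2)] for large [N].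

    A bounded J1-continuous functional need not be measurable; it is bounded from below by
    functionals that are Lipschitz for the uniform distance, and these are compared with
    functionals of finitely many coordinates. *)

(** The scale of M_N is forced by second moments: with c2 = psi 2 - 2 psi 1 it satisfies N kap^2 =
    exp (- c2 s_N). Dividing by the limiting standard deviations exp (c2 t / 2) then leaves the
    covariance exp (- c2 |t2 - t1| / 2). That c2 is positive is where the non-constancy of xi(1)
    enters. The threshold lambda_2 is read off the Lyapunov sum of order p. Its logarithm is (1 - p
    / 2) ln N + s_N (psi p - p psi 2 / 2) up to a bounded term, and psi p - p psi 2 / 2 vanishes at
    p = 2 with slope lambda_2 / 2 there. The exponent p may be arbitrarily close to 2, and fourth
    moments of M_N need not stay bounded, so a moment criterion for tightness is out of reach; this
    is why the test function grows quadratically but is quartic near 0. How large N must be may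
    depend on the cell, while the constant in front of h^2 may not: the number of cells is chosen
    from that constant, and then finitely many cells remain. The limit process is given by the laws
    of its linear forms and by its cadlag paths, so its own oscillation bound is inherited from the
    prelimit processes. *)

Lemma norm_squeeze0 {R : realType} (u v : nat -> R) : (forall n, `|u n| <= v n) ->
  v n @[n --> \oo] --> 0 -> u n @[n --> \oo] --> 0.
Proof.
move=> uv v0; apply/norm_cvg0P; apply: (squeeze_cvgr _ (cvg_cst 0) v0).
by apply: nearW => n; rewrite uv normr_ge0.
Qed.

(** * Expectations of real random variables *)

Section Expectation.
Context {R : realType} {d : measure_display} {T : measurableType d}
  (P : probability T R).
Implicit Types f g : T -> R.

Definition itg f := P.-integrable setT (EFin \o f).
Definition Ex f : R := (\int[P]_x f x)%R.

Lemma itg_meas f : itg f -> measurable_fun setT f.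
Proof. by move=> /integrableP[/measurable_EFinP]. Qed.

Lemma itg_le f g : measurable_fun setT f -> itg g -> (forall x, `|f x| <= g x) -> itg f.
Proof.
move=> mf ig fg; apply: (le_integrable _ _ _ ig) => //; first exact/measurable_EFinP.
move=> x _ /=; rewrite lee_fin (le_trans (fg x))// ler_norm//.
Qed.

Lemma itg_cst (c : R) : itg (fun=> c).
Proof. exact: finite_measure_integrable_cst. Qed.

Lemma itg_bounded f (M : R) : measurable_fun setT f -> (forall x, `|f x| <= M) -> itg f.
Proof. by move=> mf fM; apply: (itg_le mf (itg_cst M)). Qed.

Lemma itgD f g : itg f -> itg g -> itg (fun x => f x + g x).
Proof. by move=> If Ig; exact: (integrableD measurableT If Ig). Qed.

Lemma itgB f g : itg f -> itg g -> itg (fun x => f x - g x).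
Proof. by move=> If Ig; exact: (integrableB measurableT If Ig). Qed.

Lemma itgZ (c : R) f : itg f -> itg (fun x => c * f x).
Proof. by move=> If; exact: (integrableZl measurableT c If). Qed.

Lemma itg_sum (I : Type) (r : seq I) (F : I -> T -> R) :
  (forall i, itg (F i)) -> itg (fun x => \sum_(i <- r) F i x).
Proof.
move=> iF; elim: r => [|i r IH].
  by under eq_fun do rewrite big_nil; exact: itg_cst.
by under eq_fun do rewrite big_cons; exact: itgD.
Qed.

Lemma EFin_Ex f : itg f -> (Ex f)%:E = (\int[P]_x (f x)%:E)%E.
Proof. by move=> If; rewrite /Ex /Rintegral fineK//; apply: integrable_fin_num. Qed.

Lemma Ex_cst (c : R) : Ex (fun=> c) = c.
Proof. by rewrite /Ex Rintegral_cst// [X in fine X](@probability_setT _ _ _ P) mulr1. Qed.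

Lemma ExD f g : itg f -> itg g -> Ex (fun x => f x + g x) = Ex f + Ex g.
Proof. by move=> If Ig; exact: RintegralD. Qed.

Lemma ExB f g : itg f -> itg g -> Ex (fun x => f x - g x) = Ex f - Ex g.
Proof. by move=> If Ig; exact: RintegralB. Qed.

Lemma ExZ (c : R) f : itg f -> Ex (fun x => c * f x) = c * Ex f.
Proof. by move=> If; exact: RintegralZl. Qed.

Lemma Ex_sum (I : Type) (r : seq I) (F : I -> T -> R) :
  (forall i, itg (F i)) -> Ex (fun x => \sum_(i <- r) F i x) = \sum_(i <- r) Ex (F i).
Proof.
move=> iF; elim: r => [|i r IH].
  by rewrite big_nil; under eq_fun do rewrite big_nil; exact: Ex_cst.
rewrite big_cons -IH -ExD//; last exact: itg_sum.
by congr Ex; apply/funext => x; rewrite big_cons.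
Qed.

Lemma Ex_le f g : itg f -> itg g -> (forall x, f x <= g x) -> Ex f <= Ex g.
Proof. by move=> If Ig fg; apply: le_Rintegral. Qed.

Lemma Ex_ge0 f : (forall x, 0 <= f x) -> 0 <= Ex f.
Proof. by move=> f0; apply: Rintegral_ge0. Qed.

Lemma itg_norm f : itg f -> itg (fun x => `|f x|).
Proof. by move=> If; exact: (integrable_norm If). Qed.

Lemma normr_Ex f : itg f -> `|Ex f| <= Ex (fun x => `|f x|).
Proof. by move=> If; apply: le_normr_Rintegral. Qed.

Lemma normr_Ex_le f g : itg f -> itg g -> (forall x, `|f x| <= g x) -> `|Ex f| <= Ex g.
Proof.
by move=> If Ig fg; apply: (le_trans (normr_Ex If)); apply: Ex_le => //; exact: itg_norm.
Qed.

Lemma normr_Ex_bounded f (M : R) : measurable_fun setT f -> (forall x, `|f x| <= M) ->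
  `|Ex f| <= M.
Proof.
move=> mf fM; rewrite -(Ex_cst M); apply: normr_Ex_le => //; last exact: itg_cst.
exact: (itg_bounded mf fM).
Qed.

Lemma itg_indic (A : set T) : measurable A -> itg (\1_A).
Proof.
move=> mA; apply: (@itg_bounded _ 1); first exact: measurable_indic.
by move=> x; rewrite indicE; case: (x \in A); rewrite ?normr1 ?normr0.
Qed.

Lemma itgM_indic (A : set T) f : measurable A -> itg f -> itg (fun x => \1_A x * f x).
Proof.
move=> mA If; apply: (itg_le _ (itg_norm If)).
  by apply: measurable_funM; [exact: measurable_indic|exact: itg_meas].
by move=> x; rewrite normrM indicE; case: (x \in A); rewrite ?normr1 ?normr0 ?mul1r ?mul0r.
Qed.

Lemma Ex_indic (A : set T) : measurable A -> (Ex \1_A)%:E = P A.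
Proof. by move=> mA; rewrite EFin_Ex ?integral_indic ?setIT//; exact: itg_indic. Qed.

Lemma itg_ge0P f : measurable_fun setT f -> (forall x, 0 <= f x) ->
  (\int[P]_x (f x)%:E < +oo)%E -> itg f.
Proof.
move=> mf f0 lty; apply/integrableP; split; first exact/measurable_EFinP.
by under eq_integral do rewrite /= ger0_norm//.
Qed.

(** For nonnegative functions the integral is a supremum over the simple functions below, which
    grows with the integrand even without measurability; the general case compares positive and
    negative parts. It serves integrands such as [f (Y N w)]. *)
Lemma le_integral_nonmeasurable (f g : T -> \bar R) : (forall x, f x <= g x)%E ->
  (\int[P]_x f x <= \int[P]_x g x)%E.
Proof.
move=> fg.
have ge0 (u v : T -> \bar R) : (forall x, 0 <= u x)%E -> (forall x, u x <= v x)%E ->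
    (\int[P]_x u x <= \int[P]_x v x)%E.
  move=> u0 uv; have v0 x : (0 <= v x)%E := le_trans (u0 x) (uv x).
  rewrite !ge0_integralTE//; apply: le_ereal_sup => _ [h /= hu <-]; exists h => //= x.
  exact: le_trans (hu x) (uv x).
rewrite integralE [leRHS]integralE; apply: leeB; apply: ge0 => // x.
- by rewrite !funeposE ge_max le_max fg /= le_max lexx orbT.
- by rewrite !funenegE ge_max le_max leeN2 fg /= le_max lexx orbT.
Qed.

End Expectation.

(** * Cosine transform of a centered normal law *)

Section GaussianCharacteristic.
Context {R : realType}.
Variable s : R.
Hypothesis s_neq0 : s != 0.
Local Notation mu := (@lebesgue_measure R).
Local Notation g := (normal_pdf 0 s).

Lemma integral_normal_prob (f : R -> R) (M : R) : measurable_fun setT f ->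
  (forall x, `|f x| <= M) ->
  (\int[normal_prob 0 s]_x (f x)%:E = \int[mu]_x (f x * g x)%:E)%E.
Proof.
move=> mf fM.
have := @Radon_Nikodym_change_of_variables _ _ R (normal_prob (0:R) s) mu
  (normal_prob_dominates 0 s) (EFin \o f) setT measurableT.
move=> <-; last exact: (@itg_bounded _ _ _ (normal_prob (0:R) s) _ _ mf fM).
have mgE : measurable_fun [set: R] (EFin \o g).
  by apply/measurable_EFinP; exact: measurable_normal_pdf.
have RN := @Radon_Nikodym_integrable _ _ R
  (charge_of_finite_measure (normal_prob (0:R) s)) mu (normal_prob_dominates 0 s).
apply: ae_eq_integral => //.
- apply: emeasurable_funM; first exact/measurable_EFinP.
  exact: (measurable_int _ RN).
- apply/measurable_EFinP; apply: measurable_funM => //; exact: measurable_normal_pdf.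
- have : ae_eq mu setT
      (Radon_Nikodym (charge_of_finite_measure (normal_prob (0:R) s)) mu) (EFin \o g).
    apply: integral_ae_eq => //.
    move=> E _ mE; rewrite -Radon_Nikodym_integral//; exact: normal_prob_dominates.
  by apply: filterS => x /= /(_ I) -> _.
Qed.

Lemma is_derive_normal_pdf (x : R) : is_derive x 1 g (- x / s ^+ 2 * g x).
Proof.
rewrite normal_pdfE// /normal_fun.
apply: trigger_derive; rewrite /GRing.scale /= ?mulr1 ?subr0 ?add0r ?addr0.
have : s ^+ 2 != 0 by rewrite expf_neq0.
move: (normal_peak s) (expR _) => a b s20.
rewrite -mulr_natr; field => //.
Qed.

(** Up to a constant, the density at scale s is the density at scale sqrt 2 s times exp (- x^2 / (4
    s^2)), and this factor absorbs linear growth. First moments are thus dominated by a wider normal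
    density. *)
Lemma normr_normal_pdf_le : exists K : R, forall x,
  (1 + `|x|) * g x <= K * normal_pdf 0 (Num.sqrt 2 * s) x.
Proof.
have s2 : Num.sqrt 2 * s != 0 by rewrite mulf_neq0// sqrtr_eq0 -ltNge.
have p0 := normal_peak_gt0 s2; have p1 := normal_peak_gt0 s_neq0.
exists (normal_peak s / normal_peak (Num.sqrt 2 * s) * (1 + `|s|)) => {}x.
rewrite !normal_pdfE// /normal_fun !subr0.
set p := normal_peak s; set q := normal_peak _.
have E : expR (- x ^+ 2 / (s ^+ 2 *+ 2)) =
   expR (- x ^+ 2 / ((Num.sqrt 2 * s) ^+ 2 *+ 2)) * expR (- (x ^+ 2 / s ^+ 2) / 4).
  rewrite -expRD; congr (expR _); rewrite exprMn sqr_sqrtr//.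
  rewrite -[s ^+ 2 *+ 2]mulr_natr -[_ * s ^+ 2 *+ 2]mulr_natr.
  by field.
rewrite E; set a := expR (- x ^+ 2 / ((Num.sqrt 2 * s) ^+ 2 *+ 2)).
have -> : p / q * (1 + `|s|) * (q * a) = p * a * (1 + `|s|).
  by rewrite -[LHS]mulrA; field; rewrite gt_eqF.
set y := x ^+ 2 / s ^+ 2.
rewrite [leLHS](_ : _ = p * a * ((1 + `|x|) * expR (- y / 4))); last by ring.
rewrite ler_pM2l ?mulr_gt0 ?expR_gt0// mulNr expRN ler_pdivrMr ?expR_gt0//.
have y0 : 0 <= y by rewrite divr_ge0 ?sqr_ge0.
have Hy : 1 + y / 4 <= expR (y / 4) by exact: expR_ge1Dx.
have Hx : `|x| <= `|s| * (1 + y / 4).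
  have sp : 0 < `|s| by rewrite normr_gt0.
  have -> : y = (`|x| / `|s|) ^+ 2 by rewrite expr_div_n !real_normK ?num_real.
  rewrite -ler_pdivrMl// mulrC; set z := `|x| / `|s|.
  have := sqr_ge0 (1 - z / 2); nra.
have s0 : 0 <= `|s| by [].
nra.
Qed.


Variable b : R.

Local Notation kern u x := ((x / s ^+ 2 * sin (b + u * x) - u * cos (b + u * x)) * g x).

Lemma integrable_moment_normal_pdf (f : R -> R) (C : R) : measurable_fun setT f ->
  (forall x, `|f x| <= C * (1 + `|x|)) ->
  mu.-integrable setT (EFin \o (fun x => f x * g x)).
Proof.
move=> mf fC; have [K hK] := normr_normal_pdf_le.
have iN := integrableZl measurableT (C * K) (integrable_normal_pdf 0 (Num.sqrt 2 * s)).
apply: (le_integrable _ _ _ iN) => //.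
  by apply/measurable_EFinP; apply: measurable_funM => //; exact: measurable_normal_pdf.
move=> x _ /=; rewrite lee_fin; set N := normal_pdf _ (_ * _) _.
have C0 : 0 <= C by have := fC 0; rewrite normr0 addr0 mulr1; apply: le_trans.
have K0 : 0 <= K * N.
  by apply: le_trans (hK x); rewrite mulr_ge0 ?normal_pdf_ge0// addr_ge0.
have -> : `|C * K * N| = C * (K * N) by rewrite -mulrA ger0_norm// mulr_ge0.
rewrite normrM (ger0_norm (normal_pdf_ge0 _ _ _)).
apply: (@le_trans _ _ (C * (1 + `|x|) * g x)); first by rewrite ler_wpM2r ?normal_pdf_ge0.
by rewrite -mulrA; apply: ler_wpM2l.
Qed.

Lemma normal_pdf_cvg0 :
  g n.+1%:R @[n --> \oo] --> 0 /\ g (- n.+1%:R) @[n --> \oo] --> 0.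
Proof.
have [K hK] := normr_normal_pdf_le.
have s2 : Num.sqrt 2 * s != 0 by rewrite mulf_neq0// sqrtr_eq0 -ltNge.
pose L := `|K| * normal_peak (Num.sqrt 2 * s).
have gb x : `|g x| <= L / (1 + `|x|).
  rewrite ger0_norm ?normal_pdf_ge0// ler_pdivlMr ?ltr_pwDl// mulrC (le_trans (hK x))//.
  apply: (@le_trans _ _ (`|K| * normal_pdf 0 (Num.sqrt 2 * s) x)).
    by apply: ler_wpM2r; rewrite ?normal_pdf_ge0 ?ler_norm.
  by apply: ler_wpM2l => //; exact: normal_pdf_ub.
have L0 : 0 <= L by rewrite mulr_ge0// normal_peak_ge0.
have cv : L * (n.+1%:R)^-1 @[n --> \oo] --> (0:R).
  by rewrite -[X in _ --> X](mulr0 L); apply: cvgM; [exact: cvg_cst|exact: cvg_harmonic].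
by split; apply: (norm_squeeze0 _ cv) => n; apply: (le_trans (gb _)); apply: ler_wpM2l => //;
  rewrite ?normrN ger0_norm// lef_pV2 ?posrE// nat1r ler_nat.
Qed.

(** [kern u] is the derivative of - sin (b + u x) g x, which tends to 0 at both ends. The
    fundamental theorem of calculus on [-(n+1), n+1] and dominated convergence conclude. *)
Lemma gaussian_integration_by_parts (u : R) : (\int[mu]_x kern u x = 0)%R.
Proof.
pose H x := - (sin (b + u * x) * g x).
have cg : continuous (g : R -> R) by exact: continuous_normal_pdf.
have dH (x : R) : is_derive x 1 H (kern u x).
  have := is_derive_normal_pdf x => dg.
  rewrite /H; apply: trigger_derive; rewrite /GRing.scale /=; ring.
have cu : continuous (fun x : R => b + u * x).
  by move=> x; apply: (@cvgD _ R^o); [exact: cvg_cst|exact: mulrl_continuous].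
have csin : continuous (fun x : R => sin (b + u * x)).
  by move=> x; apply: continuous_comp; [exact: cu|exact: continuous_sin].
have ccos : continuous (fun x : R => cos (b + u * x)).
  by move=> x; apply: continuous_comp; [exact: cu|exact: continuous_cos].
have ck1 : continuous (fun x : R => x / s ^+ 2 * sin (b + u * x) - u * cos (b + u * x)).
  move=> x; apply: (@cvgB _ R^o); apply: cvgM.
  - by apply: cvgM; [exact: cvg_id|exact: cvg_cst].
  - exact: csin.
  - exact: cvg_cst.
  - exact: ccos.
have ck : continuous (fun x : R => kern u x).
  by move=> x; apply: cvgM; [exact: ck1|exact: cg].
have ik : mu.-integrable setT (EFin \o (fun x : R => kern u x)).
  apply: (@integrable_moment_normal_pdf _ (`|(s ^+ 2)^-1| + `|u|)).
    exact: continuous_measurable_fun.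
  move=> x; apply: (le_trans (ler_normB _ _)); rewrite !normrM.
  have := cos_max (b + u * x); have := sin_max (b + u * x).
  have := normr_ge0 x; have := normr_ge0 u; have := normr_ge0 ((s ^+ 2)^-1).
  have := normr_ge0 (sin (b + u * x)); have := normr_ge0 (cos (b + u * x)).
  move: `|x| `|u| `|_^-1| `|sin _| `|cos _| => ax au c p q *.
  have : ax * c * p <= ax * c by rewrite ler_piMr// mulr_ge0.
  have : au * q <= au by rewrite ler_piMr.
  have axu : 0 <= ax * au by rewrite mulr_ge0.
  nra.
have cH : continuous H.
  by move=> x; apply: (@cvgN _ R^o); apply: (@cvgM R); [exact: csin|exact: cg].
pose I n : set R := `[- n.+1%:R, n.+1%:R]%classic.
have FTC n : (\int[mu]_(x in I n) (kern u x)%:E)%E =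
    (H n.+1%:R - H (- n.+1%:R))%:E.
  rewrite (@continuous_FTC2 _ (fun x => kern u x) H) ?EFinB//.
  - by rewrite gtrN.
  - exact: continuous_subspaceT.
  - by split => [x _||]; [exact: @ex_derive|apply: cvg_at_right_filter; exact: cH
                         |apply: cvg_at_left_filter; exact: cH].
  - by move=> x _; rewrite derive1E derive_val.
have H0 : (H n.+1%:R - H (- n.+1%:R))%:E @[n --> \oo] --> 0%:E.
  apply: cvg_EFin; first exact: nearW.
  have [g0 gN0] := normal_pdf_cvg0.
  have Hg (x : R) : `|H x| <= g x.
    by rewrite normrN normrM (ger0_norm (normal_pdf_ge0 _ _ _)) ler_piMl ?normal_pdf_ge0 ?sin_max.
  rewrite -[X in _ --> X](subr0 0); apply: (@cvgB _ R^o).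
    by apply: (norm_squeeze0 _ g0) => n; exact: Hg.
  by apply: (norm_squeeze0 _ gN0) => n; exact: Hg.
have DCT : (\int[mu]_(x in I n) (kern u x)%:E)%E @[n --> \oo] -->
    (\int[mu]_x (kern u x)%:E)%E.
  have -> : (fun n => \int[mu]_(x in I n) (kern u x)%:E)%E =
     (fun n => \int[mu]_x ((fun x => (kern u x)%:E) \_ (I n)) x)%E.
    by apply/funext => n; rewrite integral_mkcond.
  apply: (@dominated_cvg _ _ _ mu setT measurableT
    (fun n => (fun x => (kern u x)%:E) \_ (I n)) (fun x => (kern u x)%:E)
    (fun x => `|kern u x|%:E)) => //.
  - move=> n; apply/(measurable_restrictT _ _).1; first exact: measurable_itv.
    exact: (measurable_funS measurableT (@subsetT _ _) (measurable_int _ ik)).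
  - move=> x _; apply: cvg_near_cst; near=> n.
    rewrite patchE; case: ifPn => //; rewrite notin_setE /I/= in_itv/= -ler_norml => /negP.
    case/negP; apply: (le_trans (ltW (archi_boundP (normr_ge0 x)))).
    by rewrite ler_nat leqW//; near: n; exact: nbhs_infty_ge.
  - exact: (integrable_norm ik).
  - move=> n x _; rewrite patchE; case: ifPn => //= _; rewrite ?normr0 lee_fin//.
have FTC' : (fun n => \int[mu]_(x in I n) (kern u x)%:E)%E =
    (fun n => (H n.+1%:R - H (- n.+1%:R))%:E) by apply/funext.
rewrite FTC' in DCT.
by rewrite /Rintegral (cvg_unique (@ereal_hausdorff R) DCT H0).
Unshelve. all: by end_near. Qed.

(** The phase [b] makes one real function carry both the cosine and the sine transform, so that no
    complex numbers occur. *)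
Definition gauss_cos (u : R) : R := (\int[mu]_x (cos (b + u * x) * g x))%R.

(** Differentiation under the integral produces - E (x sin (b + u x)), and the integration by parts
    above turns it into - s^2 u E (cos (b + u x)). *)
Lemma is_derive_gauss_cos (u : R) : is_derive u 1 gauss_cos (- (s ^+ 2 * u) * gauss_cos u).
Proof.
have mg : measurable_fun setT g by exact: measurable_normal_pdf.
pose f (u x : R) := cos (b + u * x) * g x.
have dfu (v x : R) : is_derive v 1 (f ^~ x) (- x * sin (b + v * x) * g x).
  rewrite /f; apply: trigger_derive; rewrite /GRing.scale /=; ring.
have mtrig (h : R -> R) v : continuous h -> measurable_fun setT (fun x : R => h (b + v * x)).
  move=> ch; apply: continuous_measurable_fun => x; apply: continuous_comp; last exact: ch.
  by apply: (@cvgD _ R^o); [exact: cvg_cst|exact: mulrl_continuous].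
have intcos v : mu.-integrable setT (EFin \o f v).
  apply: (@integrable_moment_normal_pdf _ 1).
    by apply: mtrig; exact: continuous_cos.
  by move=> x; rewrite mul1r (le_trans (cos_max _))// lerDl.
have intsin v : mu.-integrable setT (EFin \o (fun x => - x * sin (b + v * x) * g x)).
  apply: (@integrable_moment_normal_pdf _ 1).
    by apply: measurable_funM; [exact: measurable_funN|apply: mtrig; exact: continuous_sin].
  move=> x; rewrite mul1r normrM normrN (@le_trans _ _ `|x|)// ?lerDr//.
  by rewrite ler_piMr// sin_max.
have ua : `]u - 1, u + 1[%classic u by rewrite /= in_itv/=; apply/andP; split; lra.
have intG : mu.-integrable setT (EFin \o (fun x => `|x| * g x)).
  apply: (@integrable_moment_normal_pdf _ 1); first exact: (@normr_measurable R setT).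
  by move=> x; rewrite mul1r normr_id lerDr.
have d1E : @partial1of2 R _ f = fun v x => - x * sin (b + v * x) * g x.
  by apply/funext => v; apply/funext => x; rewrite partial1of2E derive_val.
have A1 v x : `]u - 1, u + 1[%classic v -> setT x -> derivable (f ^~ x) v 1.
  by move=> _ _; exact: ex_derive.
have A2 x : 0 <= `|x| * g x by rewrite mulr_ge0 ?normal_pdf_ge0.
have A3 v x : `]u - 1, u + 1[%classic v -> setT x ->
    `|@partial1of2 R _ f v x| <= `|x| * g x.
  move=> _ _; rewrite d1E normrM (ger0_norm (normal_pdf_ge0 _ _ _)).
  by rewrite ler_wpM2r ?normal_pdf_ge0// normrM normrN ler_piMr// sin_max.
apply: DeriveDef.
  exact: (derivable_under_integral measurableT ua (fun v _ => intcos v) A1 A2 intG A3).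
rewrite -derive1E.
rewrite (differentiation_under_integral measurableT ua (fun v _ => intcos v) A1 A2 intG A3) d1E.
have := gaussian_integration_by_parts u.
have -> : (fun x => kern u x) =
    (fun x => - (s ^+ 2)^-1 * (- x * sin (b + u * x) * g x) - u * (cos (b + u * x) * g x)).
  by apply/funext => x; ring.
rewrite RintegralB//; [|exact: (integrableZl measurableT _ (intsin u))
  |exact: (integrableZl measurableT _ (intcos u))].
rewrite (RintegralZl _ measurableT (intsin u)) (RintegralZl _ measurableT (intcos u)) => E.
rewrite /gauss_cos; have s20 : s ^+ 2 != 0 by rewrite expf_neq0.
move: E; set A := Rintegral _ _ _; set B := Rintegral _ _ _ => E.
have -> : A = - s ^+ 2 * (- (s ^+ 2)^-1 * A) by field.
have -> : - (s ^+ 2)^-1 * A = u * B by lra.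
ring.
Qed.

Lemma integral_cos_normal_prob :
  (\int[normal_prob 0 s]_x (cos (b + x))%:E = (cos b * expR (- s ^+ 2 / 2))%:E)%E.
Proof.
have mc : measurable_fun setT (fun x : R => cos (b + 1 * x)).
  apply: continuous_measurable_fun => x; apply: continuous_comp; last exact: continuous_cos.
  by apply: (@cvgD _ R^o); [exact: cvg_cst|exact: mulrl_continuous].
have ic : mu.-integrable setT (EFin \o (fun x => cos (b + 1 * x) * g x)).
  apply: (@integrable_moment_normal_pdf _ 1) => // x.
  by rewrite !mul1r (le_trans (cos_max _))// lerDl.
under eq_integral => x _ do rewrite -[x in cos (b + x)]mul1r.
rewrite (integral_normal_prob mc (fun x => cos_max _)).
have -> : (\int[mu]_x (cos (b + 1 * x) * g x)%:E = (gauss_cos 1)%:E)%E.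
  by rewrite /gauss_cos /Rintegral fineK//; exact: (integrable_fin_num _ ic).
congr EFin.
(* Integrating factor of the differential equation: [h] has zero derivative, so its values at 1 and
   0 agree. *)
pose h u := gauss_cos u * expR (s ^+ 2 * u ^+ 2 / 2).
have h10 : h 1 = h 0.
  apply: is_derive_0_is_cst => u; have := is_derive_gauss_cos u => dF.
  rewrite /h; apply: trigger_derive; rewrite /GRing.scale /= !mulr0 add0r !mulr1.
  by move: (expR _) (gauss_cos _) => e G; field.
have E : gauss_cos 1 * expR (s ^+ 2 / 2) = gauss_cos 0.
  have -> : gauss_cos 0 = h 0.
    by rewrite /h (_ : s ^+ 2 * 0 ^+ 2 / 2 = 0) ?expR0 ?mulr1//; ring.
  by rewrite -h10 /h (_ : s ^+ 2 * 1 ^+ 2 = s ^+ 2) //; ring.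
have -> : gauss_cos 1 = gauss_cos 0 * expR (- s ^+ 2 / 2).
  by rewrite -E -mulrA -expRD mulNr subrr expR0 mulr1.
congr (_ * _); rewrite /gauss_cos.
under eq_Rintegral => x _ do rewrite mul0r addr0.
rewrite RintegralZl//; last exact: integrable_normal_pdf.
by rewrite /Rintegral integral_normal_pdf mulr1.
Qed.

End GaussianCharacteristic.

(** * Independence of two random variables, products of expectations, pi-systems *)

Section Independence.
Context {R : realType} {d : measure_display} {T : measurableType d}
  (P : probability T R).

Definition indep2 (F G : T -> R) := forall A B : set R, measurable A -> measurable B ->
  P (F @^-1` A `&` G @^-1` B) = (P (F @^-1` A) * P (G @^-1` B))%E.

Lemma indep2_comp (F G f g : T -> R) (p q : R -> R) : indep2 F G ->
  measurable_fun setT p -> measurable_fun setT q ->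
  f = p \o F -> g = q \o G -> indep2 f g.
Proof.
move=> FG mp mq -> -> A B mA mB; apply: (FG (p @^-1` A) (q @^-1` B)).
  by rewrite -[X in measurable X]setTI; apply: mp.
by rewrite -[X in measurable X]setTI; apply: mq.
Qed.

(** The joint law is the product of the marginals, so Tonelli applies. Both sides may be infinite;
    in this form the identity applies to exponential moments before they are known to be finite. *)
Lemma integral_abs_indep2 (F G : T -> R) : indep2 F G ->
  measurable_fun setT F -> measurable_fun setT G ->
  (\int[P]_x `|(F x * G x)%:E| = \int[P]_x `|(F x)%:E| * \int[P]_x `|(G x)%:E|)%E.
Proof.
move=> FG mF mG.
pose X : {mfun T >-> R} := HB.pack F (@isMeasurableFun.Build _ _ _ _ F mF).
pose Y : {mfun T >-> R} := HB.pack G (@isMeasurableFun.Build _ _ _ _ G mG).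
have mXY : measurable_fun setT (fun w => (F w, G w)) by exact: measurable_fun_pair.
pose XY : {mfun T >-> (R * R)%type} :=
  HB.pack (fun w => (F w, G w)) (@isMeasurableFun.Build _ _ _ _ _ mXY).
pose muX := distribution P X; pose muY := distribution P Y; pose muXY := distribution P XY.
have prodE A : measurable A -> (muX \x muY)%E A = muXY A.
  by apply: product_measure_unique => U V mU mV; exact: FG.
pose h (z : R * R) : \bar R := (z.1 * z.2)%:E.
have mh : measurable_fun setT h.
  by apply/measurable_EFinP; apply: measurable_funM.
have mah : measurable_fun setT (fun z => `|h z|)%E by exact: measurableT_comp.
transitivity (\int[muXY]_z `|h z|)%E.
  rewrite ge0_integral_distribution//; exact: measurableT_comp.
rewrite -(eq_measure_integral _ (fun A mA _ => prodE A mA)).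
rewrite fubini_tonelli1//.
rewrite /fubini_F/= /h/=.
have mn : measurable_fun setT (fun x : R => `|x|%:E).
  by apply/measurable_EFinP; exact: (@normr_measurable R setT).
transitivity (\int[muX]_x (`|x|%:E * \int[muY]_y `|y|%:E))%E.
  apply: eq_integral => x _; under eq_integral => y _ do rewrite normrM EFinM.
  by rewrite ge0_integralZl_EFin.
rewrite ge0_integralZr//; last exact: integral_ge0.
rewrite (@ge0_integral_distribution _ _ _ _ _ _ X (fun x => `|x|%:E))//.
rewrite (@ge0_integral_distribution _ _ _ _ _ _ Y (fun x => `|x|%:E))//.
Qed.

Lemma Ex_indep2 (F G : T -> R) : indep2 F G -> itg P F -> itg P G ->
  itg P (fun x => F x * G x) /\ Ex P (fun x => F x * G x) = Ex P F * Ex P G.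
Proof.
move=> FG iF iG; have mF := itg_meas iF; have mG := itg_meas iG.
pose X : {mfun T >-> R} := HB.pack F (@isMeasurableFun.Build _ _ _ _ F mF).
pose Y : {mfun T >-> R} := HB.pack G (@isMeasurableFun.Build _ _ _ _ G mG).
have mXY : measurable_fun setT (fun w => (F w, G w)) by exact: measurable_fun_pair.
pose XY : {mfun T >-> (R * R)%type} :=
  HB.pack (fun w => (F w, G w)) (@isMeasurableFun.Build _ _ _ _ _ mXY).
pose muX := distribution P X; pose muY := distribution P Y; pose muXY := distribution P XY.
have prodE A : measurable A -> (muX \x muY)%E A = muXY A.
  by apply: product_measure_unique => U V mU mV; exact: FG.
pose h (z : R * R) : \bar R := (z.1 * z.2)%:E.
have mh : measurable_fun setT h.
  by apply/measurable_EFinP; apply: measurable_funM.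
have mah : measurable_fun setT (fun z => `|h z|)%E by exact: measurableT_comp.
have absE := integral_abs_indep2 FG mF mG.
have finF : (\int[P]_x `|(F x)%:E| < +oo)%E by have /integrableP[] := iF.
have finG : (\int[P]_x `|(G x)%:E| < +oo)%E by have /integrableP[] := iG.
have iFG : itg P (fun x => F x * G x).
  apply/integrableP; split; first exact/measurable_EFinP/measurable_funM.
  rewrite [ltLHS]absE lte_mul_pinfty// ?integral_ge0//.
  by rewrite ge0_fin_numE// integral_ge0.
split => //; apply: EFin_inj; rewrite EFinM !EFin_Ex//.
have ihXY : muXY.-integrable setT h.
  apply/integrableP; split => //.
  rewrite (@ge0_integral_distribution _ _ _ _ _ _ XY (fun z => `|h z|)%E)//.
    by have /integrableP[] := iFG.
have ih : (muX \x muY)%E.-integrable setT h.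
  apply/integrableP; split => //.
  by rewrite (eq_measure_integral _ (fun A mA _ => prodE A mA)); have /integrableP[] := ihXY.
transitivity (\int[muXY]_z h z)%E.
  by rewrite (@integral_distribution _ _ _ _ _ _ XY h).
rewrite -(eq_measure_integral _ (fun A mA _ => prodE A mA)) -integral12_prod_meas1//.
have mne : measurable_fun setT (fun x : R => `|x%:E|%E) by exact: measurableT_comp.
have iX : muX.-integrable setT EFin.
  apply/integrableP; split => //.
  by rewrite (@ge0_integral_distribution _ _ _ _ _ _ X (fun x => `|x%:E|%E)).
have iY : muY.-integrable setT EFin.
  apply/integrableP; split => //.
  by rewrite (@ge0_integral_distribution _ _ _ _ _ _ Y (fun x => `|x%:E|%E)).
have EY : (\int[muY]_y y%:E = (Ex P G)%:E)%E.
  by rewrite EFin_Ex// (@integral_distribution _ _ _ _ _ _ Y EFin).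
have EX : (\int[muX]_y y%:E = (Ex P F)%:E)%E.
  by rewrite EFin_Ex// (@integral_distribution _ _ _ _ _ _ X EFin).
rewrite /fubini_F/= /h/=.
transitivity (\int[muX]_x (x%:E * (Ex P G)%:E))%E.
  apply: eq_integral => x _; under eq_integral => y _ do rewrite EFinM.
  by rewrite integralZl// EY.
by rewrite integralZr// EX -!EFin_Ex.
Qed.

(** For fixed [B], the finite measures sending A to P (A and B) and to P(A) P(B) agree on a
    pi-system containing the whole space, hence on the sigma-algebra it generates. *)
Lemma indep_sigma_l (G : set (set T)) (B : set T) : measurable B ->
  G `<=` measurable -> setI_closed G -> G setT ->
  (forall A, G A -> P (A `&` B) = (P A * P B)%E) ->
  forall A, <<s G >> A -> P (A `&` B) = (P A * P B)%E.
Proof.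
move=> mB Gm GI GT GB A sA.
have PBE : (fine (P B))%:E = P B by rewrite fineK// fin_num_measure.
have PB0 : 0 <= fine (P B) by rewrite fine_ge0.
pose m2 := mscale (NngNum PB0) P.
transitivity (m2 A).
  apply: (@g_sigma_algebra_measure_unique _ R _ G Gm (fun=> setT) (fun=> GT) _
    (mrestr P mB) m2 GI _ _ A sA).
  - by apply/seteqP; split => // x _; exists 0%N.
  - move=> C GC; transitivity (P C * P B)%E; first exact: GB.
    by rewrite -[in LHS]PBE muleC.
  - move=> k; rewrite /= /mrestr/= setTI; apply: (le_lt_trans (probability_le1 P mB)).
    exact: ltry.
by rewrite -[in RHS]PBE muleC.
Qed.

End Independence.

(** * Taylor bounds for sine and cosine *)

Section TrigonometricBounds.
Context {R : realType}.
Implicit Types x w : R.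

(** Drives the chains of Taylor bounds: each difference vanishes at 0 and has the preceding one as
    its derivative. *)
Lemma ge0_of_derive (f df : R -> R) : (forall x, is_derive x 1 f (df x)) ->
  (forall x, 0 <= x -> 0 <= df x) -> f 0 = 0 -> forall x, 0 <= x -> 0 <= f x.
Proof.
move=> f' df0 f00 x; rewrite le_eqVlt => /predU1P[<-|x0]; first by rewrite f00.
have [|c] := MVT x0 (fun z _ => f' z).
  apply: continuous_subspaceT => z; apply: differentiable_continuous.
  by apply/derivable1_diffP; exact: ex_derive.
rewrite in_itv/= => /andP[c0 _]; rewrite f00 !subr0 => ->.
by rewrite mulr_ge0// ?df0// ltW.
Qed.

(** The remainder of Lindeberg's method. It is at most |w|^p for every p in [2, 3], so that a moment
    slightly above the second controls it. *)
Definition rho w : R := Num.min (w ^+ 2) (`|w| ^+ 3).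

Lemma rhoN w : rho (- w) = rho w.
Proof. by rewrite /rho sqrrN normrN. Qed.

Let sin_le x : 0 <= x -> 0 <= x - sin x.
Proof.
apply: (@ge0_of_derive (fun x => x - sin x) (fun x => 1 - cos x)).
- by move=> y _; rewrite subr_ge0 cos_le1.
- by rewrite sin0 subr0.
Qed.

Let cos_ge x : 0 <= x -> 0 <= cos x - (1 - x ^+ 2 / 2).
Proof.
apply: (@ge0_of_derive (fun x => cos x - (1 - x ^+ 2 / 2)) (fun x => x - sin x)).
- by move=> y; apply: trigger_derive; rewrite /GRing.scale/=; field.
- by [].
- by rewrite cos0 expr0n/=; ring.
Qed.

Let sin_ge x : 0 <= x -> 0 <= sin x - (x - x ^+ 3 / 6).
Proof.
apply: (@ge0_of_derive (fun x => sin x - (x - x ^+ 3 / 6))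
  (fun x => cos x - (1 - x ^+ 2 / 2))) => //.
- by move=> y; apply: trigger_derive; rewrite /GRing.scale/=; field.
- by rewrite sin0 expr0n/=; ring.
Qed.

Let cos_ge1 x : 0 <= x -> 0 <= x - (1 - cos x).
Proof.
apply: (@ge0_of_derive (fun x => x - (1 - cos x)) (fun x => 1 - sin x)) => //.
- by move=> y; apply: trigger_derive; rewrite /GRing.scale/=; field.
- by rewrite cos0; ring.
Qed.

Let sin_ge2 x : 0 <= x -> 0 <= x ^+ 2 / 2 - (x - sin x).
Proof.
apply: (@ge0_of_derive (fun x => x ^+ 2 / 2 - (x - sin x)) (fun x => x - (1 - cos x))) => //.
- by move=> y; apply: trigger_derive; rewrite /GRing.scale/=; field.
- by rewrite sin0 expr0n/=; ring.
Qed.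

Let cos_le3 x : 0 <= x -> 0 <= x ^+ 3 / 6 - (cos x - (1 - x ^+ 2 / 2)).
Proof.
apply: (@ge0_of_derive (fun x => x ^+ 3 / 6 - (cos x - (1 - x ^+ 2 / 2)))
  (fun x => x ^+ 2 / 2 - (x - sin x))) => //.
- by move=> y; apply: trigger_derive; rewrite /GRing.scale/=; field.
- by rewrite cos0 expr0n/=; ring.
Qed.

Lemma cos_ge_parabola w : 0 <= w ^+ 2 / 2 - 1 + cos w.
Proof.
wlog w0 : w / 0 <= w => [h|].
  have [/h//|/ltW w0] := leP 0 w; rewrite -cosN -sqrrN; apply: h; lra.
by have := cos_ge w0; lra.
Qed.

Lemma cos_taylor w : `|cos w - (1 - w ^+ 2 / 2)| <= rho w.
Proof.
wlog w0 : w / 0 <= w => [h|].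
  have [/h//|/ltW w0] := leP 0 w.
  by rewrite -cosN -sqrrN -rhoN; apply: h; lra.
rewrite ger0_norm ?cos_ge// le_min (ger0_norm w0); apply/andP; split.
  by have := cos_le1 w; have := sqr_ge0 w; lra.
by have := cos_le3 w0; have := exprn_ge0 3 w0; lra.
Qed.

Lemma sin_taylor w : `|sin w - w| <= rho w.
Proof.
wlog w0 : w / 0 <= w => [h|].
  have [/h//|/ltW w0] := leP 0 w.
  by rewrite -rhoN -normrN opprB addrC -sinN -[X in _ + X]opprK; apply: h; lra.
rewrite distrC ger0_norm ?sin_le// le_min (ger0_norm w0); apply/andP; split.
  by have := sin_ge2 w0; have := sqr_ge0 w; lra.
by have := sin_ge w0; have := exprn_ge0 3 w0; lra.
Qed.

Lemma sin_sub_le_sqr w : `|sin w - w| <= w ^+ 2.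
Proof. by apply: (le_trans (sin_taylor w)); rewrite /rho ge_min lexx. Qed.

Lemma rho_ge0 w : 0 <= rho w.
Proof. by rewrite le_min sqr_ge0 exprn_ge0. Qed.

Lemma measurable_rho : measurable_fun setT rho.
Proof.
apply: measurable_minr; first exact: measurable_funX.
by apply: measurable_funX; exact: (@normr_measurable R setT).
Qed.

Lemma measurable_cos : measurable_fun setT (cos : R -> R).
Proof. by apply: continuous_measurable_fun; exact: continuous_cos. Qed.

Lemma measurable_sin : measurable_fun setT (sin : R -> R).
Proof. by apply: continuous_measurable_fun; exact: continuous_sin. Qed.

End TrigonometricBounds.

(** * A central limit theorem for cosines of row sums *)

Section CentralLimit.
Context {R : realType} {d : measure_display} {T : measurableType d}
  (P : probability T R).

Lemma itg_bounded_comp (f : T -> R) (g : R -> R) : measurable_fun setT f ->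
  measurable_fun setT g -> (forall x, `|g x| <= 1) -> itg P (fun w => g (f w)).
Proof.
by move=> mf mg g1; apply: (@itg_bounded _ _ _ _ _ 1) => //; exact: measurableT_comp.
Qed.

Lemma itg_rho (f : T -> R) : measurable_fun setT f -> itg P (fun w => f w ^+ 2) ->
  itg P (fun w => rho (f w)).
Proof.
move=> mf i2; apply: (itg_le _ i2) => [|w]; first exact: (measurableT_comp measurable_rho).
by rewrite ger0_norm ?rho_ge0// /rho ge_min lexx.
Qed.

Lemma cos_expectation (W : T -> R) (v r : R) : itg P W -> itg P (fun w => W w ^+ 2) ->
  Ex P (fun w => W w ^+ 2) = v -> Ex P (fun w => rho (W w)) <= r ->
  `|Ex P (fun w => cos (W w)) - (1 - v / 2)| <= r.
Proof.
move=> iW iW2 EW2 Er; have mW := itg_meas iW.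
have i1 : itg P (fun w => 1 - 2^-1 * W w ^+ 2) by apply: itgB; [exact: itg_cst|exact: itgZ].
have -> : 1 - v / 2 = Ex P (fun w => 1 - 2^-1 * W w ^+ 2).
  by rewrite ExB ?ExZ ?Ex_cst ?EW2 1?mulrC//; [exact: itg_cst|exact: itgZ].
have ic : itg P (fun w => cos (W w)).
  exact: (itg_bounded_comp mW measurable_cos (@cos_max R)).
rewrite -ExB//; apply: le_trans Er; apply: normr_Ex_le; first exact: itgB.
  exact: itg_rho.
by move=> w; rewrite [_^-1 * _]mulrC cos_taylor.
Qed.

Lemma sin_expectation (W : T -> R) (r : R) : itg P W -> itg P (fun w => W w ^+ 2) ->
  Ex P W = 0 -> Ex P (fun w => rho (W w)) <= r -> `|Ex P (fun w => sin (W w))| <= r.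
Proof.
move=> iW iW2 EW Er; have mW := itg_meas iW.
have is' : itg P (fun w => sin (W w)).
  exact: (itg_bounded_comp mW measurable_sin (@sin_max R)).
rewrite -[X in `|X|]subr0 -EW -ExB//; apply: le_trans Er; apply: normr_Ex_le.
- exact: itgB.
- exact: itg_rho.
- by move=> w; rewrite sin_taylor.
Qed.

Section Row.
Variables (W : nat -> T -> R) (n : nat) (v r : R).
Local Notation S k := (fun w => \sum_(i < k) W i w).
Hypothesis iW : forall i, itg P (W i).
Hypothesis iW2 : forall i, itg P (fun w => W i w ^+ 2).
Hypothesis EW : forall i, (i < n)%N -> Ex P (W i) = 0.
Hypothesis EW2 : forall i, (i < n)%N -> Ex P (fun w => W i w ^+ 2) = v.
Hypothesis Er : forall i, (i < n)%N -> Ex P (fun w => rho (W i w)) <= r.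
Hypothesis indW : forall i, (i < n)%N -> indep2 P (S i) (W i).

(** Each step expands cos (c + S + W) and factors the expectations of the partial sum S and the next
    term W. Replacing E cos W by 1 - v / 2 and E sin W by 0 costs [r] each, whence 2 r per term; v
    in [0, 2] keeps 1 - v / 2 in [0, 1], so earlier errors are not amplified. *)
Lemma cos_row_sum (b : R) : 0 <= v <= 2 ->
  `|Ex P (fun w => cos (b + S n w)) - (1 - v / 2) ^+ n * cos b| <= 2 * n%:R * r.
Proof.
move=> /andP[v0 v2]; have q1 : `|1 - v / 2| <= 1.
  by rewrite ler_norml; apply/andP; split; lra.
have mS k : measurable_fun setT (S k) by apply: measurable_sum => i; exact: (itg_meas (iW i)).
have msh (h : R -> R) c : measurable_fun setT h -> measurable_fun setT (fun x : R => h (c + x)).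
  by move=> mh; apply: measurableT_comp => //; exact: measurable_funD.
suff : forall k, (k <= n)%N -> forall b,
  `|Ex P (fun w => cos (b + S k w)) - (1 - v / 2) ^+ k * cos b| <= 2 * k%:R * r by exact.
elim=> [_|k IH kn] c.
  rewrite mulr0 mul0r expr0 mul1r.
  under [X in Ex _ X]eq_fun do rewrite big_ord0 addr0.
  by rewrite Ex_cst subrr normr0.
have iC : itg P (fun w => cos (c + S k w)).
  apply: (@itg_bounded _ _ _ _ _ 1) => [|w]; last exact: cos_max.
  exact: (measurableT_comp (msh _ c measurable_cos) (mS k)).
have iS : itg P (fun w => sin (c + S k w)).
  apply: (@itg_bounded _ _ _ _ _ 1) => [|w]; last exact: sin_max.
  exact: (measurableT_comp (msh _ c measurable_sin) (mS k)).
have icW : itg P (fun w => cos (W k w)).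
  exact: (itg_bounded_comp (itg_meas (iW k)) measurable_cos (@cos_max R)).
have isW : itg P (fun w => sin (W k w)).
  exact: (itg_bounded_comp (itg_meas (iW k)) measurable_sin (@sin_max R)).
have [iCc ECc] := Ex_indep2 (indep2_comp (indW kn) (msh _ c measurable_cos) measurable_cos
  erefl erefl) iC icW.
have [iSs ESs] := Ex_indep2 (indep2_comp (indW kn) (msh _ c measurable_sin) measurable_sin
  erefl erefl) iS isW.
have -> : Ex P (fun w => cos (c + S k.+1 w)) =
  Ex P (fun w => cos (c + S k w)) * Ex P (fun w => cos (W k w)) -
  Ex P (fun w => sin (c + S k w)) * Ex P (fun w => sin (W k w)).
  rewrite -ECc -ESs -ExB//; congr Ex; apply/funext => w.
  by rewrite big_ord_recr/= addrA [LHS]cosD.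
have := IH (ltnW kn) c.
have := cos_expectation (iW k) (iW2 k) (EW2 kn) (Er kn).
have := sin_expectation (iW k) (iW2 k) (EW kn) (Er kn).
have A1 : `|Ex P (fun w => cos (c + S k w))| <= 1.
  exact: (normr_Ex_bounded P (itg_meas iC) (fun=> cos_max _)).
have B1 : `|Ex P (fun w => sin (c + S k w))| <= 1.
  exact: (normr_Ex_bounded P (itg_meas iS) (fun=> sin_max _)).
move: A1 B1; set A := Ex P (fun w => cos (c + _)); set B := Ex P (fun w => sin (c + _)).
set C := Ex P (fun w => cos (W k w)); set s := Ex P (fun w => sin (W k w)).
move=> A1 B1 s1 C1 AH; rewrite exprS -natr1.
have -> : A * C - B * s - (1 - v / 2) * (1 - v / 2) ^+ k * cos c =
  A * (C - (1 - v / 2)) - B * s + (1 - v / 2) * (A - (1 - v / 2) ^+ k * cos c) by ring.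
apply: (le_trans (ler_normD _ _)); apply: (le_trans (lerD (ler_normB _ _) (lexx _))).
rewrite !normrM.
have h1 : `|A| * `|C - (1 - v / 2)| <= r.
  by apply: le_trans C1; rewrite ler_piMl.
have h2 : `|B| * `|s| <= r by apply: le_trans s1; rewrite ler_piMl.
have h3 : `|1 - v / 2| * `|A - (1 - v / 2) ^+ k * cos c| <= 2 * k%:R * r.
  by apply: le_trans AH; rewrite ler_piMl.
lra.
Qed.

End Row.

(** Telescoping over the factors: 1 - a and exp (- a) lie in [0, 1] and differ by at most a^2, since
    exp (- a) <= 1 / (1 + a) <= 1 - a + a^2. *)
Lemma expX_approx (n : nat) (a : R) : 0 <= a <= 1 ->
  `|(1 - a) ^+ n - expR (- (n%:R * a))| <= n%:R * a ^+ 2.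
Proof.
move=> /andP[a0 a1].
have step : `|(1 - a) - expR (- a)| <= a ^+ 2.
  have h1 := expR_ge1Dx (- a); rewrite distrC ger0_norm; last by lra.
  have h2 := expR_ge1Dx a.
  have : expR (- a) <= (1 + a)^-1 by rewrite expRN lef_pV2 ?posrE ?expR_gt0//; lra.
  have : (1 + a)^-1 <= 1 - a + a ^+ 2.
    by rewrite -[leLHS]mul1r ler_pdivrMr; last lra; nra.
  lra.
elim: n => [|n IH]; first by rewrite expr0 mul0r oppr0 expR0 subrr normr0 mul0r.
rewrite exprS -natr1 [(_ + 1) * a]mulrDl [(_ + 1) * a ^+ 2]mulrDl !mul1r opprD expRD.
have -> : (1 - a) * (1 - a) ^+ n - expR (- (n%:R * a)) * expR (- a) =
  (1 - a) * ((1 - a) ^+ n - expR (- (n%:R * a))) + expR (- (n%:R * a)) * (1 - a - expR (- a)).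
  by ring.
apply: (le_trans (ler_normD _ _)); rewrite !normrM lerD//.
  apply: le_trans IH; rewrite ler_piMl// ger0_norm; lra.
apply: le_trans step; rewrite ler_piMl// ger0_norm ?expR_ge0//.
by rewrite -expR0 ler_expR oppr_le0 mulr_ge0.
Qed.

(** Independence is phrased between a partial sum and the next term, the form in which the expansion
    of the cosine consumes it. *)
Definition centered_row (W : nat -> T -> R) (n : nat) (v r : R) :=
  [/\ forall i, itg P (W i) /\ itg P (fun w => W i w ^+ 2),
      forall i, (i < n)%N -> Ex P (W i) = 0,
      forall i, (i < n)%N -> Ex P (fun w => W i w ^+ 2) = v,
      forall i, (i < n)%N -> Ex P (fun w => rho (W i w)) <= r &
      forall i, (i < n)%N -> indep2 P (fun w => \sum_(j < i) W j w) (W i)].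

(** With a = v_N / 2 the two preceding estimates leave an error 2 N r_N + N v_N^2 / 4. It vanishes
    because N r_N does and because v_N tends to 0 while N v_N converges. *)
Lemma cos_clt (W : nat -> nat -> T -> R) (vN rN : nat -> R) (v b : R) :
  (\forall N \near \oo, centered_row (W N) N (vN N) (rN N)) ->
  N%:R * vN N @[N --> \oo] --> v -> N%:R * rN N @[N --> \oo] --> 0 ->
  Ex P (fun w => cos (b + \sum_(i < N) W N i w)) @[N --> \oo] --> cos b * expR (- (v / 2)).
Proof.
move=> rowW cv cr.
pose L N := cos b * expR (- (N%:R * vN N / 2)).
have cL : L N @[N --> \oo] --> cos b * expR (- (v / 2)).
  apply: cvgM; first exact: cvg_cst.
  apply: continuous_cvg; first exact: continuous_expR.
  by apply: (@cvgN _ R^o); apply: cvgM => //; exact: cvg_cst.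
have cinv : (N%:R)^-1 @[N --> \oo] --> (0 : R).
  by rewrite -cvg_shiftS; exact: cvg_harmonic.
have cvN : vN N @[N --> \oo] --> 0.
  have : (N%:R)^-1 * (N%:R * vN N) @[N --> \oo] --> 0 * v by exact: cvgM.
  rewrite mul0r; apply: cvg_trans; apply: near_eq_cvg; near=> N.
  by rewrite mulKf// pnatr_eq0 -lt0n; near: N; exact: nbhs_infty_gt.
pose D N := 2 * (N%:R * rN N) + (N%:R * vN N) * vN N / 4.
have cD : D N @[N --> \oo] --> 0.
  rewrite [X in _ --> X](_ : 0 = 2 * 0 + v * 0 / 4); last by ring.
  apply: (@cvgD _ R^o); first by apply: cvgM => //; exact: cvg_cst.
  by apply: cvgM; [exact: cvgM|exact: cvg_cst].
pose E N := Ex P (fun w => cos (b + \sum_(i < N) W N i w)).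
have ED : E N - L N @[N --> \oo] --> 0.
  apply/norm_cvg0P; apply: (squeeze_cvgr _ (cvg_cst 0) cD); near=> N; rewrite normr_ge0/=.
  have N0 : (0 < N)%N by near: N; exact: nbhs_infty_gt.
  have [iW EW EW2 Er ind] : centered_row (W N) N (vN N) (rN N) by near: N.
  have v0 : 0 <= vN N by rewrite -(EW2 0%N)//; apply: Ex_ge0 => w; exact: sqr_ge0.
  have v1 : vN N <= 1.
    by apply: ltW; near: N; exact: (cvgr_lt 0 cvN).
  have := @cos_row_sum (W N) N (vN N) (rN N) (fun i => (iW i).1) (fun i => (iW i).2)
    EW EW2 Er ind b.
  move/(_ (introT andP (conj v0 (le_trans v1 (ler1n _ 2))))).
  rewrite -/(E N) => h1.
  have := @expX_approx N (vN N / 2).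
  have -> : 0 <= vN N / 2 <= 1 by apply/andP; split; lra.
  move=> /(_ isT) h2.
  rewrite /L -[N%:R * vN N / 2]mulrA.
  set q := (1 - vN N / 2) ^+ N in h1 h2; set e := expR _ in h2 *.
  have -> : E N - cos b * e = (E N - q * cos b) + (q - e) * cos b by ring.
  apply: (le_trans (ler_normD _ _)); rewrite /D lerD//.
    by rewrite mulrA.
  rewrite normrM (le_trans (ler_piMr _ (cos_max b)))// (le_trans h2)//.
  by rewrite le_eqVlt; apply/orP; left; apply/eqP; field.
rewrite -[X in _ --> X]add0r.
have -> : (fun N => Ex P (fun w => cos (b + \sum_(i < N) W N i w))) =
  (fun N => (E N - L N) + L N) by apply/funext => N; rewrite subrK.
exact: (@cvgD _ R^o).
Unshelve. all: by end_near. Qed.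

End CentralLimit.

(** * A maximal inequality through first passage *)

Section MaximalInequality.
Context {R : realType}.

(** Real-valued indicator that the first [l] values stay under [e]. As a product it is measurable
    with respect to these values, and [below D e l w - below D e l.+1 w] indicates first passage at
    index [l]. *)
Definition below (U : Type) (D : nat -> U -> R) (e : R) (l : nat) (w : U) : R :=
  \prod_(k < l) (D k w < e)%R%:R.

Lemma belowS U (D : nat -> U -> R) e l w :
  below D e l.+1 w = below D e l w * (D l w < e)%R%:R.
Proof. by rewrite /below big_ord_recr. Qed.

Lemma below01 U (D : nat -> U -> R) e l w : below D e l w = 0 \/ below D e l w = 1.
Proof.
elim: l => [|l IH]; first by right; rewrite /below big_ord0.
by rewrite belowS; case: IH => ->; case: (_ < e); rewrite ?(mulr0, mulr1, mul0r); auto.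
Qed.

Lemma below_eq1 U (D : nat -> U -> R) e l w : below D e l w = 1 ->
  forall k, (k < l)%N -> D k w < e.
Proof.
elim: l => [//|l IH]; rewrite belowS.
have [|/negbTE h] := boolP (D l w < e); last by rewrite mulr0 => /esym/eqP; rewrite oner_eq0.
rewrite mulr1 => Dl /IH h k; rewrite ltnS leq_eqVlt => /orP[/eqP-> //|]; exact: h.
Qed.

Lemma measurable_ind_lt (d : measure_display) (U : measurableType d) (f : U -> R) (e : R) :
  measurable_fun setT f -> measurable_fun setT (fun w => (f w < e)%R%:R : R).
Proof.
move=> mf; rewrite (_ : (fun _ => _) = \1_(f @^-1` `]-oo, e[%classic)).
  by apply: measurable_indic; rewrite -[X in measurable X]setTI; apply: mf.
apply/funext => w; rewrite indicE; congr (_%:R); congr nat_of_bool.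
by apply/idP/idP; [move=> fe; rewrite inE/= in_itv|rewrite inE/= in_itv].
Qed.

Lemma measurable_below (d : measure_display) (U : measurableType d)
    (D : nat -> U -> R) (e : R) (l : nat) :
  (forall k, (k < l)%N -> measurable_fun setT (D k)) -> measurable_fun setT (below D e l).
Proof.
elim: l => [_|l IH mD].
  by rewrite (_ : below _ _ _ = fun=> 1)//; apply/funext => w; rewrite /below big_ord0.
rewrite (_ : below _ _ _ = fun w => below D e l w * (D l w < e)%R%:R); last first.
  by apply/funext => w; rewrite belowS.
apply: measurable_funM; first by apply: IH => k kl; apply: mD; rewrite (ltn_trans kl).
apply: measurable_ind_lt; exact: mD.
Qed.

Context {d : measure_display} {T : measurableType d} (P : probability T R).

(* A convex function with a supporting line of slope [c >= 0] at [e] dominates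
   the maximum of a martingale through the first passage above [e]. *)
Lemma maximal_inequality (D : nat -> T -> R) (phi : R -> R) (n : nat) (e a c : R) :
  (forall k, (k <= n)%N -> itg P (D k)) -> itg P (fun w => phi (D n w)) ->
  (forall y, 0 <= phi y) -> 0 <= c -> (forall y, a + c * (y - e) <= phi y) ->
  (forall l, (l <= n)%N ->
    Ex P (fun w => below D e l w * (e <= D l w)%R%:R * D n w) =
    Ex P (fun w => below D e l w * (e <= D l w)%R%:R * D l w)) ->
  a * Ex P (fun w => 1 - below D e n.+1 w) <= Ex P (fun w => phi (D n w)).
Proof.
move=> iD iphi phi0 c0 line mart.
pose chi l w := below D e l w * (e <= D l w)%R%:R.
have chiE l w : chi l w = below D e l w - below D e l.+1 w.
  rewrite belowS /chi ltNge; case: (e <= _); rewrite ?mulr1 ?mulr0 ?subr0 ?subrr//.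
have chi01 l w : chi l w = 0 \/ chi l w = 1.
  by rewrite /chi; case: (below01 D e l w) => ->; case: (e <= _);
    rewrite ?(mulr0, mulr1, mul0r); auto.
have sumchi m w : \sum_(l < m) chi l w = 1 - below D e m w.
  elim: m => [|m IH]; first by rewrite big_ord0 /below big_ord0 subrr.
  by rewrite big_ord_recr/= IH chiE; ring.
have mchi l : (l <= n)%N -> measurable_fun setT (chi l).
  move=> ln; rewrite (_ : chi l = fun w => below D e l w - below D e l.+1 w); last first.
    by apply/funext => w; exact: chiE.
  apply: measurable_funB; apply: measurable_below => k kl; apply: itg_meas; apply: iD.
    exact: leq_trans (ltnW kl) ln.
  by rewrite ltnS in kl; exact: leq_trans kl ln.
have chib l w : `|chi l w| <= 1 by case: (chi01 l w) => ->; rewrite ?normr0 ?normr1.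
have ichi l : (l <= n)%N -> itg P (chi l).
  by move=> ln; apply: (itg_bounded P (mchi l ln) (chib l)).
have ichiD l k : (l <= n)%N -> (k <= n)%N -> itg P (fun w => chi l w * D k w).
  move=> ln kn; apply: (itg_le _ (itg_norm (iD k kn))).
    by apply: measurable_funM; [exact: mchi|apply: itg_meas; exact: iD].
  by move=> w; rewrite normrM ler_piMl.
have iline l : (l <= n)%N -> itg P (fun w => chi l w * (a + c * (D n w - e))).
  move=> ln; rewrite (_ : (fun _ => _) =
      fun w => (a - c * e) * chi l w + c * (chi l w * D n w)); last first.
    by apply/funext => w; ring.
  by apply: itgD; apply: itgZ; [exact: ichi|exact: ichiD].
pose psi w := \sum_(l < n.+1) chi l w * (a + c * (D n w - e)).
have ipsi : itg P psi.
  by apply: itg_sum => l; apply: iline; rewrite -ltnS.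
have psiphi w : psi w <= phi (D n w).
  rewrite /psi -big_distrl/= sumchi; case: (below01 D e n.+1 w) => ->.
    by rewrite subr0 mul1r.
  by rewrite subrr mul0r.
apply: le_trans (Ex_le ipsi iphi psiphi).
rewrite /psi Ex_sum; last by move=> l; apply: iline; rewrite -ltnS.
have -> : (fun w => 1 - below D e n.+1 w) = (fun w => \sum_(l < n.+1) chi l w).
  by apply/funext => w; rewrite sumchi.
rewrite Ex_sum; last by move=> l; apply: ichi; rewrite -ltnS.
rewrite big_distrr/=; apply: ler_sum => l _; have ln : (l <= n)%N by rewrite -ltnS.
have -> : (fun w => chi l w * (a + c * (D n w - e))) =
    fun w => (a - c * e) * chi l w + c * (chi l w * D n w).
  by apply/funext => w; ring.
have iD' := ichiD l n ln (leqnn n).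
rewrite (ExD (itgZ _ (ichi l ln)) (itgZ _ iD')) (ExZ _ (ichi l ln)) (ExZ _ iD').
rewrite (mart l ln).
have : e * Ex P (chi l) <= Ex P (fun w => chi l w * D l w).
  rewrite -ExZ; last exact: ichi.
  apply: Ex_le; [by apply: itgZ; exact: ichi|exact: ichiD|move=> w].
  rewrite /chi; have [eD|_] := leP e (D l w); last by rewrite !(mulr0, mul0r).
  by rewrite mulr1; case: (below01 D e l w) => ->; rewrite ?(mulr0, mul0r)// mulr1 mul1r.
rewrite -[Ex P (fun w => _ * D l w)]/(Ex P (fun w => chi l w * D l w)).
set x := Ex P (chi l); set y := Ex P (fun w => chi l w * D l w) => xy.
have := ler_wpM2l c0 xy.
lra.
Qed.

End MaximalInequality.

(** * Bernstein polynomials as binomial means *)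

Section Bernstein.
Context {R : realType}.
Implicit Types (p : R) (f g : nat -> R).

(** The mean of f (j + S) for S binomial with parameters [m] and [p], computed one trial at a time.
    For j = 0 and f sampling a function at i / m this is its Bernstein polynomial; the recursion
    gives monotonicity and closure properties without binomial coefficients. *)
Fixpoint bern p (m : nat) f (j : nat) : R :=
  if m is m'.+1 then p * bern p m' f j.+1 + (1 - p) * bern p m' f j else f j.

Lemma bern_le p m f g j : 0 <= p <= 1 -> (forall i, f i <= g i) ->
  bern p m f j <= bern p m g j.
Proof.
move=> /andP[p0 p1] fg; elim: m j => [|m IH] j //=.
by apply: lerD; apply: ler_wpM2l => //; lra.
Qed.

Lemma bern_affine p m f j (a b : R) :
  bern p m (fun i => a * f i + b) j = a * bern p m f j + b.
Proof. by elim: m j => [|m IH] j //=; rewrite !IH; ring. Qed.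

Lemma bern_sqr p m j (a : R) :
  bern p m (fun i => (i%:R - a) ^+ 2) j = (j%:R + m%:R * p - a) ^+ 2 + m%:R * p * (1 - p).
Proof.
elim: m j => [|m IH] j /=; first by rewrite !mul0r; ring.
by rewrite !IH -!natr1; ring.
Qed.

(** With k^2 trials the success frequency deviates from [p] by order 1 / k, so no square root is
    needed in the rate. *)
Lemma bern_approx p (k : nat) f (y C : R) : (0 < k)%N -> 0 <= p <= 1 -> 0 <= C ->
  (forall i, `|f i - y| <= C * `|i%:R / (k ^ 2)%N%:R - p|) ->
  `|bern p (k ^ 2) f 0 - y| <= C / k%:R.
Proof.
move=> k0 p01 C0 fy; set m := (k ^ 2)%N.
have kp : 0 < k%:R :> R by rewrite ltr0n.
have mk : m%:R = k%:R ^+ 2 :> R by rewrite natrX.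
(* The bound |z| <= (k z^2 + 1 / k) / 2 for z = i / m - p, rewritten in i - m p so that the binomial
   variance applies. *)
pose q i : R := (2 * k%:R ^+ 3)^-1 * (i%:R - m%:R * p) ^+ 2 + (2 * k%:R)^-1.
have fq i : `|f i - y| <= C * q i.
  apply: (le_trans (fy i)); rewrite ler_wpM2l// /q -/m mk.
  have -> : i%:R - k%:R ^+ 2 * p = (i%:R / k%:R ^+ 2 - p) * k%:R ^+ 2 by field; rewrite gt_eqF.
  set z := i%:R / _ - p.
  have -> : (2 * k%:R ^+ 3)^-1 * (z * k%:R ^+ 2) ^+ 2 + (2 * k%:R)^-1 =
     (z ^+ 2 * k%:R ^+ 2 + 1) / (2 * k%:R) by field; rewrite gt_eqF.
  rewrite ler_pdivlMr ?mulr_gt0// -[z ^+ 2]real_normK ?num_real//.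
  by have := sqr_ge0 (`|z| * k%:R - 1); nra.
have bq : bern p m q 0 <= k%:R^-1.
  rewrite bern_affine bern_sqr add0r subrr expr0n/= add0r mk.
  have -> : (2 * k%:R ^+ 3)^-1 * (k%:R ^+ 2 * p * (1 - p)) + (2 * k%:R)^-1 =
    (p * (1 - p) + 1) / 2 / k%:R by field; rewrite gt_eqF.
  by rewrite ler_piMl ?invr_ge0 ?ler0n//; case/andP: p01 => p0 p1; nra.
have up : bern p m f 0 <= C * bern p m q 0 + y.
  rewrite -bern_affine; apply: bern_le => // i.
  by have := fq i; rewrite ler_norml => /andP[]; lra.
have lo : - C * bern p m q 0 + y <= bern p m f 0.
  rewrite -bern_affine; apply: bern_le => // i.
  by have := fq i; rewrite ler_norml => /andP[]; lra.
have : C * bern p m q 0 <= C / k%:R by rewrite ler_wpM2l.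
by rewrite ler_norml => h; apply/andP; split; lra.
Qed.

End Bernstein.

(** * Trigonometric functionals and approximation of truncated Lipschitz functionals *)

Section TrigonometricFunctionals.
Context {R : realType} {I : Type}.
Implicit Types (x : I -> R) (l : seq (R * I)) (h : (I -> R) -> R).

Definition linform l x : R := \sum_(p <- l) p.1 * x p.2.

(** The linear span of the cosines of affine forms. The phase includes sines, and the product-to-sum
    formula makes the span an algebra. *)
Inductive trig : ((I -> R) -> R) -> Prop :=
| trig_cos (b : R) l : trig (fun x => cos (b + linform l x))
| trigD h1 h2 : trig h1 -> trig h2 -> trig (fun x => h1 x + h2 x)
| trigZ (c : R) h : trig h -> trig (fun x => c * h x).

Lemma linform_cat l1 l2 x : linform (l1 ++ l2) x = linform l1 x + linform l2 x.
Proof. by rewrite /linform big_cat. Qed.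

Lemma linform_opp l x : linform [seq (- p.1, p.2) | p <- l] x = - linform l x.
Proof. by rewrite /linform big_map -sumrN; apply: eq_bigr => p _; rewrite mulNr. Qed.

Lemma trig_ext h1 h2 : trig h1 -> h1 =1 h2 -> trig h2.
Proof. by move=> ? /funext <-. Qed.

Lemma trig_cst (c : R) : trig (fun=> c).
Proof.
apply: (trig_ext (trigZ c (trig_cos 0 [::]))) => x.
by rewrite /linform big_nil addr0 cos0 mulr1.
Qed.

Lemma trigM h1 h2 : trig h1 -> trig h2 -> trig (fun x => h1 x * h2 x).
Proof.
elim=> [b1 l1|u1 u2 _ IH1 _ IH2|c u _ IH] t2; last 2 first.
- by apply: (trig_ext (trigD (IH1 t2) (IH2 t2))) => x; ring.
- by apply: (trig_ext (trigZ c (IH t2))) => x; ring.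
elim: t2 => [b2 l2|u1 u2 _ IH1 _ IH2|c u _ IH]; last 2 first.
- by apply: (trig_ext (trigD IH1 IH2)) => x; ring.
- by apply: (trig_ext (trigZ c IH)) => x; ring.
pose l2' := [seq (- p.1, p.2) | p <- l2].
apply: (trig_ext (trigZ 2^-1 (trigD (trig_cos (b1 + b2) (l1 ++ l2))
                                    (trig_cos (b1 - b2) (l1 ++ l2'))))) => x.
rewrite !linform_cat linform_opp.
have -> : b1 + b2 + (linform l1 x + linform l2 x) =
  (b1 + linform l1 x) + (b2 + linform l2 x) by ring.
have -> : b1 - b2 + (linform l1 x - linform l2 x) =
  (b1 + linform l1 x) - (b2 + linform l2 x) by ring.
by rewrite cosD cosB; field.
Qed.

Lemma trig_sin (a : R) (t : I) : trig (fun x => sin (a * x t)).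
Proof.
apply: (trig_ext (trig_cos (- (pi / 2)) [:: (a, t)])) => x.
by rewrite /linform big_seq1/= addrC cosBpihalf.
Qed.

Lemma trig_bern (p : (I -> R) -> R) (F : nat -> (I -> R) -> R) (m j : nat) : trig p ->
  (forall i, trig (F i)) -> trig (fun x => bern (p x) m (fun i => F i x) j).
Proof.
move=> tp tF; elim: m j => [|m IH] j /=; first exact: tF.
apply: trigD; apply: trigM => //.
by apply: (trig_ext (trigD (trig_cst 1) (trigZ (-1) tp))) => x; ring.
Qed.

(** Lipschitz for the maximum distance on the first [n] coordinates; taking e = 0 shows that [g]
    depends on these coordinates alone. *)
Definition lipschitz_coords (n : nat) (K : R) (g : (nat -> R) -> R) :=
  forall (u v : nat -> R) (e : R), 0 <= e ->
    (forall k, (k < n)%N -> `|u k - v k| <= e) -> `|g u - g v| <= K * e.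

Lemma trig_approx (t : nat -> I) (K L : R) (n : nat) (g : (nat -> R) -> R) (e : R) :
  0 <= K -> 0 < L -> 0 < e -> lipschitz_coords n K g ->
  exists2 h, trig h & forall x,
    `|h x - g (fun k => L * sin (L^-1 * x (t k)))| <= e.
Proof.
move=> K0 L0; elim: n g e => [|n IH] g e e0 gL.
  exists (fun=> g (fun=> 0)); first exact: trig_cst.
  move=> x; have /(_ _ _ 0 (lexx 0)) := gL.
  by move=> /(_ (fun=> 0) (fun k => L * sin (L^-1 * x (t k)))) h;
    rewrite (le_trans (h _))// mulr0 ltW.
have [k k0 ke] : exists2 k : nat, (0 < k)%N & K * (2 * L) / k%:R <= e / 2.
  pose q := K * (2 * L) / (e / 2).
  have q0 : 0 <= q by rewrite divr_ge0 ?mulr_ge0//; lra.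
  exists (Num.bound q) => //.
  rewrite ler_pdivrMr ?(le_lt_trans q0) ?archi_boundP// [leRHS]mulrC -ler_pdivrMr; last by lra.
  exact/ltW/archi_boundP.
set m := (k ^ 2)%N.
pose c (j : nat) : R := L * (2 * (j%:R / m%:R) - 1).
pose upd (v : nat -> R) (a : R) : nat -> R := fun i => if i == n then a else v i.
have gcL j : lipschitz_coords n K (fun v => g (upd v (c j))).
  move=> u v d d0 uv; apply: gL => // i; rewrite ltnS leq_eqVlt /upd.
  by case: eqVneq => /= [_ _|_]; [rewrite subrr normr0|exact: uv].
have e2 : 0 < e / 2 by lra.
have /choice[F FP] : forall j, exists h, trig h /\ forall x,
    `|h x - g (upd (fun k => L * sin (L^-1 * x (t k))) (c j))| <= e / 2.
  by move=> j; have [h th hP] := IH _ _ e2 (gcL j); exists h.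
(* The last truncated coordinate, rescaled to [0, 1]: the success probability of the Bernstein mean
   is itself a trigonometric functional. *)
pose p (x : I -> R) : R := 2^-1 * (1 + sin (L^-1 * x (t n))).
have tp : trig p by apply/trigZ/trigD; [exact: trig_cst|exact: trig_sin].
exists (fun x => bern (p x) m (fun i => F i x) 0).
  by apply: trig_bern => // i; case: (FP i).
move=> x; set v := fun k => L * sin (L^-1 * x (t k)).
have p01 : 0 <= p x <= 1.
  rewrite /p; have := sin_le1 (L^-1 * x (t n)); have := sin_geN1 (L^-1 * x (t n)).
  by move=> *; apply/andP; split; lra.
have h1 : `|bern (p x) m (fun i => g (upd v (c i))) 0 - g v| <= K * (2 * L) / k%:R.
  apply: bern_approx => // [|i]; first by rewrite !mulr_ge0// ltW.
  rewrite -/m -mulrA; apply: gL => [|l].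
    by rewrite mulr_ge0// mulr_ge0// ltW.
  rewrite ltnS leq_eqVlt /upd; case: eqVneq => /= [-> _|_ _].
    rewrite /c /v; have -> : sin (L^-1 * x (t n)) = 2 * p x - 1 by rewrite /p; field.
    rewrite -mulrBr (_ : _ - (2 * p x - 1) = 2 * (i%:R / m%:R - p x)); last by ring.
    by rewrite !normrM (gtr0_norm L0) ger0_norm// !mulrA [L * 2]mulrC.
  by rewrite subrr normr0 mulr_ge0// mulr_ge0// ltW.
have h2 : `|bern (p x) m (fun i => F i x) 0 - bern (p x) m (fun i => g (upd v (c i))) 0| <= e / 2.
  have up : bern (p x) m (fun i => F i x) 0 <= 1 * bern (p x) m (fun i => g (upd v (c i))) 0 + e / 2.
    rewrite -bern_affine; apply: bern_le => // i; have [_ /(_ x)] := FP i.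
    by rewrite ler_norml => /andP[]; rewrite -/v; lra.
  have lo : 1 * bern (p x) m (fun i => g (upd v (c i))) 0 + - (e / 2) <= bern (p x) m (fun i => F i x) 0.
    rewrite -bern_affine; apply: bern_le => // i; have [_ /(_ x)] := FP i.
    by rewrite ler_norml => /andP[]; rewrite -/v; lra.
  by rewrite ler_norml; apply/andP; split; lra.
rewrite (le_trans (ler_distD (bern (p x) m (fun i => g (upd v (c i))) 0) _ _))//; lra.
Qed.

End TrigonometricFunctionals.

(** * From cosines of linear forms to bounded Lipschitz functionals *)

Section LipschitzFunctionals.
Context {R : realType}.
Implicit Types (g : (nat -> R) -> R) (h : (nat -> R) -> R).

Lemma trig_bounded (I : Type) (h : (I -> R) -> R) : trig h ->
  exists M : R, forall x, `|h x| <= M.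
Proof.
elim=> [b l|h1 h2 _ [M1 b1] _ [M2 b2]|c u _ [M b]].
- by exists 1 => x; exact: cos_max.
- by exists (M1 + M2) => x; rewrite (le_trans (ler_normD _ _))// lerD.
- by exists (`|c| * M) => x; rewrite normrM ler_wpM2l.
Qed.

Lemma measurable_linform (I : Type) (d : measure_display) (T : measurableType d)
    (V : I -> T -> R) (l : seq (R * I)) :
  (forall i, measurable_fun setT (V i)) ->
  measurable_fun setT (fun w => linform l (V^~ w)).
Proof.
move=> mV; apply: measurable_sum => p; apply: measurable_funM => //.
Qed.

Lemma measurable_trig (I : Type) (d : measure_display) (T : measurableType d)
    (V : I -> T -> R) (h : (I -> R) -> R) :
  (forall i, measurable_fun setT (V i)) -> trig h ->
  measurable_fun setT (fun w => h (V^~ w)).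
Proof.
move=> mV; elim=> [b l|h1 h2 _ m1 _ m2|c u _ m].
- apply: (measurableT_comp measurable_cos).
  by apply: measurable_funD => //; exact: measurable_linform.
- exact: measurable_funD.
- exact: measurable_funM.
Qed.

(** Since |sin x - x| <= x^2, replacing v by L sin (v / L) moves it by at most v^2 / L. Bounding the
    maximum over coordinates by the sum leaves an error controlled by second moments. *)
Lemma lipschitz_sin_scaling (n : nat) (K L : R) g (v : nat -> R) : 0 < L -> 0 <= K ->
  lipschitz_coords n K g ->
  `|g (fun k => L * sin (L^-1 * v k)) - g v| <= K * \sum_(k < n) v k ^+ 2 / L.
Proof.
move=> L0 K0 gL; have s0 k : 0 <= v k ^+ 2 / L by rewrite divr_ge0 ?sqr_ge0// ltW.
apply: gL => [|k kn]; first by apply: sumr_ge0 => i _.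
rewrite (bigD1 (Ordinal kn))//= -[leLHS]addr0 lerD//; last by apply: sumr_ge0 => i _.
have -> : L * sin (L^-1 * v k) - v k = L * (sin (L^-1 * v k) - L^-1 * v k).
  by field; rewrite gt_eqF.
rewrite normrM (gtr0_norm L0).
have -> : v k ^+ 2 / L = L * (L^-1 * v k) ^+ 2 by field; rewrite gt_eqF.
by rewrite ler_wpM2l ?(ltW L0)// sin_sub_le_sqr.
Qed.

(** Such a functional is the pointwise limit of trigonometric ones, taken with truncation level j +
    1 and accuracy 1 / (j + 1), so measurability needs no topology on the space of sequences. *)
Lemma measurable_lipschitz (d : measure_display) (T : measurableType d)
    (V : nat -> T -> R) (n : nat) (K : R) g :
  (forall k, measurable_fun setT (V k)) -> 0 <= K -> lipschitz_coords n K g ->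
  measurable_fun setT (fun w => g (V^~ w)).
Proof.
move=> mV K0 gL.
have /choice[h hP] : forall j : nat, exists h : (nat -> R) -> R, trig h /\ forall x,
    `|h x - g (fun k => j.+1%:R * sin (j.+1%:R^-1 * x k))| <= j.+1%:R^-1.
  move=> j; have j0 : 0 < j.+1%:R :> R by rewrite ltr0n.
  have ji : 0 < j.+1%:R^-1 :> R by rewrite invr_gt0.
  by have [h th hP] := trig_approx id K0 j0 ji gL; exists h.
apply: (measurable_fun_cvg (h := fun j w => h j (V^~ w))).
  by move=> j; apply: measurable_trig => //; case: (hP j).
move=> w _; set v := V^~ w.
have cv : (K * \sum_(k < n) v k ^+ 2 + 1) * j.+1%:R^-1 @[j --> \oo] --> 0.
  by rewrite -[X in _ --> X](mulr0 (K * \sum_(k < n) v k ^+ 2 + 1));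
    apply: cvgM; [exact: cvg_cst|exact: cvg_harmonic].
rewrite -[X in _ --> X]add0r.
rewrite (_ : (fun j => h j v) = fun j => (h j v - g v) + g v); last first.
  by apply/funext => j; rewrite subrK.
apply: (@cvgD _ R^o); last exact: cvg_cst.
apply: (norm_squeeze0 _ cv) => j.
apply: (le_trans (ler_distD (g (fun k => j.+1%:R * sin (j.+1%:R^-1 * v k))) _ _)).
have [_ /(_ v) h1] := hP j.
have := @lipschitz_sin_scaling n K j.+1%:R g v (ltr0Sn _ _) K0 gL.
by rewrite -mulr_suml => h2; rewrite mulrDl mul1r addrC -mulrA lerD.
Qed.

Section Convergence.
Context {d d' : measure_display} {T : measurableType d} {T' : measurableType d'}
  (P : probability T R) (Q : probability T' R).
Variables (V : nat -> nat -> T -> R) (X : nat -> T' -> R) (C : R).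
Hypothesis mV : \forall N \near \oo, forall k, measurable_fun setT (V N k) /\
  itg P (fun w => V N k w ^+ 2) /\ Ex P (fun w => V N k w ^+ 2) <= C.
Hypothesis mX : forall k, measurable_fun setT (X k) /\
  itg Q (fun w => X k w ^+ 2) /\ Ex Q (fun w => X k w ^+ 2) <= C.
Hypothesis cosV : forall b l,
  Ex P (fun w => cos (b + linform l (V N ^~ w))) @[N --> \oo] -->
  Ex Q (fun w => cos (b + linform l (X^~ w))).

Lemma trig_cvg h : trig h ->
  Ex P (fun w => h (V N ^~ w)) @[N --> \oo] --> Ex Q (fun w => h (X^~ w)).
Proof.
have itgT (U : measurableType d) (m : probability U R) (W : nat -> U -> R)
    (u : (nat -> R) -> R) : trig u ->
    (forall k, measurable_fun setT (W k)) -> itg m (fun w => u (W^~ w)).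
  move=> tu mW; have [M uM] := trig_bounded tu.
  by apply: (itg_bounded m (measurable_trig mW tu)) => w; exact: uM.
have itgT' (u : (nat -> R) -> R) : trig u -> itg Q (fun w => u (X^~ w)).
  move=> tu; have [M uM] := trig_bounded tu.
  by apply: (itg_bounded Q (measurable_trig (fun k => (mX k).1) tu)) => w; exact: uM.
elim=> [b l|h1 h2 t1 c1 t2 c2|c u tu cu]; first exact: cosV.
- rewrite ExD; [|exact: itgT'|exact: itgT'].
  apply: (cvg_trans _ (@cvgD _ R^o _ _ _ _ _ _ _ c1 c2)); apply: near_eq_cvg; near=> N.
  have gN : forall k, measurable_fun setT (V N k).
    by near: N; apply: filterS mV => N VN k; case: (VN k).
  by rewrite /= ExD//; apply: itgT.
- rewrite ExZ; last exact: itgT'.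
  apply: (cvg_trans _ (cvgM (cvg_cst c) cu)); apply: near_eq_cvg; near=> N.
  have gN : forall k, measurable_fun setT (V N k).
    by near: N; apply: filterS mV => N VN k; case: (VN k).
  by rewrite /= ExZ//; apply: itgT.
Unshelve. all: by end_near. Qed.

Lemma itg_lipschitz (e : measure_display) (U : measurableType e) (m : probability U R)
    (W : nat -> U -> R) (n : nat) (K M : R) g :
  (forall k, measurable_fun setT (W k)) -> 0 <= K -> lipschitz_coords n K g ->
  (forall v, `|g v| <= M) -> itg m (fun w => g (W^~ w)).
Proof.
by move=> mW K0 gL gM; apply: (itg_bounded m (measurable_lipschitz mW K0 gL)) => w; exact: gM.
Qed.

Lemma Ex_trig_approx (e : measure_display) (U : measurableType e) (m : probability U R)
    (W : nat -> U -> R) (n : nat) (K M L c eps : R) g h :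
  (forall k, measurable_fun setT (W k) /\
    itg m (fun w => W k w ^+ 2) /\ Ex m (fun w => W k w ^+ 2) <= c) ->
  0 <= K -> 0 < L -> lipschitz_coords n K g -> (forall v, `|g v| <= M) -> trig h ->
  (forall x, `|h x - g (fun k => L * sin (L^-1 * x k))| <= eps) ->
  `|Ex m (fun w => h (W^~ w)) - Ex m (fun w => g (W^~ w))| <= eps + K * n%:R * c / L.
Proof.
move=> mW K0 L0 gL gM th hP.
have [H hH] := trig_bounded th; have mW1 k := (mW k).1.
have ih : itg m (fun w => h (W^~ w)).
  by apply: (itg_bounded m (measurable_trig mW1 th)) => w; exact: hH.
have ig := itg_lipschitz m mW1 K0 gL gM.
have iW2 k : itg m (fun w => L^-1 * W k w ^+ 2) by apply: itgZ; case: (mW k) => _ [].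
have is' : itg m (fun w => K * \sum_(k < n) L^-1 * W k w ^+ 2) by apply/itgZ/itg_sum.
rewrite -ExB//.
apply: (@le_trans _ _ (Ex m (fun w => eps + K * \sum_(k < n) L^-1 * W k w ^+ 2))).
  apply: normr_Ex_le; [exact: itgB|by apply: itgD => //; exact: itg_cst|move=> w].
  apply: (le_trans (ler_distD (g (fun k => L * sin (L^-1 * W k w))) _ _)).
  apply: lerD; first exact: (hP (W^~ w)).
  apply: (le_trans (lipschitz_sin_scaling (W^~ w) L0 K0 gL)).
  by under eq_bigr do rewrite mulrC.
rewrite ExD ?Ex_cst//; last exact: itg_cst.
rewrite lerD// ExZ; last exact: itg_sum.
rewrite -!mulrA ler_wpM2l// Ex_sum//.
apply: (@le_trans _ _ (\sum_(k < n) c / L)); last by rewrite sumr_const card_ord mulr_natl.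
apply: ler_sum => k _; have [_ [i2 c2]] := mW k.
by rewrite ExZ// mulrC ler_wpM2r// invr_ge0 ltW.
Qed.

(** The second moments are bounded by [C] for large N and in the limit, so one truncation level L,
    large enough for K n C / L <= e / 6, serves both sides; in between stands the convergence of a
    single trigonometric functional. *)
Lemma lipschitz_cvg (n : nat) (K M : R) g : 0 <= K -> lipschitz_coords n K g ->
  (forall v, `|g v| <= M) ->
  Ex P (fun w => g (V N ^~ w)) @[N --> \oo] --> Ex Q (fun w => g (X^~ w)).
Proof.
move=> K0 gL gM; apply/cvgrPdist_le => e e0.
have C0 : 0 <= C by have [_ [_]] := mX 0%N; apply: le_trans; apply: Ex_ge0 => w; exact: sqr_ge0.
pose L := K * n%:R * C / (e / 6) + 1.
have q0 : 0 <= K * n%:R * C by rewrite !mulr_ge0.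
have L0 : 0 < L by rewrite ltr_wpDl// divr_ge0//; lra.
have qL : K * n%:R * C / L <= e / 6.
  have e6 : 0 < e / 6 by lra.
  by rewrite ler_pdivrMr// [leRHS]mulrC -ler_pdivrMr// /L lerDl ler01.
have e6 : 0 < e / 6 by lra.
have [h th hP] := @trig_approx _ _ id K L n g (e / 6) K0 L0 e6 gL.
have ch := trig_cvg th.
near=> N.
have mN : forall k, measurable_fun setT (V N k) /\
    itg P (fun w => V N k w ^+ 2) /\ Ex P (fun w => V N k w ^+ 2) <= C by near: N.
have h1 := Ex_trig_approx mN K0 L0 gL gM th hP.
have h2 := Ex_trig_approx mX K0 L0 gL gM th hP.
have h3 : `|Ex Q (fun w => h (X^~ w)) - Ex P (fun w => h (V N ^~ w))| <= e / 6.
  by near: N; move/cvgrPdist_le : ch => /(_ _ e6).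
move: h1 h2 h3; set a := Ex Q _; set b := Ex P _; set a' := Ex Q _; set b' := Ex P _.
rewrite !ler_norml => /andP[? ?] /andP[? ?] /andP[? ?]; apply/andP; split; lra.
Unshelve. all: by end_near. Qed.

End Convergence.
End LipschitzFunctionals.

(** * Lipschitz minorants of a J1-continuous functional *)

Section Portmanteau.
Context {R : realType}.

Lemma Ex_bounded_cvg (d : measure_display) (T : measurableType d) (P : probability T R)
    (f_ : nat -> T -> R) (f : T -> R) (M : R) :
  (forall n, measurable_fun setT (f_ n)) -> (forall n w, `|f_ n w| <= M) ->
  (forall w, f_ n w @[n --> \oo] --> f w) ->
  [/\ measurable_fun setT f, forall w, `|f w| <= M & Ex P (f_ n) @[n --> \oo] --> Ex P f].
Proof.
move=> mf fM ff.
have mlim : measurable_fun setT f by apply: (measurable_fun_cvg mf) => w _; exact: ff.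
have limM w : `|f w| <= M.
  have cn : `|f_ n w| @[n --> \oo] --> `|f w| by apply: cvg_norm; exact: ff.
  rewrite -(cvg_lim (@Rhausdorff R) cn); apply: limr_le; first by apply/cvg_ex; eexists; exact: cn.
  by apply: nearW => n; exact: fM.
split => //.
have H : (\int[P]_w (f_ n w)%:E)%E @[n --> \oo] --> (\int[P]_w (f w)%:E)%E.
  apply: (@dominated_cvg _ _ _ P setT measurableT (fun n w => (f_ n w)%:E)
    (fun w => (f w)%:E) (fun=> M%:E)) => //.
  - by move=> n; apply/measurable_EFinP.
  - by move=> w _; apply: cvg_EFin; [exact: nearW|exact: ff].
  - exact: (itg_cst P M).
  - by move=> n w _; rewrite lee_fin.
rewrite -(EFin_Ex (itg_bounded P mlim limM)) in H.
exact: (fine_cvg H).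
Qed.

Variable T : R.

(** The neighbourhood behind [J1_cvg]: convergence of x to y says that for each e > 0,
    [close e (x n) y] holds eventually. *)
Definition close (e : R) (z x : R -> R) := exists2 l, time_change T l &
  forall t, -T <= t <= T -> `|l t - t| <= e /\ `|z (l t) - x t| <= e.

Lemma close_shift (e e' : R) (z x x' : R -> R) : 0 <= e -> close e' z x' ->
  (forall t, -T <= t <= T -> `|x t - x' t| <= e) -> close (e' + e) z x.
Proof.
move=> e0 [l tl lP] xx'; exists l => // t tT; have [l1 l2] := lP t tT; split.
  by rewrite (le_trans l1)// lerDl.
by rewrite (le_trans (ler_distD (x' t) _ _))// lerD// distrC xx'.
Qed.

Lemma time_change_id : time_change T id.
Proof.
split => //; split => //; split => //.
by apply: continuous_subspaceT => x; exact: cvg_id.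
Qed.

Lemma close_refl (x : R -> R) : close 0 x x.
Proof. by exists id; [exact: time_change_id|move=> t _; rewrite !subrr normr0]. Qed.

Variables (f : (R -> R) -> R) (M : R).
Hypothesis fM : forall x, cadlag_on T x -> `|f x| <= M.
Hypothesis M0 : 0 <= M.
Hypothesis cf : forall (x : nat -> R -> R) (y : R -> R), (forall n, cadlag_on T (x n)) ->
  cadlag_on T y -> J1_cvg T x y -> f (x n) @[n --> \oo] --> f y.

(* Pasch-Hausdorff envelope: the largest functional below [f] that is
   [k]-Lipschitz for the uniform distance, capped by [M]. *)
Definition env_set (k : R) (x : R -> R) : set R :=
  [set y | y = M \/ exists z e, [/\ cadlag_on T z, 0 <= e, close e z x & y = f z + k * e]].

Definition env (k : R) (x : R -> R) : R := inf (env_set k x).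

Lemma env_set_lb k x : 0 <= k -> lbound (env_set k x) (- M).
Proof.
move=> k0 y [->|[z [e [cz e0 _ ->]]]]; first (rewrite (@le_trans _ _ 0)// oppr_le0 //).
have /ler_normlP[h _] := fM cz; have := mulr_ge0 k0 e0; lra.
Qed.

(** The cap [M] keeps the set nonempty for every [x]. This matters because the envelope is evaluated
    at paths frozen on a finite grid, which need not be cadlag. *)
Lemma env_set_has_inf k x : 0 <= k -> has_inf (env_set k x).
Proof. by move=> k0; split; [exists M; left|exists (- M); exact: env_set_lb]. Qed.

Lemma env_bounded k x : 0 <= k -> `|env k x| <= M.
Proof.
move=> k0; rewrite ler_norml; apply/andP; split.
  by apply: lb_le_inf; [exists M; left|exact: env_set_lb].
by apply: ge_inf; [exists (- M); exact: env_set_lb|left].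
Qed.

Lemma env_le k x : 0 <= k -> cadlag_on T x -> env k x <= f x.
Proof.
move=> k0 cx; apply: ge_inf; first by exists (- M); exact: env_set_lb.
by right; exists x, 0; split => //; [exact: close_refl|rewrite mulr0 addr0].
Qed.

Lemma env_lip1 k x x' e : 0 <= k -> 0 <= e ->
  (forall t, -T <= t <= T -> `|x t - x' t| <= e) -> env k x <= env k x' + k * e.
Proof.
move=> k0 e0 xx'; rewrite -lerBlDr; apply: lb_le_inf; first by exists M; left.
have lbx := ex_intro _ (- M) (@env_set_lb k x k0) : has_lbound (env_set k x).
move=> y [->|[z [e' [cz e'0 cl ->]]]].
  have : env k x <= M by apply: ge_inf => //; left.
  by have := mulr_ge0 k0 e0; lra.
have : env k x <= f z + k * (e' + e).
  apply: ge_inf => //; right; exists z, (e' + e); split => //; first by rewrite addr_ge0.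
  exact: close_shift cl xx'.
lra.
Qed.

Lemma env_lip k x x' e : 0 <= k -> 0 <= e ->
  (forall t, -T <= t <= T -> `|x t - x' t| <= e) -> `|env k x - env k x'| <= k * e.
Proof.
move=> k0 e0 xx'; have h1 := env_lip1 k0 e0 xx'.
have h2 : env k x' <= env k x + k * e.
  by apply: env_lip1 => // t tT; rewrite distrC xx'.
by rewrite ler_norml; apply/andP; split; lra.
Qed.

Lemma env_mono k k' x : 0 <= k -> k <= k' -> env k x <= env k' x.
Proof.
move=> k0 kk'; apply: lb_le_inf; first by exists M; left.
have lbx := ex_intro _ (- M) (@env_set_lb k x k0) : has_lbound (env_set k x).
move=> y [->|[z [e [cz e0 cl ->]]]]; first by apply: ge_inf => //; left.
apply: (@le_trans _ _ (f z + k * e)); last by rewrite lerD2l ler_wpM2r.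
by apply: ge_inf => //; right; exists z, e.
Qed.

(** Otherwise, for every n, some path z_n within e_n of [x] has f z_n + n e_n < f x - e. Boundedness
    of [f] forces n e_n <= 2 M, so z_n tends to [x] in J1 while f z_n stays below f x - e, against
    continuity. *)
Lemma env_cvg x : cadlag_on T x -> env n%:R x @[n --> \oo] --> f x.
Proof.
move=> cx; apply/cvgrPdist_le => e e0.
have [[n0 n0P]|no] := pselect (exists n0 : nat, f x - e <= env n0%:R x).
  near=> n; rewrite ger0_norm ?subr_ge0 ?env_le//.
  have : env n0%:R x <= env n%:R x.
    by apply: env_mono => //; rewrite ler_nat; near: n; exact: nbhs_infty_ge.
  lra.
exfalso.
have far n : exists ze : (R -> R) * R, [/\ cadlag_on T ze.1, 0 <= ze.2, close ze.2 ze.1 x &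
    f ze.1 + n%:R * ze.2 < f x - e].
  have lt : env n%:R x < f x - e by rewrite ltNge; apply/negP => h; apply: no; exists n.
  have [y Sy ylt] := inf_lt (env_set_has_inf x (ler0n R n)).1 lt.
  case: Sy ylt => [->|[z [e' [cz e'0 cl ->]]] zlt]; last by exists (z, e').
  by have /ler_normlP[_ h] := fM cx; move=> h'; exfalso; lra.
have {far} /choice[ze zeP] := far.
have small n : (ze n).2 * n%:R <= 2 * M.
  have [cz e'0 _ lt] := zeP n.
  by have /ler_normlP[h _] := fM cz; have /ler_normlP[_ h'] := fM cx; lra.
have J1 : J1_cvg T (fun n => (ze n).1) x.
  move=> eps eps0; near=> n.
  have [cz e'0 [l tl lP] _] := zeP n; exists l; split => // t tT.
  have le_eps : (ze n).2 <= eps.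
    have n0 : 0 < n%:R :> R by rewrite ltr0n; near: n; exact: nbhs_infty_gt.
    apply: (@le_trans _ _ (2 * M / n%:R)); first by rewrite ler_pdivlMr.
    rewrite ler_pdivrMr// [leRHS]mulrC -ler_pdivrMr//.
    apply: (le_trans (ltW (archi_boundP _))); first by rewrite divr_ge0 ?mulr_ge0// ltW.
    by rewrite ler_nat; near: n; exact: nbhs_infty_ge.
  by have [l1 l2] := lP t tT; split; [exact: le_trans l1 le_eps|exact: le_trans l2 le_eps].
have := cf (fun n => let: And4 c _ _ _ := zeP n in c) cx J1.
move/cvgrPdist_lt => /(_ _ e0) [n0 _ /(_ n0 (leqnn n0))] /=.
have [_ e'0 _ lt] := zeP n0; rewrite ltr_norml => /andP[_ h].
by have := mulr_ge0 (ler0n R n0) e'0; lra.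
Unshelve. all: by end_near. Qed.

End Portmanteau.

(** * Weak convergence from finite-dimensional convergence and small oscillation *)

Section WeakConvergence.
Context {R : realType} {d d' : measure_display} {Om : measurableType d}
  {Om' : measurableType d'} (P : probability Om R) (Q : probability Om' R).
Variables (T : R) (Y : nat -> Om -> R -> R) (X : Om' -> R -> R).

(** The large-oscillation event involves uncountably many times, so it is covered by a measurable
    event instead of being measured itself. The map [idx] assigns to each time the grid point at
    which the path is frozen. *)
Definition small_oscillation (e : measure_display) (U : measurableType e)
    (m : probability U R) (W : U -> R -> R) (ts : nat -> R) (idx : R -> nat) (eps eta : R) :=
  exists A, [/\ measurable A, (m A <= eta%:E)%E &
    forall w, ~ A w -> forall t, -T <= t <= T -> `|W w t - W w (ts (idx t))| <= eps].

Hypothesis cY : \forall N \near \oo, forall w, cadlag_on T (Y N w).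
Hypothesis cX : forall w, cadlag_on T (X w).
Hypothesis mY : \forall N \near \oo, forall t, -T <= t <= T ->
  measurable_fun setT (fun w => Y N w t).
Hypothesis mX : forall t, -T <= t <= T -> measurable_fun setT (X^~ t).
Hypothesis fdd : forall (ts : nat -> R) (n : nat) (K M : R) g,
  (forall k, -T <= ts k <= T) -> 0 <= K -> lipschitz_coords n K g -> (forall v, `|g v| <= M) ->
  Ex P (fun w => g (fun k => Y N w (ts k))) @[N --> \oo] --> Ex Q (fun w => g (fun k => X w (ts k))).
Hypothesis tight : forall eps eta, 0 < eps -> 0 < eta ->
  exists n (ts : nat -> R) (idx : R -> nat), [/\ forall k, -T <= ts k <= T,
    forall t, (idx t < n)%N, small_oscillation Q X ts idx eps eta &
    \forall N \near \oo, small_oscillation P (Y N) ts idx eps eta].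

(** By Borel-Cantelli the paths of X frozen on the j-th grid converge uniformly, off a null event,
    to X. Letting j and then k grow in the k-Lipschitz envelopes identifies a measurable version of
    f (X), whose mean is the number [a]. Of the error [e], a quarter each goes to the choice of k,
    the choice of j, finite-dimensional convergence, and freezing the prelimit paths. *)
Lemma weak_cvg_lower (f : (R -> R) -> R) (M e : R) : 0 <= M -> 0 < e ->
  (forall x, cadlag_on T x -> `|f x| <= M) ->
  (forall (x : nat -> R -> R) (y : R -> R), (forall n, cadlag_on T (x n)) ->
     cadlag_on T y -> J1_cvg T x y -> f (x n) @[n --> \oo] --> f y) ->
  exists2 a : R, (\int[Q]_w (f (X w))%:E <= a%:E)%E &
    \forall N \near \oo, ((a - e)%:E <= \int[P]_w (f (Y N w))%:E)%E.
Proof.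
move=> M0 e0 fM cf.
(* Equal to 2^-(j+1), summable as Borel-Cantelli requires. *)
pose eta j : R := 1 / (2 ^ j.+1)%:R.
have eta0 j : 0 < eta j by rewrite divr_gt0// ltr0n expn_gt0.
have /choice[G GP] : forall j, exists G : nat * (nat -> R) * (R -> nat),
    [/\ forall k, -T <= G.1.2 k <= T, forall t, (G.2 t < G.1.1)%N,
      small_oscillation Q X G.1.2 G.2 (eta j) (eta j) &
    \forall N \near \oo, small_oscillation P (Y N) G.1.2 G.2 (eta j) (eta j)].
  by move=> j; have [n [ts [idx h]]] := tight (eta0 j) (eta0 j); exists (n, ts, idx).
pose ts j := (G j).1.2; pose idx j := (G j).2.
have tsT j k : -T <= ts j k <= T by have [h _ _ _] := GP j; exact: h.
have idxn j t : (idx j t < (G j).1.1)%N by have [_ h _ _] := GP j; exact: h.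
have /choice[A AP] : forall j, exists A, [/\ measurable A, (Q A <= (eta j)%:E)%E &
    forall w, ~ A w -> forall t, -T <= t <= T -> `|X w t - X w (ts j (idx j t))| <= eta j].
  by move=> j; have [_ _ h _] := GP j; exact: h.
have mA j : measurable (A j) by case: (AP j).
pose C := ~` lim_sup_set A.
have Q0 : Q (lim_sup_set A) = 0%E.
  apply: lim_sup_set_cvg0 => //.
  apply: (@le_lt_trans _ _ (\sum_(j <oo) (eta j)%:E)%E).
    by apply: lee_nneseries => // j _; case: (AP j).
  by apply: (le_lt_trans (epsilon_trick0 xpredT ler01)); exact: ltry.
have mL : measurable (lim_sup_set A).
  by apply: bigcapT_measurable => n; apply: bigcup_measurable => k _.
have mC : measurable C by exact: measurableC.
pose E k x := env T f M k x.
pose h k j w := E k%:R (fun t => X w (ts j (idx j t))).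
pose gkj (k j : nat) (v : nat -> R) := E k%:R (fun t => v (idx j t)).
have glip k j : lipschitz_coords (G j).1.1 k%:R (gkj k j).
  move=> u v dd dd0 uv; apply: (env_lip fM M0) => // t _; exact: uv.
have gbd k j v : `|gkj k j v| <= M by apply: (env_bounded fM M0).
have mh k j : measurable_fun setT (h k j).
  by apply: (measurable_lipschitz (V := fun i w => X w (ts j i))
    (fun i => mX (tsT j i)) (ler0n R k) (glip k j)).
(* Multiplying by the indicator of [C] removes the null event where frozen paths may fail to
   converge; [F k] and [F0] are then everywhere limits of measurable functions. *)
pose F k w : R := \1_C w * E k%:R (X w).
pose F0 w : R := \1_C w * f (X w).
have ind01 w : \1_C w = 0 :> R \/ \1_C w = 1 :> R.
  by rewrite indicE; case: (_ \in _); [right|left].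
have eta_cvg : eta j @[j --> \oo] --> 0.
  apply: (norm_squeeze0 _ cvg_harmonic) => j; rewrite ger0_norm ?(ltW (eta0 j))//.
  by rewrite /eta div1r lef_pV2 ?posrE ?ltr0n ?expn_gt0// ler_nat ltnW// ltn_expl.
have hF k w : \1_C w * h k j w @[j --> \oo] --> F k w.
  rewrite /F indicE; have [wC|_] := boolP (w \in C); last first.
    by rewrite mul0r; under eq_fun do rewrite mul0r; exact: cvg_cst.
  rewrite mul1r; under eq_fun do rewrite mul1r.
  have [J JP] : exists J, forall j, (J <= j)%N -> ~ A j w.
    move: wC; rewrite inE => wC; apply: contrapT => nJ; apply: wC => n _ /=.
    apply: contrapT => nA; apply: nJ; exists n => j nj Aj; apply: nA; exists j => //.
  have cv : k%:R * eta j @[j --> \oo] --> 0.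
    by rewrite -[X in _ --> X](mulr0 k%:R); apply: cvgM => //; exact: cvg_cst.
  apply/cvgrPdist_le => eps eps0.
  move/cvgrPdist_le : cv => /(_ _ eps0) cv; near=> j.
  apply: (@le_trans _ _ (k%:R * eta j)).
    apply: (env_lip fM M0) => //; first exact: ltW.
    have [_ _ h'] := AP j; apply: h'; apply: JP; near: j; exact: nbhs_infty_ge.
  have : `|0 - k%:R * eta j| <= eps by near: j.
  by rewrite sub0r normrN ger0_norm// mulr_ge0// ltW.
have bnd1 w (x : R) : `|x| <= M -> `|\1_C w * x| <= M.
  by case: (ind01 w) => ->; rewrite ?mul1r// mul0r normr0.
have hbd k j w : `|h k j w| <= M by exact: (gbd k j (fun i => X w (ts j i))).
have mind : measurable_fun setT (\1_C : Om' -> R) by exact: measurable_indic.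
have cvh k := @Ex_bounded_cvg R _ _ Q (fun j w => \1_C w * h k j w) (F k) M
  (fun j => measurable_funM mind (mh k j)) (fun j w => bnd1 w _ (hbd k j w)) (hF k).
have FF0 w : F k w @[k --> \oo] --> F0 w.
  by apply: cvgM; [exact: cvg_cst|exact: (env_cvg fM M0 cf (cX w))].
have [mF0 bF0 cvF] := @Ex_bounded_cvg R _ _ Q F F0 M
  (fun k => let: And3 m _ _ := cvh k in m) (fun k => let: And3 _ b _ := cvh k in b) FF0.
have iL : itg Q (\1_(lim_sup_set A)) by exact: itg_indic.
have EL : Ex Q (\1_(lim_sup_set A)) = 0 by apply: EFin_inj; rewrite Ex_indic.
have indL w : \1_C w = 1 - \1_(lim_sup_set A) w :> R.
  by rewrite !indicE in_setC; case: (_ \in _); rewrite /= ?subrr ?subr0.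
have hQ k j : Ex Q (h k j) = Ex Q (fun w => \1_C w * h k j w).
  have ih : itg Q (h k j) by apply: (itg_bounded Q (mh k j)) => w; exact: hbd.
  have iCh : itg Q (fun w => \1_C w * h k j w) by exact: itgM_indic.
  apply/eqP; rewrite -subr_eq0 -normr_le0 -(mulr0 M) -EL -ExZ// -ExB//.
  apply: normr_Ex_le; [exact: itgB|exact: itgZ|move=> w].
  rewrite (_ : h k j w - _ = \1_(lim_sup_set A) w * h k j w); last by rewrite indL; ring.
  by rewrite normrM indicE; case: (_ \in _); rewrite ?normr1 ?normr0 ?mul0r ?mul1r ?mulr0 ?mulr1//; exact: hbd.
exists (Ex Q F0).
  have iF0 : itg Q F0 by exact: (itg_bounded Q mF0 bF0).
  (* Adding [M] on the null event leaves the mean unchanged and makes the integrand dominate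
     [f (X w)] at every point, as monotonicity without measurability demands. *)
  have -> : Ex Q F0 = Ex Q (fun w => F0 w + M * \1_(lim_sup_set A) w).
    by rewrite ExD ?ExZ ?EL ?mulr0 ?addr0//; exact: itgZ.
  rewrite EFin_Ex; last by apply: itgD => //; exact: itgZ.
  apply: le_integral_nonmeasurable => w; rewrite lee_fin /F0 indL.
  have /ler_normlP[_ h1] := fM _ (cX w).
  rewrite indicE; case: (_ \in _); rewrite ?subr0 ?subrr ?mulr0 ?mul1r ?mul0r ?mulr1 ?addr0 ?add0r//.
have [k kP] : exists k, Ex Q F0 - e / 4 <= Ex Q (F k).
  have e4 : 0 < e / 4 by lra.
  move/cvgrPdist_le : cvF => /(_ _ e4) [k _ /(_ k (leqnn k))] /= h1.
  by exists k; move: h1; rewrite ler_norml => /andP[]; lra.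
have [j [jP jk]] : exists j, Ex Q (F k) - e / 4 <= Ex Q (h k j) /\ (k%:R + 2 * M) * eta j <= e / 4.
  have e4 : 0 < e / 4 by lra.
  have [_ _ /cvgrPdist_le /(_ _ e4) c1] := cvh k.
  have /cvgrPdist_le/(_ _ e4) c2 : (k%:R + 2 * M) * eta j @[j --> \oo] --> 0.
    by rewrite -[X in _ --> X](mulr0 (k%:R + 2 * M)); apply: cvgM => //; exact: cvg_cst.
  have [j [c1j c2j]] : exists j, `|Ex Q (F k) - Ex Q (fun w => \1_C w * h k j w)| <= e / 4 /\
      `|0 - (k%:R + 2 * M) * eta j| <= e / 4.
    have [j _ jP] := filterI c1 c2; exists j; exact: (jP j (leqnn j)).
  exists j; rewrite hQ; move: c1j c2j; rewrite !ler_norml => /andP[? ?] /andP[? ?].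
  by split; lra.
have e4 : 0 < e / 4 by lra.
have /cvgrPdist_le/(_ _ e4) cvN := @fdd (ts j) (G j).1.1 k%:R M (gkj k j)
  (tsT j) (ler0n _ _) (glip k j) (gbd k j).
have [_ _ _ oscY] := GP j.
have gN' : \forall N \near \oo,
    Ex Q (h k j) - e / 4 <= Ex P (fun w => gkj k j (fun i => Y N w (ts j i))).
  apply: filterS cvN => N; rewrite ler_norml => /andP[_].
  rewrite -[Ex Q (fun w => gkj _ _ _)]/(Ex Q (h k j)); lra.
near=> N.
have cYN : forall w, cadlag_on T (Y N w) by near: N.
have mYN : forall t, -T <= t <= T -> measurable_fun setT (fun w => Y N w t) by near: N.
have [B [mB PB Bosc]] : small_oscillation P (Y N) (ts j) (idx j) (eta j) (eta j) by near: N.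
pose g w := gkj k j (fun i => Y N w (ts j i)).
have gN : Ex Q (h k j) - e / 4 <= Ex P g by rewrite /g; near: N.
have mg : measurable_fun setT g.
  by apply: (measurable_lipschitz (V := fun i w => Y N w (ts j i))
    (fun i => mYN _ (tsT j i)) (ler0n R k) (glip k j)).
have ig : itg P g by apply: (itg_bounded P mg) => w; exact: gbd.
(* A measurable minorant of [f (Y N w)]: off [B] freezing the path costs k eta_j in the envelope,
   while on [B] subtracting 2 M brings g under - M. *)
pose low w : R := (g w - k%:R * eta j) - 2 * M * \1_B w.
have ilow : itg P low.
  by apply: itgB; [apply: itgB => //; exact: itg_cst|apply/itgZ/itg_indic].
have lowf w : low w <= f (Y N w).
  have keta : 0 <= k%:R * eta j by rewrite mulr_ge0// ltW.
  rewrite /low indicE; have [wB|] := boolP (w \in B).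
    have /ler_normlP[_ gM] := gbd k j (fun i => Y N w (ts j i)).
    by have /ler_normlP[fM' _] := fM _ (cYN w); rewrite mulr1 /g; lra.
  rewrite notin_setE => wB; rewrite mulr0 subr0.
  apply: (le_trans _ (env_le fM M0 (ler0n R k) (cYN w))).
  have : env T f M k%:R (fun t => Y N w (ts j (idx j t))) <= env T f M k%:R (Y N w) + k%:R * eta j.
    apply: (env_lip1 fM M0) => //; first exact: ltW.
    by move=> t tT; rewrite distrC; exact: Bosc.
  by rewrite /g /gkj /E; lra.
apply: (le_trans _ (le_integral_nonmeasurable P (f := EFin \o low) (g := fun w => (f (Y N w))%:E)
   (fun w => lowf w))).
rewrite -EFin_Ex// lee_fin /low.
have i1 : itg P (fun w => g w - k%:R * eta j) by apply: itgB => //; exact: itg_cst.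
have iB : itg P (\1_B) by exact: itg_indic.
rewrite ExB//; last exact: itgZ.
rewrite ExB//; last exact: itg_cst.
rewrite Ex_cst ExZ//.
have EB : Ex P \1_B <= eta j by rewrite -lee_fin Ex_indic.
have : 2 * M * Ex P \1_B <= 2 * M * eta j by rewrite ler_wpM2l// mulr_ge0.
lra.
Unshelve. all: by end_near. Qed.

(** The bound makes the positive part have a finite integral, which suffices for negation to commute
    with the integral of a possibly non-measurable function. *)
Lemma bounded_integral (e : measure_display) (U : measurableType e) (m : probability U R)
    (f : U -> R) (M : R) : (forall w, `|f w| <= M) ->
  [/\ ((- M)%:E <= \int[m]_w (f w)%:E)%E, (\int[m]_w (f w)%:E <= M%:E)%E &
      (\int[m]_w (- f w)%:E = - \int[m]_w (f w)%:E)%E].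
Proof.
move=> fM; have EM (c : R) : (\int[m]_w c%:E = c%:E)%E by rewrite -EFin_Ex ?Ex_cst//; exact: itg_cst.
split.
- by rewrite -EM; apply: le_integral_nonmeasurable => w; have := fM w;
    rewrite lee_fin ler_norml => /andP[].
- by rewrite -[leRHS]EM; apply: le_integral_nonmeasurable => w; have := fM w;
    rewrite lee_fin ler_norml => /andP[].
under eq_integral do rewrite EFinN.
apply: integralN; apply: fin_num_adde_defr.
rewrite ge0_fin_numE; last by apply: integral_ge0.
apply: (@le_lt_trans _ _ M%:E); last exact: ltry.
rewrite -[leRHS]EM; apply: le_integral_nonmeasurable => w; have := fM w.
rewrite ler_norml funeposE ge_max !lee_fin => /andP[h1 h2]; rewrite h2/=; lra.
Qed.

(** The lower bound applied to [f] and to - f gives the two halves of the convergence. *)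
Lemma weak_cvg_tight : D_weak_cvg P Q T Y X.
Proof.
move=> f [M0 fM0] cf; pose M := `|M0|.
have fM x : cadlag_on T x -> `|f x| <= M by move=> cx; exact: le_trans (fM0 x cx) (ler_norm _).
have M_ge0 : 0 <= M by rewrite normr_ge0.
have [q1 q2 _] := bounded_integral Q (fun w => fM _ (cX w)).
have qfin : (\int[Q]_w (f (X w))%:E)%E \is a fin_num.
  by rewrite fin_numE; apply/andP; split; apply/eqP => qE; move: q1 q2; rewrite qE.
rewrite -(fineK qfin); set q := fine _.
have pfin : \forall N \near \oo, (\int[P]_w (f (Y N w))%:E)%E \is a fin_num.
  apply: filterS cY => N cYN; have [p1 p2 _] := bounded_integral P (fun w => fM _ (cYN w)).
  by rewrite fin_numE; apply/andP; split; apply/eqP => qE; move: p1 p2; rewrite qE.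
apply: cvg_EFin => //; apply/cvgrPdist_le => e e0.
have [a qa aP] := weak_cvg_lower M_ge0 e0 fM cf.
have fM' x : cadlag_on T x -> `|- f x| <= M by move=> cx; rewrite normrN; exact: fM.
have cf' (x : nat -> R -> R) (y : R -> R) : (forall n, cadlag_on T (x n)) ->
    cadlag_on T y -> J1_cvg T x y -> - f (x n) @[n --> \oo] --> - f y.
  by move=> cx cy J; apply: (@cvgN _ R^o); exact: cf.
have [a' qa' aP'] := weak_cvg_lower M_ge0 e0 fM' cf'.
have [_ _ qN] := bounded_integral Q (fun w => fM _ (cX w)).
rewrite qN -(fineK qfin) -EFinN lee_fin -/q in qa'.
rewrite -(fineK qfin) lee_fin -/q in qa.
near=> N => /=.
have pN : (\int[P]_w (f (Y N w))%:E)%E \is a fin_num by near: N.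
have h1 : ((a - e)%:E <= \int[P]_w (f (Y N w))%:E)%E by near: N.
have h2 : ((a' - e)%:E <= \int[P]_w (- f (Y N w))%:E)%E by near: N.
have cYN : forall w, cadlag_on T (Y N w) by near: N.
have [_ _ pNN] := bounded_integral P (fun w => fM _ (cYN w)).
rewrite pNN -(fineK pN) -EFinN lee_fin in h2.
rewrite -(fineK pN) lee_fin in h1.
by rewrite ler_norml; apply/andP; split; lra.
Unshelve. all: by end_near. Qed.

End WeakConvergence.

(** * Random variables with the same law, and vanishing expectations *)

Section SameLaw.
Context {R : realType} {d d' : measure_display} {T : measurableType d} {T' : measurableType d'}
  (P : probability T R) (Q : probability T' R).

Definition same_law (F : T -> R) (G : T' -> R) :=
  forall B : set R, measurable B -> P (F @^-1` B) = Q (G @^-1` B).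

Lemma ge0_integral_same_law (F : T -> R) (G : T' -> R) (h : R -> \bar R) :
  measurable_fun setT F -> measurable_fun setT G -> same_law F G ->
  measurable_fun setT h -> (forall x, 0 <= h x)%E ->
  (\int[P]_w h (F w) = \int[Q]_w h (G w))%E.
Proof.
move=> mF mG FG mh h0.
pose X : {mfun T >-> R} := HB.pack F (@isMeasurableFun.Build _ _ _ _ F mF).
pose Y : {mfun T' >-> R} := HB.pack G (@isMeasurableFun.Build _ _ _ _ G mG).
have := @ge0_integral_distribution _ _ _ _ _ P X h mh h0 => <-.
have := @ge0_integral_distribution _ _ _ _ _ Q Y h mh h0 => <-.
by apply: eq_measure_integral => A mA _; exact: FG.
Qed.

Lemma Ex_same_law (F : T -> R) (G : T' -> R) (h : R -> R) :
  measurable_fun setT F -> measurable_fun setT G -> same_law F G ->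
  measurable_fun setT h -> itg P (fun w => h (F w)) ->
  itg Q (fun w => h (G w)) /\ Ex P (fun w => h (F w)) = Ex Q (fun w => h (G w)).
Proof.
move=> mF mG FG mh iF.
pose X : {mfun T >-> R} := HB.pack F (@isMeasurableFun.Build _ _ _ _ F mF).
pose Y : {mfun T' >-> R} := HB.pack G (@isMeasurableFun.Build _ _ _ _ G mG).
have iG : itg Q (fun w => h (G w)).
  apply/integrableP; split; first by apply/measurable_EFinP; exact: (measurableT_comp mh mG).
  rewrite -(@ge0_integral_same_law F G (fun x => `|(h x)%:E|)%E)//.
    by have /integrableP[] := iF.
  by apply: measurableT_comp => //; exact/measurable_EFinP.
split => //; apply: EFin_inj; rewrite !EFin_Ex//.
have mhE : measurable_fun setT (EFin \o h) by exact/measurable_EFinP.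
have := @integral_distribution _ _ _ _ _ P X (EFin \o h) mhE iF => <-.
have := @integral_distribution _ _ _ _ _ Q Y (EFin \o h) mhE iG => <-.
by apply: eq_measure_integral => A mA _; exact: FG.
Qed.

End SameLaw.

Section PositiveExpectation.
Context {R : realType} {d : measure_display} {T : measurableType d} (P : probability T R).

Lemma Ex_eq0 (f : T -> R) : itg P f -> (forall x, 0 <= f x) -> Ex P f = 0 ->
  P (f @^-1` [set 0]) = 1%E.
Proof.
move=> If f0 E0; have mf := itg_meas If.
have mZ : measurable (f @^-1` [set 0]).
  by rewrite -[X in measurable X]setTI; apply: mf.
have : (\int[P]_x `|(f x)%:E| = 0)%E.
  under eq_integral do rewrite gee0_abs ?lee_fin//.
  by rewrite -EFin_Ex// E0.
have mfE : measurable_fun setT (EFin \o f) by exact/measurable_EFinP.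
move=> /(ae_eq_integral_abs P measurableT mfE) [N [mN N0 sub]].
have : P (~` (f @^-1` [set 0])) = 0%E.
  apply/eqP; rewrite eq_le measure_ge0 andbT -N0; apply: le_measure; rewrite ?inE//.
    exact: measurableC.
  move=> x /= fx; apply: sub => /= h; apply: fx; have /(_ I) [] := h => //.
rewrite probability_setC// -(fineK (fin_num_measure P _ mZ)) -EFinB => -[/eqP].
by rewrite subr_eq0 => /eqP <-.
Qed.

Lemma Ex_gt0 (f : T -> R) : itg P f -> (forall x, 0 < f x) -> 0 < Ex P f.
Proof.
move=> If f0; rewrite lt_neqAle Ex_ge0 ?andbT => [|x]; last exact: ltW.
apply/eqP => /esym E0; have := Ex_eq0 If (fun x => ltW (f0 x)) E0.
rewrite (_ : f @^-1` _ = set0); last first.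
  by apply/seteqP; split => x //= fx; have := f0 x; rewrite fx ltxx.
by rewrite measure0 => /eqP; rewrite eqe eq_sym oner_eq0.
Qed.

End PositiveExpectation.

(** * Exponential moments of a Lévy process *)

Section LevyMoments.
Context {R : realType} {d : measure_display} {Om : measurableType d} (P : probability Om R).
Variable X : R -> Om -> R.
Hypothesis LX : levy_process P X.

Let mX t : 0 <= t -> measurable_fun setT (X t).
Proof. by case: LX => m _; exact: m. Qed.

Let X0 w : X 0 w = 0.
Proof. by case: LX => _ [h _]. Qed.

Lemma indep2_cst_l (c : R) (F G : Om -> R) : (forall w, F w = c) -> indep2 P F G.
Proof.
move=> Fc A B mA mB; have [Ac|Ac] := pselect (A c).
  by rewrite (_ : F @^-1` A = setT) ?setTI ?probability_setT ?mul1e//;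
    apply/seteqP; split => w //= _; rewrite Fc.
by rewrite (_ : F @^-1` A = set0) ?set0I ?measure0 ?mul0e//;
  apply/seteqP; split => w //=; rewrite Fc.
Qed.

Lemma indep2C (F G : Om -> R) : indep2 P F G -> indep2 P G F.
Proof. by move=> FG A B mA mB; rewrite setIC FG// muleC. Qed.

(** The process starts at 0, so X s is itself an increment, and the grid 0 < s < s + t applies.
    Grids are strictly increasing, hence s = 0 and t = 0 are treated apart: there one of the two
    variables is constant. *)
Lemma levy_indep_increment (s t : R) : 0 <= s -> 0 <= t ->
  indep2 P (X s) (fun w => X (s + t) w - X s w).
Proof.
rewrite le_eqVlt => /predU1P[<-|s0].
  by move=> _; apply: (@indep2_cst_l 0).
rewrite le_eqVlt => /predU1P[<-|t0].
  by apply/indep2C/(@indep2_cst_l 0) => w; rewrite addr0 subrr.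
move=> A B mA mB; have [_ [_ [_ [_ ind]]]] := LX.
pose ts (k : 'I_3) : R := if (k : nat) is k'.+1 then (if k' is _.+1 then s + t else s) else 0.
have ts0 k : 0 <= ts k.
  by case: k => -[|[|k]] ?; rewrite /ts/= ?lexx ?(ltW s0)// addr_ge0 ?ltW.
have tsm (i j : 'I_3) : (i < j)%N -> ts i < ts j.
  by move: i j => [[|[|[|?]]] ?] [[|[|[|?]]] ?] // _; rewrite /ts/= ?ltrDl// addr_gt0.
have := ind 2%N ts ts0 tsm (fun k : 'I_2 => if (k : nat) is 0 then A else B).
have mAB (k : 'I_2) : measurable (if (k : nat) is 0 then A else B) by case: k => -[|k].
move=> /(_ mAB); rewrite big_ord_recl big_ord1/=.
have X0' w : X 0 w = 0 by exact: X0.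
set F0 := (fun w : Om => _) @^-1` A; set F1 := (fun w : Om => _) @^-1` B.
have -> : F0 = X s @^-1` A.
  by apply/seteqP; split => w /=; rewrite /F0/= /ts/= X0 subr0.
have -> : F1 = (fun w => X (s + t) w - X s w) @^-1` B by [].
move=> <-; congr (P _); apply/seteqP; split => w /=.
  by move=> [Aw Bw] [[|[|k]]] // Hk _; rewrite /= /ts/= ?X0 ?subr0.
move=> h; split.
  by have /(_ I) := h (@Ordinal 2 0 isT); rewrite /= /ts/= X0 subr0.
by have /(_ I) := h (@Ordinal 2 1 isT).
Qed.

End LevyMoments.

Section LevyMgf.
Context {R : realType} {d : measure_display} {Om : measurableType d} (P : probability Om R).
Variable X : R -> Om -> R.
Hypothesis LX : levy_process P X.
Hypothesis iX1 : forall u : R, itg P (fun w => expR (u * X 1 w)).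

Let mX t : 0 <= t -> measurable_fun setT (X t).
Proof. by case: LX => m _; exact: m. Qed.

Lemma measurable_expRZ (u : R) : measurable_fun setT (fun x : R => expR (u * x)).
Proof. by apply: measurableT_comp => //; exact: measurable_funM. Qed.

Let G (u t : R) : \bar R := (\int[P]_w (expR (u * X t w))%:E)%E.

Lemma levy_stationary (s t : R) : 0 <= s -> 0 <= t ->
  same_law P P (fun w => X (s + t) w - X s w) (X t).
Proof. by move=> s0 t0 B mB; have [_ [_ [_ [st _]]]] := LX; exact: st. Qed.

Let mincr s t : 0 <= s -> 0 <= t -> measurable_fun setT (fun w => X (s + t) w - X s w).
Proof. by move=> s0 t0; apply: measurable_funB; apply: mX => //; exact: addr_ge0. Qed.

(** [G] takes extended real values, so that multiplicativity in time is available before finiteness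
    and can be used to prove it. *)
Let G_add u s t : 0 <= s -> 0 <= t -> (G u (s + t) = G u s * G u t)%E.
Proof.
move=> s0 t0; have mu := measurable_expRZ u.
have ind := indep2_comp (levy_indep_increment LX s0 t0) mu mu erefl erefl.
have := integral_abs_indep2 ind (measurableT_comp mu (mX s0))
  (measurableT_comp mu (mincr s0 t0)).
have abs1 (F : Om -> R) : (\int[P]_x `|(expR (F x))%:E| = \int[P]_x (expR (F x))%:E)%E.
  by apply: eq_integral => x _; rewrite gee0_abs// lee_fin expR_ge0.
move=> H; transitivity (\int[P]_x `|(expR (u * X s x) * expR (u * (X (s + t) x - X s x)))%:E|)%E.
  apply: eq_integral => x _; rewrite -expRD -mulrDr [X s x + _]addrC subrK.
  by rewrite gee0_abs ?lee_fin ?expR_ge0.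
rewrite [LHS]H; congr (_ * _)%E; first exact: (abs1 (fun x => u * X s x)).
rewrite [LHS](abs1 (fun x => u * (X (s + t) x - X s x))).
apply: (ge0_integral_same_law (mincr s0 t0) (mX t0) (levy_stationary s0 t0)
  (h := fun x => (expR (u * x))%:E)); first exact/measurable_EFinP.
by move=> x; rewrite lee_fin expR_ge0.
Qed.

Let G_ge0 u t : (0 <= G u t)%E.
Proof. by apply: integral_ge0 => w _; rewrite lee_fin expR_ge0. Qed.

Let G_neq0 u t : 0 <= t -> G u t != 0%E.
Proof.
move=> t0; apply/eqP => G0.
have mE : measurable_fun setT (fun w => expR (u * X t w)).
  exact: (measurableT_comp (measurable_expRZ u) (mX t0)).
have iE : itg P (fun w => expR (u * X t w)).
  by apply: itg_ge0P => //; rewrite -/(G u t) G0 ltry.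
have := Ex_gt0 iE (fun w => expR_gt0 _); rewrite -lte_fin EFin_Ex//.
by rewrite -/(G u t) G0 ltxx.
Qed.

Let G1_fin u : (G u 1 < +oo)%E.
Proof.
have /integrableP[_] := iX1 u; congr (_ < _)%E; apply: eq_integral => w _.
by rewrite gee0_abs// lee_fin expR_ge0.
Qed.

Let Gn_fin u (n : nat) : (G u n%:R < +oo)%E.
Proof.
elim: n => [|n IH].
  rewrite /G (_ : (fun w => _) = cst 1%E); last first.
    by apply/funext => w; case: LX => _ [-> _]; rewrite mulr0 expR0.
  by rewrite integral_cst// mul1e (le_lt_trans (probability_le1 _ _))// ltry.
by rewrite -natr1 G_add// lte_mul_pinfty// ge0_fin_numE.
Qed.

(** For an integer n >= t, the finite moment at time n is the product of those at t and n - t.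
    Neither factor is 0, so neither is infinite. *)
Lemma levy_itg_expR u t : 0 <= t -> itg P (fun w => expR (u * X t w)).
Proof.
move=> t0; apply: itg_ge0P => [|w|].
- exact: (measurableT_comp (measurable_expRZ u) (mX t0)).
- exact: expR_ge0.
- rewrite -/(G u t); have [n tn] : exists n : nat, t <= n%:R.
    by exists (Num.bound t); apply: ltW; exact: archi_boundP.
  have nt0 : 0 <= n%:R - t by rewrite subr_ge0.
  have := Gn_fin u n; rewrite -[n%:R](subrKC t) (G_add _ t0 nt0).
  case: (G u t) (G_ge0 u t) (G_neq0 u t0) => [r| |] // _ _; first by rewrite ltry.
  by rewrite gt0_mulye ?ltxx// lt_neqAle G_ge0 eq_sym G_neq0.
Qed.

Let g u t := Ex P (fun w => expR (u * X t w)).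

Let gE u t : 0 <= t -> (g u t)%:E = G u t.
Proof. by move=> t0; rewrite /g EFin_Ex//; exact: levy_itg_expR. Qed.

Let g_gt0 u t : 0 <= t -> 0 < g u t.
Proof. by move=> t0; apply: Ex_gt0 => [|w]; [exact: levy_itg_expR|exact: expR_gt0]. Qed.

Let L u t := ln (g u t).

Let L_add u s t : 0 <= s -> 0 <= t -> L u (s + t) = L u s + L u t.
Proof.
move=> s0 t0; rewrite /L -lnM ?posrE ?g_gt0//; congr ln; apply: EFin_inj.
by rewrite EFinM !gE ?addr_ge0// G_add.
Qed.

Let L_natM u (t : R) (n : nat) : 0 <= t -> L u (n%:R * t) = n%:R * L u t.
Proof.
move=> t0; elim: n => [|n IH].
  by have := L_add u (lexx 0) (lexx 0); rewrite !mul0r addr0 => /eqP; rewrite -subr_eq subrr => /eqP.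
by rewrite -natr1 !mulrDl !mul1r L_add ?mulr_ge0// IH.
Qed.

Let L_rat u (m n : nat) : L u (m%:R / n.+1%:R) = m%:R / n.+1%:R * L u 1.
Proof.
have n0 : n.+1%:R != 0 :> R by rewrite pnatr_eq0.
apply: (mulfI n0); rewrite -L_natM; last by rewrite divr_ge0.
rewrite mulrCA mulfV// mulr1 mulrA mulrCA mulfV// mulr1.
by rewrite -{1}[m%:R]mulr1 L_natM.
Qed.

(** Rational times decrease to [t], where [L] is already known to be linear; right continuity of the
    paths and Fatou's lemma bound the moment at [t] by the limit. *)
Let L_le u t : 0 <= t -> L u t <= t * L u 1.
Proof.
move=> t0.
(* A rational strictly above [t] and within 1 / (n + 1) of it; strictness is what a limit from the
   right requires. *)
pose tn (n : nat) : R := (Num.truncn (t * n.+1%:R)).+1%:R / n.+1%:R.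
have n0 n : 0 < n.+1%:R :> R by rewrite ltr0n.
have tn_gt n : t < tn n.
  by rewrite /tn ltr_pdivlMr// truncnS_gt.
have tn_le n : tn n - t <= n.+1%:R^-1.
  rewrite lerBlDr /tn ler_pdivrMr// mulrDl mulVf ?gt_eqF// -natr1 addrC lerD2l.
  by rewrite truncn_le// mulr_ge0.
have tn_cvg : tn n @[n --> \oo] --> t.
  rewrite -[X in _ --> X]add0r (_ : tn = fun n => (tn n - t) + t); last first.
    by apply/funext => n; rewrite subrK.
  apply: (@cvgD _ R^o); last exact: cvg_cst.
  apply: (norm_squeeze0 _ cvg_harmonic) => n; rewrite ger0_norm ?tn_le// subr_ge0.
  exact: ltW.
have tn0 n : 0 <= tn n by exact: le_trans t0 (ltW (tn_gt n)).
have Xcvg w : X (tn n) w @[n --> \oo] --> X t w.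
  have [_ [_ [cad _]]] := LX; have [rc _] := cad w.
  have /cvg_at_rightP := rc t t0; move=> /(_ tn); apply; split => //.
have Ecvg w : (expR (u * X (tn n) w))%:E @[n --> \oo] --> (expR (u * X t w))%:E.
  apply: cvg_EFin; first exact: nearW.
  apply: continuous_cvg; first exact: continuous_expR.
  by apply: cvgM; [exact: cvg_cst|exact: Xcvg].
have := @fatou _ _ _ P setT measurableT (fun n w => (expR (u * X (tn n) w))%:E).
rewrite (_ : (fun w => limn_einf _) = fun w => (expR (u * X t w))%:E); last first.
  by apply/funext => w; exact: (cvg_limn_einf_sup (Ecvg w)).1.
have mE n : measurable_fun setT (fun w => (expR (u * X (tn n) w))%:E).
  apply/measurable_EFinP; exact: (measurableT_comp (measurable_expRZ u) (mX (tn0 n))).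
move=> /(_ mE (fun n w _ => _)) h.
have {}h : ((g u t)%:E <= limn_einf (fun n => (g u (tn n))%:E))%E.
  rewrite gE//; apply: (le_trans (h _)) => [n w|]; first by rewrite lee_fin expR_ge0.
  rewrite (_ : (fun n => (g u (tn n))%:E) = fun n => G u (tn n))//.
  by apply/funext => n; rewrite gE.
have gc : (g u (tn n))%:E @[n --> \oo] --> (expR (t * L u 1))%:E.
  apply: cvg_EFin; first exact: nearW.
  have -> : fine \o (fun n => (g u (tn n))%:E) = fun n => expR (tn n * L u 1).
    by apply/funext => n /=; rewrite /tn -L_rat /L lnK// posrE g_gt0// tn0.
  apply: continuous_cvg; first exact: continuous_expR.
  by apply: cvgM => //; exact: cvg_cst.
rewrite (cvg_limn_einf_sup gc).1 lee_fin in h.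
by rewrite /L -ler_expR lnK// posrE g_gt0.
Qed.

(** The reverse of the inequality from Fatou's lemma comes from the same inequality at n - t, since
    the values at t and n - t add up to the known value at the integer n. *)
Lemma levy_mgf u t : 0 <= t ->
  Ex P (fun w => expR (u * X t w)) = expR (t * ln (Ex P (fun w => expR (u * X 1 w)))).
Proof.
move=> t0; rewrite -[LHS]/(g u t) -[ln _]/(L u 1).
suff <- : L u t = t * L u 1 by rewrite /L lnK// posrE g_gt0.
apply/eqP; rewrite eq_le L_le//=.
have [n tn] : exists n : nat, t <= n%:R.
  by exists (Num.bound t); apply: ltW; exact: archi_boundP.
have nt0 : 0 <= n%:R - t by rewrite subr_ge0.
have := L_add u t0 nt0; rewrite subrKC -{1}[n%:R]mulr1 L_natM// => h.
by rewrite -(lerD2r (L u (n%:R - t))) -h -lerBrDl -mulrBl L_le.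
Qed.

End LevyMgf.

(** * The cumulant generating function near 2 *)

Lemma exponent_algebra {R : realType} (a b h lam : R) :
  a - b <= h * ((lam + b) / 2) -> a - (h + 2) * b / 2 <= ((h + 2) / 2 - 1) * lam.
Proof. lra. Qed.

Section CumulantGenerating.
Context {R : realType} {d : measure_display} {Om : measurableType d} (P : probability Om R).
Variable xi : Om -> R.
Hypothesis mxi : measurable_fun setT xi.
Hypothesis iexp : forall u : R, itg P (fun w => expR (u * xi w)).

Let m (u : R) : R := Ex P (fun w => expR (u * xi w)).
Let psi (u : R) : R := ln (m u).

Let m_gt0 u : 0 < m u.
Proof. by apply: Ex_gt0 => [//|w]; exact: expR_gt0. Qed.

(** Differentiation under the expectation for v in (1, 3): |x| exp (v x) <= exp (|x| + v x), which
    is at most exp (4 x) for x >= 0 and at most 1 for x <= 0. *)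
Lemma derivable_mgf2 : derivable m 2 1.
Proof.
pose f (u : R) (w : Om) := expR (u * xi w).
have df (v : R) (w : Om) : is_derive v 1 (f ^~ w) (xi w * f v w).
  by rewrite /f; apply: trigger_derive; rewrite /GRing.scale/=; ring.
have I2 : `]1, 3[%classic (2 : R) by rewrite /= in_itv/=; apply/andP; split; lra.
have A1 v w : `]1, 3[%classic v -> setT w -> derivable (f ^~ w) v 1.
  by move=> _ _; exact: ex_derive.
have A2 w : 0 <= expR (4 * xi w) + 1 by rewrite addr_ge0// expR_ge0.
have intG : P.-integrable setT (EFin \o (fun w => expR (4 * xi w) + 1)).
  by apply: itgD => //; exact: itg_cst.
have A3 v w : `]1, 3[%classic v -> setT w -> `|@partial1of2 R _ f v w| <= expR (4 * xi w) + 1.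
  rewrite /= in_itv/= => /andP[v1 v3] _; rewrite partial1of2E derive_val.
  rewrite normrM (ger0_norm (expR_ge0 _)) /f.
  have yb : `|xi w| <= expR `|xi w|.
    by apply: le_trans (expR_ge1Dx _); rewrite lerDr.
  apply: (@le_trans _ _ (expR `|xi w| * expR (v * xi w))).
    by rewrite ler_wpM2r ?expR_ge0.
  rewrite -expRD; have [y0|/ltW y0] := leP 0 (xi w).
    by rewrite ger0_norm// ler_wpDr// ler_expR; nra.
  by rewrite ler0_norm// ler_wpDl ?expR_ge0// -expR0 ler_expR; nra.
exact: (derivable_under_integral measurableT I2 (fun v _ => iexp v) A1 A2 intG A3).
Qed.

Lemma derivable_cgf2 : derivable psi 2 1.
Proof.
have dm : is_derive (2 : R) 1 m ('D_1 m 2) by apply: DeriveDef => //; exact: derivable_mgf2.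
have dl := is_derive1_ln (m_gt0 2).
exact: (@ex_derive _ _ _ _ _ _ _ (is_derive1_comp dl dm)).
Qed.

(** The assumption says psi' 2 < (lam + psi 2) / 2, so for small h > 0 the secant from 2 to p = 2 +
    h has slope below this number; subtracting h psi 2 / 2 gives the bound. The cap p <= 3 is what
    the remainder [rho] can use. *)
Lemma cgf_exponent (lam : R) : 2 * derive1 psi 2 - psi 2 < lam ->
  exists p, [/\ 2 < p, p <= 3 & psi p - p * psi 2 / 2 <= (p / 2 - 1) * lam].
Proof.
move=> lam_gt.
have lt2 : 'D_1 psi 2 < (lam + psi 2) / 2 by rewrite -derive1E ltr_pdivlMr//; lra.
have := cvgr_lt _ derivable_cgf2 _ lt2; rewrite near_withinE => -[e /= e0 eP].
pose h := Num.min (e / 2) 1.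
have h0 : 0 < h by rewrite lt_min ltr01 andbT divr_gt0.
have h1 : h <= 1 by rewrite ge_min lexx orbT.
have he : h < e.
  by apply: (@le_lt_trans _ _ (e / 2)); [rewrite ge_min lexx|rewrite ltr_pdivrMr//; lra].
have := eP h; rewrite /ball_/= sub0r normrN gtr0_norm// => /(_ he).
rewrite gt_eqF// => /(_ isT).
rewrite [h *: 1]mulr1 [_ *: _]mulrC ltr_pdivrMr// => /ltW q.
rewrite [_ * h]mulrC in q.
exists (h + 2); split.
- by rewrite ltrDr.
- by rewrite (_ : 3 = 1 + 2) ?lerD2r//; ring.
- exact: (exponent_algebra q).
Qed.

(** Otherwise E exp (2 xi) <= (E exp xi)^2, so exp xi has zero variance and xi equals psi 1 almost
    surely. *)
Lemma cgf_strictly_convex12 : ~ (exists c : R, P (xi @^-1` [set c]) = 1%E) ->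
  2 * psi 1 < psi 2.
Proof.
move=> nc; rewrite ltNge; apply/negP => le21; apply: nc; exists (psi 1).
have m21 : m 2 <= m 1 ^+ 2.
  rewrite -ler_ln ?posrE ?exprn_gt0 ?m_gt0// lnXn ?m_gt0//.
  by have -> : ln (m 1) *+ 2 = 2 * psi 1 by rewrite mulr_natl.
pose v w := (expR (1 * xi w) - m 1) ^+ 2.
have vE w : v w = expR (2 * xi w) - 2 * m 1 * expR (1 * xi w) + m 1 ^+ 2.
  rewrite /v sqrrB -expRM_natl mul1r [_ *+ 2 in LHS]mulr2n; ring.
have iv : itg P v.
  rewrite (_ : v = fun w => expR (2 * xi w) - 2 * m 1 * expR (1 * xi w) + m 1 ^+ 2).
    by apply: itgD; [apply: itgB => //; exact: itgZ|exact: itg_cst].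
  by apply/funext.
have v0 w : 0 <= v w by exact: sqr_ge0.
have Ev : Ex P v = 0.
  apply/eqP; rewrite eq_le Ex_ge0// andbT.
  rewrite (_ : v = fun w => expR (2 * xi w) - 2 * m 1 * expR (1 * xi w) + m 1 ^+ 2); last first.
    by apply/funext.
  have i1 := itgZ (2 * m 1) (iexp 1).
  rewrite (ExD (itgB (iexp 2) i1) (itg_cst P _)) (ExB (iexp 2) i1) (ExZ _ (iexp 1)) Ex_cst.
  rewrite (_ : _ + _ = m 2 - m 1 ^+ 2) ?subr_le0//; rewrite /m; ring.
have <- := Ex_eq0 iv v0 Ev; congr (P _); apply/seteqP; split => w /=.
  by rewrite /v => ->; rewrite mul1r lnK ?posrE ?m_gt0// subrr expr0n.
move/eqP; rewrite /v sqrf_eq0 subr_eq0 mul1r => /eqP E.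
by rewrite -[psi 1]/(ln (m 1)) -E expRK.
Qed.

End CumulantGenerating.

(** * Sigma-algebras of several independent processes and their generating pi-systems *)

Definition process_space {R : realType} {d : measure_display} {Om : measurableType d}
    (X : R -> Om -> R) :=
  g_sigma_algebraType [set A | exists (t : R) (B : set R),
    0 <= t /\ measurable B /\ A = X t @^-1` B].

Section ProductSystem.
Context {R : realType} {d : measure_display} {Om : measurableType d} (P : probability Om R).
Variable xis : nat -> R -> Om -> R.
Hypothesis mxis : forall i t, 0 <= t -> measurable_fun setT (xis i t).
Hypothesis ind : indep_processes P xis.

Lemma process_sigma_measurable i : process_sigma (xis i) `<=` measurable.
Proof.
apply: smallest_sub; first exact: sigma_algebra_measurable.
move=> A [t [B [t0 [mB ->]]]].
by rewrite -[X in measurable X]setTI; apply: mxis.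
Qed.

Lemma process_sigma_value i t B : 0 <= t -> measurable B ->
  process_sigma (xis i) (xis i t @^-1` B).
Proof. by move=> t0 mB; apply: sub_sigma_algebra; exists t, B. Qed.

Lemma measurable_process_value i t : 0 <= t ->
  @measurable_fun _ _ (process_space (xis i)) R setT (xis i t).
Proof. by move=> t0 _ B mB; rewrite setTI; exact: process_sigma_value. Qed.

Lemma process_sigmaI i A B : process_sigma (xis i) A -> process_sigma (xis i) B ->
  process_sigma (xis i) (A `&` B).
Proof. by move=> sA sB; exact: (@measurableI _ (process_space (xis i)) A B). Qed.

Lemma process_sigmaT i : process_sigma (xis i) setT.
Proof. exact: (@measurableT _ (process_space (xis i))). Qed.

Variable C : nat -> set (set Om).
Hypothesis Csub : forall j, C j `<=` process_sigma (xis j).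
Hypothesis CI : forall j, setI_closed (C j).
Hypothesis CT : forall j, C j setT.

(** One event from each of the first [n] processes, drawn from a class [C j] left as a parameter:
    the whole sigma-algebra of a process to compare particles with each other, or the cylinders of a
    time grid to describe their common past. *)
Definition product_system (n : nat) : set (set Om) :=
  [set A | exists2 B : nat -> set Om, (forall j, C j (B j)) & A = \bigcap_(j in `I_n) B j].

Lemma indep_processes_bigcap n (B : nat -> set Om) :
  (forall j, (j < n)%N -> process_sigma (xis j) (B j)) ->
  P (\bigcap_(j in `I_n) B j) = (\prod_(j < n) P (B j))%E.
Proof.
move=> sB; have inj : injective (fun k : 'I_n => k : nat) by move=> i j; exact: ord_inj.
rewrite -(ind inj (fun k => sB _ (ltn_ord k))); congr (P _).
apply/seteqP; split => w /= h j; first by move=> _; exact: (h j (ltn_ord j)).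
by move=> jn; exact: (h (Ordinal jn) I).
Qed.

Lemma product_systemI n : setI_closed (product_system n).
Proof.
move=> _ _ [A cA ->] [B cB ->]; exists (fun j => A j `&` B j).
  by move=> j; exact: CI.
by rewrite -bigcapI.
Qed.

Lemma product_systemT n : product_system n setT.
Proof. by exists (fun=> setT) => //; rewrite bigcapT. Qed.

Lemma product_system_measurable n : product_system n `<=` measurable.
Proof.
move=> _ [B cB ->]; apply: bigcap_measurableType => j _.
by apply: (@process_sigma_measurable j); apply: Csub; exact: cB.
Qed.

Lemma product_system1 n i A : (i < n)%N -> C i A -> product_system n A.
Proof.
move=> i_n cA; exists (fun j => if j == i then A else setT).
  by move=> j; case: eqP => [->|].
apply/seteqP; split => w /=; first by move=> Aw j _; case: eqP.
by move=> /(_ i i_n); rewrite eqxx.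
Qed.

Lemma product_system_new n A E : product_system n A -> process_sigma (xis n) E ->
  P (A `&` E) = (P A * P E)%E.
Proof.
move=> [B cB ->] sE; pose B' j := if j == n then E else B j.
have B'n j : (j < n)%N -> B' j = B j by rewrite /B'; case: eqP => // ->; rewrite ltnn.
have -> : \bigcap_(j in `I_n) B j `&` E = \bigcap_(j in `I_n.+1) B' j.
  apply/seteqP; split => w /=.
    move=> [Bw Ew] j; rewrite /= ltnS leq_eqVlt => /predU1P[->|jn].
      by rewrite /B' eqxx.
    by rewrite B'n//; exact: Bw.
  move=> h; split; last by have := h n (ltnSn n); rewrite /B' eqxx.
  by move=> j jn; rewrite -B'n//; apply: h; exact: ltnW.
rewrite !indep_processes_bigcap.
- rewrite big_ord_recr/= {2}/B' eqxx; congr (_ * _)%E.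
  by apply: eq_bigr => j _; rewrite B'n.
- by move=> j _; apply: Csub.
- move=> j; rewrite ltnS leq_eqVlt => /predU1P[->|jn]; first by rewrite /B' eqxx.
  by rewrite B'n//; exact: Csub.
Qed.

(** An event of particle [i] meets only the i-th factor of the product. It is absorbed there, split
    off by the assumed independence from [C i], and the other factors are unchanged. *)
Lemma product_system_increment n i A E : (i < n)%N -> process_sigma (xis i) E ->
  (forall B, C i B -> P (B `&` E) = (P B * P E)%E) -> product_system n A ->
  P (A `&` E) = (P A * P E)%E.
Proof.
move=> i_n sE BE [B cB ->]; pose B' j := if j == i then B j `&` E else B j.
have -> : \bigcap_(j in `I_n) B j `&` E = \bigcap_(j in `I_n) B' j.
  apply/seteqP; split => w /=.
    by move=> [Bw Ew] j jn; rewrite /B'; case: eqP => // _; [split => //|]; exact: Bw.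
  move=> h; split; last by have := h i i_n; rewrite /B' eqxx => -[].
  by move=> j jn; have := h j jn; rewrite /B'; case: eqP => // _ [].
rewrite !indep_processes_bigcap.
- rewrite (bigD1 (Ordinal i_n))//= [in RHS](bigD1 (Ordinal i_n))//= /B' eqxx BE//.
  rewrite -!muleA; congr (_ * _)%E; rewrite muleC; congr (_ * _)%E.
  by apply: eq_bigr => j ji; rewrite ifF//; exact/negbTE.
- by move=> j _; apply: Csub.
- move=> j jn; rewrite /B'; case: eqP => [->|_]; last exact: Csub.
  by apply: process_sigmaI => //; exact: Csub.
Qed.

(** Like [process_space], a copy of the sample space carrying a generated sigma-algebra, so that
    closure properties of measurable functions apply to it directly. *)
Definition past n := g_sigma_algebraType (product_system n).

Lemma past_measurable_fun n (F : Om -> R) :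
  (forall B, measurable B -> product_system n (F @^-1` B)) ->
  @measurable_fun _ _ (past n) R setT F.
Proof. by move=> h _ B mB; rewrite setTI; apply: sub_sigma_algebra; exact: h. Qed.

Lemma past_measurable n (F : Om -> R) : @measurable_fun _ _ (past n) R setT F ->
  measurable_fun setT F.
Proof.
move=> mF _ B mB; rewrite setTI; have := mF measurableT B mB; rewrite setTI.
exact: (smallest_sub (@sigma_algebra_measurable _ Om) (@product_system_measurable n)).
Qed.

Lemma past_indep2 n (F V : Om -> R) : @measurable_fun _ _ (past n) R setT F ->
  measurable_fun setT V ->
  (forall A B, product_system n A -> measurable B ->
     P (A `&` V @^-1` B) = (P A * P (V @^-1` B))%E) ->
  indep2 P F V.
Proof.
move=> mF mV h A B mA mB.
have mVB : measurable (V @^-1` B) by rewrite -[X in measurable X]setTI; apply: mV.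
apply: (indep_sigma_l mVB (@product_system_measurable n) (@product_systemI n)
  (@product_systemT n)) => [A' GA'|]; first exact: h.
by have := mF measurableT A mA; rewrite setTI.
Qed.

End ProductSystem.

(** * Increments of a Lévy process along a time grid *)

Section LevyGrid.
Context {R : realType} {d : measure_display} {Om : measurableType d} (P : probability Om R).
Variable X : R -> Om -> R.
Hypothesis LX : levy_process P X.
Variable tau : nat -> R.
Hypothesis tau0 : tau 0 = 0.
Hypothesis tau_mono : forall k, tau k < tau k.+1.

Let tau_lt i j : (i < j)%N -> tau i < tau j.
Proof.
elim: j => // j IH; rewrite ltnS leq_eqVlt => /predU1P[->//|/IH ij].
exact: lt_trans ij (tau_mono j).
Qed.

Lemma grid_ge0 k : 0 <= tau k.
Proof. by case: k => [|k]; rewrite -tau0// ltW// tau_lt. Qed.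

Definition grid_increment l w := X (tau l.+1) w - X (tau l) w.

(** Rectangles in the increments, not in the values: this is the form on which independence of
    increments is stated, and the values are recovered by summation. *)
Definition grid_cylinder (n : nat) : set (set Om) :=
  [set A | exists2 B : nat -> set R, (forall l, measurable (B l)) &
    A = \bigcap_(l in `I_n) (grid_increment l @^-1` B l)].

Lemma grid_cylinderI n : setI_closed (grid_cylinder n).
Proof.
move=> _ _ [A mA ->] [B mB ->]; exists (fun l => A l `&` B l).
  by move=> l; exact: measurableI.
by rewrite -bigcapI; apply: eq_bigcapr => l _; rewrite preimage_setI.
Qed.

Lemma grid_cylinderT n : grid_cylinder n setT.
Proof. by exists (fun=> setT) => //; rewrite bigcapT. Qed.

Lemma grid_cylinder_sigma n : grid_cylinder n `<=` process_sigma X.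
Proof.
move=> _ [B mB ->].
pose U := process_space X.
apply: (@bigcap_measurableType _ U) => l _.
have mX t : 0 <= t -> @measurable_fun _ _ U R setT (X t).
  by move=> t0 _ E mE; rewrite setTI; apply: sub_sigma_algebra; exists t, E.
have := @measurable_funB _ U R setT _ _ (mX _ (grid_ge0 l.+1)) (mX _ (grid_ge0 l)).
by move=> /(_ measurableT _ (mB l)); rewrite setTI.
Qed.

Lemma grid_cylinder1 n l B : (l < n)%N -> measurable B ->
  grid_cylinder n (grid_increment l @^-1` B).
Proof.
move=> ln mB; exists (fun k => if k == l then B else setT).
  by move=> k; case: eqP.
apply/seteqP; split => w /=; first by move=> Bw k _; case: eqP => [->|].
by move=> /(_ l ln); rewrite eqxx.
Qed.

(** Independence of increments is applied to the grid tau 0 < ... < tau n extended by the final time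
    [s]; the last increment is the one to be split off. *)
Lemma grid_cylinder_indep n A (s : R) B : grid_cylinder n A -> tau n < s -> measurable B ->
  P (A `&` (fun w => X s w - X (tau n) w) @^-1` B) =
  (P A * P ((fun w => (X s w - X (tau n) w)%R) @^-1` B))%E.
Proof.
move=> [C mC ->] ns mB; have [_ [_ [_ [_ ind]]]] := LX.
pose ts (k : 'I_n.+2) : R := if (k <= n)%N then tau k else s.
have ts0 k : 0 <= ts k.
  by rewrite /ts; case: ifP => _; [exact: grid_ge0|exact: le_trans (grid_ge0 n) (ltW ns)].
have tsm (i j : 'I_n.+2) : (i < j)%N -> ts i < ts j.
  move=> ij; rewrite /ts; have [jn|nj] := leqP j n.
    by rewrite (ltnW (leq_trans ij jn)) tau_lt.
  case: leqP => [i_n|ni]; last first.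
    by exfalso; move: ij; rewrite ltnNge => /negP; apply; rewrite -ltnS (leq_trans (ltn_ord j)).
  by apply: le_lt_trans ns; move: i_n; rewrite leq_eqVlt => /predU1P[->//|/tau_lt/ltW].
pose V w := X s w - X (tau n) w.
have key (E : set R) : measurable E ->
    P (\bigcap_(l in `I_n) (grid_increment l @^-1` C l) `&` V @^-1` E) =
    ((\prod_(l < n) P (grid_increment l @^-1` C l)) * P (V @^-1` E))%E.
  move=> mE; pose D (k : 'I_n.+1) := if (k < n)%N then C k else E.
  have mD k : measurable (D k) by rewrite /D; case: ifP.
  have incr (k : 'I_n.+1) : (k < n)%N ->
      (fun w => X (ts (lift ord0 k)) w - X (ts (widen_ord (leqnSn n.+1) k)) w) =
      grid_increment k.
    by move=> kn; rewrite /ts /= kn ltnW.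
  have incrn : (fun w => X (ts (lift ord0 (@ord_max n))) w -
      X (ts (widen_ord (leqnSn n.+1) (@ord_max n))) w) = V.
    by rewrite /ts /= ltnn leqnn.
  have := ind n.+1 ts ts0 tsm D mD.
  rewrite big_ord_recr/= incrn {3}/D ltnn => H.
  transitivity (P (\bigcap_(k in [set: 'I_n.+1])
    ((fun w => X (ts (lift ord0 k)) w - X (ts (widen_ord (leqnSn n.+1) k)) w) @^-1` D k))).
    congr (P _); apply/seteqP; split => w.
      move=> [Cw Ew] k _; have [kn|nk] := ltnP k n.
        by rewrite incr// /D kn; exact: Cw.
      have -> : k = ord_max by apply/val_inj/eqP; rewrite /= eqn_leq nk -ltnS ltn_ord.
      by rewrite incrn /D ltnn.
    move=> h; split.
      move=> l /= ln; have := h (Ordinal (ltnW (ln : (l < n)%N) : (l < n.+1)%N)) I.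
      by rewrite incr// /D /= ln.
    by have := h ord_max I; rewrite incrn /D ltnn.
  rewrite H; congr (_ * _)%E; apply: eq_bigr => k _.
  have kn : (widen_ord (leqnSn n) k < n)%N by exact: (ltn_ord k).
  by rewrite (incr _ kn) /D kn.
rewrite key//; congr (_ * _)%E.
(* With the whole line in the last slot, the same identity evaluates the probability of the
   cylinder. *)
have := key setT measurableT.
by rewrite preimage_setT setIT probability_setT mule1 => ->.
Qed.

End LevyGrid.

(** * Size of the Lindeberg remainder *)

Section RhoBounds.
Context {R : realType}.
Implicit Types x y : R.

Lemma rho_le_norm x y : `|x| <= `|y| -> rho x <= rho y.
Proof.
move=> xy; rewrite /rho le_min !ge_min; apply/andP; split.
  by rewrite -(real_normK (num_real x)) -(real_normK (num_real y)) lerXn2r ?nnegrE.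
by rewrite (@lerXn2r _ 3 `|x| `|y|) ?nnegrE// orbT.
Qed.

Lemma rho_scale_le (A x : R) : 1 <= A -> rho (A * x) <= A ^+ 3 * rho x.
Proof.
move=> A1; have A0 : 0 <= A by exact: le_trans A1.
have A23 : A ^+ 2 <= A ^+ 3 by rewrite ler_weXn2l.
have A30 : 0 <= A ^+ 3 by exact: exprn_ge0.
rewrite {2}/rho /Num.min; case: ifP => _.
  rewrite /rho ge_min; apply/orP; left; rewrite exprMn ler_wpM2r// sqr_ge0//.
by rewrite /rho ge_min; apply/orP; right; rewrite normrM exprMn ger0_norm.
Qed.

(** If |x| <= |y| then |x + y| <= |2 y|, and scaling by 2 costs 2^3 = 8. *)
Lemma rhoD_le x y : rho (x + y) <= 8 * (rho x + rho y).
Proof.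
wlog xy : x y / `|x| <= `|y| => [h|].
  have [/h//|/ltW/h] := leP `|x| `|y|; by rewrite addrC [rho y + _]addrC.
have h1 : rho (x + y) <= rho (2 * y).
  apply: rho_le_norm; rewrite normrM ger0_norm//.
  by rewrite (le_trans (ler_normD _ _))//; lra.
have h2 := @rho_scale_le 2 y (ler1n _ 2).
have h3 := rho_ge0 x; rewrite (le_trans h1)// (le_trans h2)//.
have := rho_ge0 y; rewrite (_ : 2 ^+ 3 = 8 :> R); last by ring.
lra.
Qed.

Lemma rho_sum_le (n : nat) (f : nat -> R) :
  rho (\sum_(k < n) f k) <= 8 ^+ n * \sum_(k < n) rho (f k).
Proof.
elim: n => [|n IH]; first by rewrite !big_ord0 mulr0 /rho expr0n/= ge_min lexx.
rewrite !big_ord_recr/= exprS.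
apply: (le_trans (rhoD_le _ _)); rewrite -mulrA ler_pM2l// mulrDr lerD//.
by rewrite ler_peMl ?rho_ge0// exprn_ege1// ler1n.
Qed.

Lemma rho_expR_le (p y : R) : 2 <= p <= 3 -> rho (expR y) <= expR (p * y).
Proof.
move=> /andP[p2 p3]; rewrite /rho ge_min ger0_norm ?expR_ge0// -!expRM_natl !ler_expR.
by have [y0|/ltW y0] := leP 0 y; apply/orP; [left|right]; nra.
Qed.

End RhoBounds.

(** * Moments of one particle divided by its mean *)

Section ParticleMoments.
Context {R : realType} {d : measure_display} {Om : measurableType d} (P : probability Om R).
Variables (X : R -> Om -> R) (psi : R -> R).
Hypothesis LX : levy_process P X.
Hypothesis mom : forall u t, 0 <= t -> itg P (fun w => expR (u * X t w)) /\
  Ex P (fun w => expR (u * X t w)) = expR (t * psi u).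
Let c2 := psi 2 - 2 * psi 1.

Definition emart t w := expR (X t w - psi 1 * t).

Let mX t : 0 <= t -> measurable_fun setT (X t).
Proof. by case: LX => m _; exact: m. Qed.

Lemma emart_power p t : 0 <= t -> itg P (fun w => expR (p * (X t w - psi 1 * t))) /\
  Ex P (fun w => expR (p * (X t w - psi 1 * t))) = expR (t * (psi p - p * psi 1)).
Proof.
move=> t0; have [i e] := mom p t0.
have E w : expR (p * (X t w - psi 1 * t)) = expR (- (p * psi 1 * t)) * expR (p * X t w).
  by rewrite -expRD; congr expR; ring.
split; first by under eq_fun do rewrite E; exact: itgZ.
under eq_fun do rewrite E.
by rewrite ExZ// e -expRD; congr expR; ring.
Qed.

Lemma emart_itg t : 0 <= t -> itg P (emart t).
Proof.
by move=> t0; have [+ _] := emart_power 1 t0; rewrite /emart; under eq_fun do rewrite mul1r.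
Qed.

Lemma Ex_emart t : 0 <= t -> Ex P (emart t) = 1.
Proof.
move=> t0; have [_] := emart_power 1 t0; rewrite /emart; under eq_fun do rewrite mul1r.
by move=> ->; rewrite mul1r subrr mulr0 expR0.
Qed.

Lemma emart_sqr t : 0 <= t -> itg P (fun w => emart t w ^+ 2) /\
  Ex P (fun w => emart t w ^+ 2) = expR (c2 * t).
Proof.
move=> t0; have [i e] := emart_power 2 t0.
have E w : emart t w ^+ 2 = expR (2 * (X t w - psi 1 * t)).
  by rewrite /emart -expRM_natl.
by split; under eq_fun do rewrite E; rewrite // e mulrC.
Qed.

Definition emart_ratio s t w := expR (X (s + t) w - X s w - psi 1 * t).

Lemma emartD s t w : emart (s + t) w = emart s w * emart_ratio s t w.
Proof. by rewrite /emart /emart_ratio -expRD; congr expR; ring. Qed.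

Let measurable_shift_expR (a : R) : measurable_fun setT (fun x : R => expR (x - a)).
Proof. by apply: measurableT_comp => //; exact: measurable_funB. Qed.

Lemma emart_ratio_law s t : 0 <= s -> 0 <= t ->
  itg P (emart_ratio s t) /\ Ex P (emart_ratio s t) = 1.
Proof.
move=> s0 t0.
have := Ex_same_law (Q := P) (mX t0) _ _ (measurable_shift_expR (psi 1 * t)) (emart_itg t0).
move=> /(_ (fun w => X (s + t) w - X s w)) [||i e].
- by apply: measurable_funB; apply: mX => //; exact: addr_ge0.
- by move=> B mB; have [_ [_ [_ [st _]]]] := LX; rewrite st.
by split => //; rewrite -(Ex_emart t0).
Qed.

(** The martingale property: the later value is the earlier one times an independent factor of mean
    1, so the mixed moment is the second moment at the earlier time. *)
Lemma emart_prod s t : 0 <= s -> s <= t -> itg P (fun w => emart s w * emart t w) /\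
  Ex P (fun w => emart s w * emart t w) = expR (c2 * s).
Proof.
move=> s0 st; pose u := t - s; have u0 : 0 <= u by rewrite subr_ge0.
have [i2 e2] := emart_sqr s0; have [iV eV] := emart_ratio_law s0 u0.
have msq : measurable_fun setT (fun x : R => expR (x - psi 1 * s) ^+ 2).
  exact: (measurable_funX 2 (measurable_shift_expR _)).
have ind : indep2 P (fun w => emart s w ^+ 2) (emart_ratio s u).
  exact: (indep2_comp (levy_indep_increment LX s0 u0) msq
    (measurable_shift_expR (psi 1 * u)) erefl erefl).
have [i e] := Ex_indep2 ind i2 iV.
have E w : emart s w * emart t w = emart s w ^+ 2 * emart_ratio s u w.
  by rewrite -[t](subrKC s) -/u emartD expr2 mulrA.
by split; under eq_fun do rewrite E; rewrite // e e2 eV mulr1.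
Qed.

Lemma emart_cov s t : 0 <= s -> 0 <= t -> itg P (fun w => emart s w * emart t w) /\
  Ex P (fun w => emart s w * emart t w) = expR (c2 * Num.min s t).
Proof.
move=> s0 t0; have [st|/ltW ts] := leP s t; first exact: emart_prod.
by under eq_fun do rewrite mulrC; exact: emart_prod.
Qed.

End ParticleMoments.

(** * Rows of particles: variance, Lyapunov condition, central limit theorem *)

Section RowVariance.
Context {R : realType} {d : measure_display} {Om : measurableType d} (P : probability Om R).

Lemma row_variance (W : nat -> Om -> R) (n : nat) (v r : R) : centered_row P W n v r ->
  itg P (fun w => (\sum_(i < n) W i w) ^+ 2) /\
  Ex P (fun w => (\sum_(i < n) W i w) ^+ 2) = n%:R * v.
Proof.
move=> [iW EW EW2 _ ind].
suff : forall k, (k <= n)%N -> itg P (fun w => (\sum_(i < k) W i w) ^+ 2) /\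
  Ex P (fun w => (\sum_(i < k) W i w) ^+ 2) = k%:R * v by exact.
elim=> [_|k IH kn].
  under eq_fun do rewrite big_ord0 expr0n/=.
  by split; [exact: itg_cst|rewrite Ex_cst mul0r].
have [i2 e2] := IH (ltnW kn); have [iWk iWk2] := iW k.
have iS : itg P (fun w => \sum_(i < k) W i w) by apply: itg_sum => i; case: (iW i).
have [ic ec] := Ex_indep2 (ind k kn) iS iWk.
have E w : (\sum_(i < k.+1) W i w) ^+ 2 =
    (\sum_(i < k) W i w) ^+ 2 + (2 * ((\sum_(i < k) W i w) * W k w) + W k w ^+ 2).
  by rewrite big_ord_recr/=; ring.
have i3 := itgZ 2 ic.
split; first by under eq_fun do rewrite E; do 2 apply: itgD => //.
under eq_fun do rewrite E.
rewrite (ExD i2 (itgD i3 iWk2)) (ExD i3 iWk2) (ExZ _ ic) ec e2 (EW k kn) (EW2 k kn) -natr1.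
by ring.
Qed.

End RowVariance.

Lemma cvg_sum_ord {R : realType} (U : Type) (F : set_system U) {FF : Filter F} (n : nat)
    (f : nat -> U -> R) (l : nat -> R) :
  (forall k, f k x @[x --> F] --> l k) ->
  \sum_(k < n) f k x @[x --> F] --> \sum_(k < n) l k.
Proof.
move=> fl; elim: n => [|n IH].
  by under eq_fun do rewrite big_ord0; rewrite big_ord0; exact: cvg_cst.
under eq_fun do rewrite big_ord_recr/=; rewrite big_ord_recr/=.
exact: (@cvgD _ R^o).
Qed.

Section ParticleSystem.
Context {R : realType} {d : measure_display} {Om : measurableType d} (P : probability Om R).
Variables (xis : nat -> R -> Om -> R) (psi : R -> R) (s : nat -> R).
Hypothesis Lx : forall i, levy_process P (xis i).
Hypothesis indx : indep_processes P xis.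
Hypothesis mom : forall i u t, 0 <= t -> itg P (fun w => expR (u * xis i t w)) /\
  Ex P (fun w => expR (u * xis i t w)) = expR (t * psi u).
Hypothesis s_cvg : s N @[N --> \oo] --> +oo.
Hypothesis psi12 : 2 * psi 1 < psi 2.
Variables (p lam lam' : R).
Hypothesis p23 : 2 < p /\ p <= 3.
Hypothesis psip : psi p - p * psi 2 / 2 <= (p / 2 - 1) * lam.
Hypothesis lamlam' : lam < lam'.
Hypothesis lnN : \forall N \near \oo, lam' * s N <= ln N%:R.

Local Notation c2 := (psi 2 - 2 * psi 1).

(* [lkap N] is the logarithm of [exp (- c2 * s N / 2) / sqrt N], the scale at which the sum of
   the normalized particles has bounded variance. *)
Definition lkap (N : nat) : R := - (c2 / 2 * s N) - ln N%:R / 2.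
Definition kap (N : nat) : R := expR (lkap N).

Definition centered_particle (t : R) (N i : nat) (w : Om) : R :=
  kap N * (emart (xis i) psi (s N + t) w - 1).

Let s_ge (x : R) : \forall N \near \oo, x <= s N.
Proof. by move/cvgryPge : s_cvg; exact. Qed.

Lemma expR_linear_cvg0 (a b : R) : 0 < a -> expR (b - a * s N) @[N --> \oo] --> 0.
Proof.
move=> a0; apply/cvgrPdist_le => e e0.
near=> N.
rewrite sub0r normrN ger0_norm ?expR_ge0// -[leRHS]lnK ?posrE// ler_expR.
have : (b - ln e) / a <= s N by near: N; exact: s_ge.
by rewrite ler_pdivrMr// mulrC; lra.
Unshelve. all: by end_near. Qed.

Lemma natM_kap_sqr N : (0 < N)%N -> N%:R * kap N ^+ 2 = expR (- (c2 * s N)).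
Proof.
move=> N0; have {1}-> : N%:R = expR (ln N%:R) :> R by rewrite lnK// posrE ltr0n.
rewrite /kap -expRM_natl -expRD.
by congr expR; rewrite /lkap; field.
Qed.

(** The Lyapunov condition. In the first term the exponents add up to (1 - p / 2) ln N + s_N (psi p
    - p psi 2 / 2) plus a constant, which is at most - (p / 2 - 1) (lam' - lam) s_N plus that
    constant. The second term comes from subtracting the mean of a particle and is at most exp (- p
    c2 s_N / 2). *)
Lemma rho_moment_cvg0 (t : R) :
  N%:R * (expR (p * lkap N + (s N + t) * (psi p - p * psi 1)) + expR (p * lkap N))
    @[N --> \oo] --> 0.
Proof.
have [p2 p3] := p23.
have a1 : 0 < (p / 2 - 1) * (lam' - lam) by rewrite mulr_gt0 ?subr_gt0// ltr_pdivlMr// mul1r.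
have a2 : 0 < p * (c2 / 2).
  by rewrite mulr_gt0 ?divr_gt0 ?subr_gt0// (lt_trans _ p2).
pose b := t * (psi p - p * psi 1).
have cv : expR (b - (p / 2 - 1) * (lam' - lam) * s N) + expR (0 - p * (c2 / 2) * s N)
    @[N --> \oo] --> 0.
  by rewrite -[X in _ --> X]addr0; apply: (@cvgD _ R^o); exact: expR_linear_cvg0.
apply/norm_cvg0P; apply: (squeeze_cvgr _ (cvg_cst 0) cv); near=> N.
have N0 : (0 < N)%N by near: N; exact: nbhs_infty_gt.
have s0 : 0 <= s N by near: N; exact: s_ge.
have lN : lam' * s N <= ln N%:R by near: N.
have lN0 : 0 <= ln N%:R :> R by rewrite ln_ge0// ler1n.
rewrite normr_ge0/= ger0_norm; last by rewrite mulr_ge0// addr_ge0// expR_ge0.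
have -> : N%:R = expR (ln N%:R) :> R by rewrite lnK// posrE ltr0n.
rewrite mulrDr -!expRD.
have h1 : (p / 2 - 1) * (lam' * s N) <= (p / 2 - 1) * ln N%:R.
  by rewrite ler_wpM2l//; lra.
have h2 : s N * (psi p - p * psi 2 / 2) <= s N * ((p / 2 - 1) * lam) by rewrite ler_wpM2l.
have h3 : 0 <= (p / 2 - 1) * ln N%:R by rewrite mulr_ge0//; lra.
apply: lerD; rewrite ler_expR /lkap /b; lra.
Unshelve. all: by end_near. Qed.

Let mX i t : 0 <= t -> measurable_fun setT (xis i t).
Proof. by case: (Lx i) => m _; exact: m. Qed.

Variables (T : R) (n : nat) (t : nat -> R) (a : nat -> nat -> R) (A : nat -> R).
Hypothesis tT : forall k, - T <= t k.
Hypothesis aA : forall k, a N k @[N --> \oo] --> A k.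

(** The coefficients depend on N because the normalizing standard deviations do. *)
Definition particle_row (N i : nat) (w : Om) : R :=
  \sum_(k < n) a N k * centered_particle (t k) N i w.

Definition row_var (N : nat) : R := kap N ^+ 2 *
  \sum_(j < n) \sum_(k < n) a N j * a N k * (expR (c2 * (s N + Num.min (t j) (t k))) - 1).

(** The factor 8^n pays for splitting the sum over times, B^3 for coefficients bounded by [B], and
    the inner 8 for separating the particle from its mean; the exponentials are moments of order
    [p]. *)
Definition row_rho (B : R) (N : nat) : R := 8 ^+ n * \sum_(k < n) (B ^+ 3 * (8 *
  (expR (p * lkap N + (s N + t k) * (psi p - p * psi 1)) + expR (p * lkap N)))).

Lemma measurable_particle_row (e : measure_display) (U : measurableType e)
    (N : nat) (Z : nat -> U -> R) :
  (forall k, measurable_fun setT (Z k)) ->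
  measurable_fun setT (fun w => \sum_(k < n) a N k *
    (kap N * (expR (Z k w - psi 1 * (s N + t k)) - 1))).
Proof.
move=> mZ; apply: measurable_sum => k; apply: measurable_funM => //.
apply: measurable_funM => //; apply: measurable_funB => //.
by apply: measurableT_comp => //; apply: measurable_funB.
Qed.

Section Row.
Variable N : nat.
Hypothesis sT : T <= s N.

Let st k : 0 <= s N + t k.
Proof. by have := tT k; have := sT; lra. Qed.

(** The partial sum is measurable for the past generated by the first [i] processes, and the next
    term for the sigma-algebra of the process of index [i]. *)
Lemma particle_row_indep i : indep2 P (fun w => \sum_(j < i) particle_row N j w)
  (particle_row N i).
Proof.
pose C (j : nat) := process_sigma (xis j).
have Csub j : C j `<=` process_sigma (xis j) by [].
have CI j : setI_closed (C j) by move=> E F; exact: process_sigmaI.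
have CT j : C j setT by exact: process_sigmaT.
apply: (past_indep2 mX Csub CI CT (n := i)).
- apply: (@measurable_sum _ (past C i)) => j.
  apply: (@measurable_particle_row _ (past C i) N (fun k => xis j (s N + t k))) => k.
  apply: past_measurable_fun => B mB.
  apply: (product_system1 CT (ltn_ord j)); exact: process_sigma_value.
- exact: (measurable_particle_row N (fun k => mX i (st k))).
- move=> E B GE mB; apply: (product_system_new indx Csub GE).
  pose U := process_space (xis i).
  have := @measurable_particle_row _ U N (fun k => xis i (s N + t k))
    (fun k => @measurable_process_value _ _ _ xis i _ (st k)).
  by move=> /(_ measurableT B mB); rewrite setTI.
Qed.

Lemma centered_particle_moments j k i :
  [/\ itg P (centered_particle (t k) N i), Ex P (centered_particle (t k) N i) = 0,
    itg P (fun w => centered_particle (t j) N i w * centered_particle (t k) N i w) &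
    Ex P (fun w => centered_particle (t j) N i w * centered_particle (t k) N i w) =
    kap N ^+ 2 * (expR (c2 * (s N + Num.min (t j) (t k))) - 1)].
Proof.
have im l := emart_itg (mom i) (st l); have em l := Ex_emart (mom i) (st l).
have i1 l : itg P (fun w => emart (xis i) psi (s N + t l) w - 1).
  by apply: itgB => //; exact: itg_cst.
have [ic ec] := emart_cov (Lx i) (mom i) (st j) (st k).
have E w : centered_particle (t j) N i w * centered_particle (t k) N i w =
  kap N ^+ 2 * (emart (xis i) psi (s N + t j) w * emart (xis i) psi (s N + t k) w
    - (emart (xis i) psi (s N + t j) w + emart (xis i) psi (s N + t k) w - 1)).
  by rewrite /centered_particle; ring.
have i2 := itgB (itgD (im j) (im k)) (itg_cst P 1).
split.
- exact: itgZ.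
- by rewrite /centered_particle ExZ// ExB ?em ?Ex_cst ?subrr ?mulr0//; exact: itg_cst.
- by under eq_fun do rewrite E; apply: itgZ; exact: itgB.
under eq_fun do rewrite E.
rewrite (ExZ _ (itgB ic i2)) (ExB ic i2) (ExB (itgD (im j) (im k)) (itg_cst P 1)).
rewrite (ExD (im j) (im k)) !em Ex_cst ec; congr (_ * (expR (_ * _) - _)); last by ring.
by rewrite /Order.min ltrD2l; case: ifP.
Qed.

Lemma particle_row_moments i : [/\ itg P (particle_row N i), Ex P (particle_row N i) = 0,
  itg P (fun w => particle_row N i w ^+ 2) &
  Ex P (fun w => particle_row N i w ^+ 2) = row_var N].
Proof.
have i1 k : itg P (fun w => a N k * centered_particle (t k) N i w).
  by have [h _ _ _] := centered_particle_moments k k i; exact: itgZ.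
have i2 j k : itg P (fun w => a N j * a N k *
    (centered_particle (t j) N i w * centered_particle (t k) N i w)).
  by have [_ _ h _] := centered_particle_moments j k i; exact: itgZ.
have E w : particle_row N i w ^+ 2 = \sum_(j < n) \sum_(k < n) a N j * a N k *
    (centered_particle (t j) N i w * centered_particle (t k) N i w).
  rewrite expr2 /particle_row big_distrlr/=; apply: eq_bigr => j _.
  by apply: eq_bigr => k _; ring.
split.
- exact: itg_sum.
- rewrite /particle_row Ex_sum//; apply: big1 => k _.
  by have [h e _ _] := centered_particle_moments k k i; rewrite ExZ// e mulr0.
- by under eq_fun do rewrite E; do 2 apply: itg_sum => ?.
under eq_fun do rewrite E.
rewrite Ex_sum => [|j]; last exact: itg_sum.
rewrite /row_var big_distrr/=; apply: eq_bigr => j _.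
rewrite Ex_sum// big_distrr/=; apply: eq_bigr => k _.
have [_ _ h e] := centered_particle_moments j k i.
by rewrite ExZ// e; ring.
Qed.

Lemma particle_row_rho (B : R) i : 1 <= B -> (forall k, (k < n)%N -> `|a N k| <= B) ->
  Ex P (fun w => rho (particle_row N i w)) <= row_rho B N.
Proof.
move=> B1 aB; have [p2 p3] := p23.
have [iW _ iW2 _] := particle_row_moments i.
pose b k w := B ^+ 3 * (8 *
  (expR (p * lkap N) * expR (p * (xis i (s N + t k) w - psi 1 * (s N + t k))) + expR (p * lkap N))).
have ib k : itg P (b k).
  apply/itgZ/itgZ/itgD; last exact: itg_cst.
  by have [h _] := emart_power (mom i) p (st k); exact: itgZ.
have Eb k : Ex P (b k) = B ^+ 3 * (8 *
    (expR (p * lkap N + (s N + t k) * (psi p - p * psi 1)) + expR (p * lkap N))).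
  have [h e] := emart_power (mom i) p (st k).
  have h1 := itgZ (expR (p * lkap N)) h; have h2 := itgD h1 (itg_cst P (expR (p * lkap N))).
  by rewrite (ExZ _ (itgZ _ h2)) (ExZ _ h2) (ExD h1 (itg_cst P _)) (ExZ _ h) Ex_cst e -expRD.
have -> : row_rho B N = Ex P (fun w => 8 ^+ n * \sum_(k < n) b k w).
  rewrite ExZ; last exact: itg_sum.
  by rewrite Ex_sum//; congr (_ * _); apply: eq_bigr => k _; rewrite Eb.
apply: Ex_le; [exact: (itg_rho (itg_meas iW))|by apply/itgZ/itg_sum|move=> w].
apply: (le_trans (rho_sum_le n (fun k => a N k * centered_particle (t k) N i w))).
rewrite ler_wpM2l ?exprn_ge0//; apply: ler_sum => k _.
set x := centered_particle _ _ _ _.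
apply: (@le_trans _ _ (rho (B * x))).
  apply: rho_le_norm; rewrite !normrM ler_wpM2r// [leRHS]ger0_norm ?(le_trans ler01)//.
  exact: aB.
apply: (le_trans (rho_scale_le _ B1)); rewrite ler_wpM2l ?exprn_ge0 ?(le_trans ler01)//.
have -> : x = kap N * emart (xis i) psi (s N + t k) w + - kap N.
  by rewrite /x /centered_particle; ring.
apply: (le_trans (rhoD_le _ _)); rewrite ler_pM2l// rhoN.
have p23' : 2 <= p <= 3 by rewrite (ltW p2) p3.
apply: lerD; last exact: rho_expR_le.
rewrite /kap /emart -expRD; apply: (le_trans (rho_expR_le _ p23')).
by rewrite -expRD mulrDr.
Qed.

Lemma centered_particle_row (B : R) : 1 <= B -> (forall k, (k < n)%N -> `|a N k| <= B) ->
  centered_row P (particle_row N) N (row_var N) (row_rho B N).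
Proof.
move=> B1 aB; split.
- by move=> i; have [] := particle_row_moments i.
- by move=> i _; have [] := particle_row_moments i.
- by move=> i _; have [] := particle_row_moments i.
- by move=> i _; exact: particle_row_rho.
- by move=> i _; exact: particle_row_indep.
Qed.

End Row.

Definition limit_var : R := \sum_(j < n) \sum_(k < n) A j * A k * expR (c2 * Num.min (t j) (t k)).

Lemma row_var_cvg : N%:R * row_var N @[N --> \oo] --> limit_var.
Proof.
have c20 : 0 < c2 by rewrite subr_gt0.
have cv : \sum_(j < n) \sum_(k < n) a N j * a N k *
     (expR (c2 * Num.min (t j) (t k)) - expR (0 - c2 * s N)) @[N --> \oo] --> limit_var.
  apply: (cvg_sum_ord (f := fun j N => \sum_(k < n) a N j * a N k *
     (expR (c2 * Num.min (t j) (t k)) - expR (0 - c2 * s N)))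
    (l := fun j => \sum_(k < n) A j * A k * expR (c2 * Num.min (t j) (t k)))) => j.
  apply: (cvg_sum_ord (f := fun k N => a N j * a N k *
     (expR (c2 * Num.min (t j) (t k)) - expR (0 - c2 * s N)))
    (l := fun k => A j * A k * expR (c2 * Num.min (t j) (t k)))) => k.
  apply: cvgM; first by apply: cvgM; exact: aA.
  rewrite -[X in _ --> X]subr0; apply: (@cvgB _ R^o); first exact: cvg_cst.
  exact: expR_linear_cvg0.
apply: cvg_trans cv; apply: near_eq_cvg; near=> N.
have N0 : (0 < N)%N by near: N; exact: nbhs_infty_gt.
rewrite /row_var mulrA natM_kap_sqr// big_distrr/=; apply: eq_bigr => j _.
rewrite big_distrr/=; apply: eq_bigr => k _.
rewrite sub0r mulrCA; congr (_ * _); rewrite mulrBr -expRD mulr1; congr (expR _ - _); ring.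
Unshelve. all: by end_near. Qed.

Lemma row_rho_cvg B : N%:R * row_rho B N @[N --> \oo] --> 0.
Proof.
have cv : 8 ^+ n * \sum_(k < n) (B ^+ 3 * (8 * (N%:R *
  (expR (p * lkap N + (s N + t k) * (psi p - p * psi 1)) + expR (p * lkap N)))))
    @[N --> \oo] --> 8 ^+ n * \sum_(k < n) (B ^+ 3 * (8 * 0)).
  apply: cvgM; first exact: cvg_cst.
  apply: (cvg_sum_ord (f := fun k N => B ^+ 3 * (8 * (N%:R *
  (expR (p * lkap N + (s N + t k) * (psi p - p * psi 1)) + expR (p * lkap N)))))
    (l := fun=> B ^+ 3 * (8 * 0))) => k; do 2 (apply: cvgM; first exact: cvg_cst).
  exact: rho_moment_cvg0.
have z0 : 8 ^+ n * \sum_(k < n) (B ^+ 3 * (8 * 0)) = 0 :> R.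
  by rewrite big1 ?mulr0// => k _; rewrite !mulr0.
rewrite z0 in cv.
apply: cvg_trans cv; apply: near_eq_cvg; near=> N.
rewrite /row_rho mulrCA; congr (_ * _); rewrite big_distrr/=.
by apply: eq_bigr => k _; ring.
Unshelve. all: by end_near. Qed.

Lemma particle_row_clt : exists B, [/\ 1 <= B,
  (\forall N \near \oo, centered_row P (particle_row N) N (row_var N) (row_rho B N)) &
  forall b, Ex P (fun w => cos (b + \sum_(i < N) particle_row N i w)) @[N --> \oo] -->
    cos b * expR (- (limit_var / 2))].
Proof.
(* At least 1, as scaling of [rho] requires, and above every |A k| + 1, hence eventually above the
   coefficients. *)
pose B := 1 + \sum_(k < n) (`|A k| + 1).
have B1 : 1 <= B by rewrite lerDl sumr_ge0// => k _; rewrite addr_ge0.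
have aB : \forall N \near \oo, forall k, (k < n)%N -> `|a N k| <= B.
  have : \forall N \near \oo, forall k : 'I_n, `|a N k| <= `|A k| + 1.
    apply: filter_forall => k.
    have : `|a N k| @[N --> \oo] --> `|A k| by apply: cvg_norm; exact: aA.
    by move=> h; apply: (cvgr_le _ h); rewrite ltrDl.
  apply: filterS => N h k kn; apply: (le_trans (h (Ordinal kn))).
  rewrite /B (bigD1 (Ordinal kn))//= addrCA lerDl.
  by apply: addr_ge0 => //; apply: sumr_ge0 => j _; apply: addr_ge0.
have row : \forall N \near \oo, centered_row P (particle_row N) N (row_var N) (row_rho B N).
  near=> N; apply: centered_particle_row => //; last by near: N.
  by near: N; exact: s_ge.
exists B; split => // b.
exact (@cos_clt _ _ _ P particle_row row_var (row_rho B) limit_var b row row_var_cvg (row_rho_cvg B)).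
Unshelve. all: by end_near. Qed.

End ParticleSystem.

(** * The test function x^2 / 2 - 1 + cos x *)

Section CosineTest.
Context {R : realType}.
Implicit Types x y e : R.

Definition cos_test y : R := y ^+ 2 / 2 - 1 + cos y.

Lemma cos_test_ge0 y : 0 <= cos_test y.
Proof. exact: cos_ge_parabola. Qed.

Let line_pos e x : 0 <= x -> 0 <= x ^+ 2 / 2 + cos (e + x) - cos e + sin e * x.
Proof.
apply: (@ge0_of_derive _ (fun x => x ^+ 2 / 2 + cos (e + x) - cos e + sin e * x)
  (fun x => x - sin (e + x) + sin e)).
- by move=> y; apply: trigger_derive; rewrite /GRing.scale/=; field.
- move=> y; apply: (@ge0_of_derive _ (fun x => x - sin (e + x) + sin e)
    (fun x => 1 - cos (e + x))).
  + by move=> z; apply: trigger_derive; rewrite /GRing.scale/=; field.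
  + by move=> z _; rewrite subr_ge0 cos_le1.
  + by rewrite addr0 sub0r addNr.
- by rewrite expr0n/= addr0; ring.
Qed.

(** The left side is the tangent at [e]. Points to its left are reduced to points to the right of -
    e, the function being even. *)
Lemma cos_test_line e y : cos_test e + (e - sin e) * (y - e) <= cos_test y.
Proof.
rewrite -subr_ge0 /cos_test; have [ye|/ltW ye] := leP e y.
  have h : 0 <= y - e by rewrite subr_ge0.
  have := line_pos e h; rewrite subrKC => h2.
  rewrite (_ : _ - _ = (y - e) ^+ 2 / 2 + cos y - cos e + sin e * (y - e))//; by field.
have h : 0 <= - y - - e by rewrite opprK addrC subr_ge0.
have := line_pos (- e) h; rewrite subrKC !cosN sinN => h2.
by rewrite (_ : _ - _ = (- y - - e) ^+ 2 / 2 + cos y - cos e + - sin e * (- y - - e))//; field.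
Qed.

Lemma cos_test_slope e : 0 <= e -> 0 <= e - sin e.
Proof.
apply: (@ge0_of_derive _ (fun x => x - sin x) (fun x => 1 - cos x)).
- by move=> y _; rewrite subr_ge0 cos_le1.
- by rewrite sin0 subr0.
Qed.

(** Three further Taylor bounds give x^4 / 24 - x^5 / 120 as a minorant on x >= 0, which is positive
    on (0, 1]. *)
Lemma cos_test_gt0 e : 0 < e -> e <= 1 -> 0 < cos_test e.
Proof.
move=> e0 e1.
have c1 x : 0 <= x -> 0 <= (1 - cos x) - (x ^+ 2 / 2 - x ^+ 3 / 6).
  apply: (@ge0_of_derive _ (fun x => (1 - cos x) - (x ^+ 2 / 2 - x ^+ 3 / 6))
    (fun x => sin x - (x - x ^+ 2 / 2))).
  - by move=> y; apply: trigger_derive; rewrite /GRing.scale/=; field.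
  - apply: (@ge0_of_derive _ (fun x => sin x - (x - x ^+ 2 / 2)) (fun x => cos x - (1 - x))).
    + by move=> y; apply: trigger_derive; rewrite /GRing.scale/=; field.
    + apply: (@ge0_of_derive _ (fun x => cos x - (1 - x)) (fun x => 1 - sin x)).
      * by move=> y; apply: trigger_derive; rewrite /GRing.scale/=; field.
      * by move=> y _; rewrite subr_ge0 sin_le1.
      * by rewrite cos0; ring.
    + by rewrite sin0 expr0n/=; ring.
  - by rewrite cos0 !expr0n/=; ring.
have c2 x : 0 <= x -> 0 <= (x - sin x) - (x ^+ 3 / 6 - x ^+ 4 / 24).
  apply: (@ge0_of_derive _ (fun x => (x - sin x) - (x ^+ 3 / 6 - x ^+ 4 / 24))
    (fun x => (1 - cos x) - (x ^+ 2 / 2 - x ^+ 3 / 6))) => //.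
  - by move=> y; apply: trigger_derive; rewrite /GRing.scale/=; field.
  - by rewrite sin0 !expr0n/=; ring.
have c3 x : 0 <= x -> 0 <= cos_test x - (x ^+ 4 / 24 - x ^+ 5 / 120).
  apply: (@ge0_of_derive _ (fun x => cos_test x - (x ^+ 4 / 24 - x ^+ 5 / 120))
    (fun x => (x - sin x) - (x ^+ 3 / 6 - x ^+ 4 / 24))) => //.
  - by move=> y; apply: trigger_derive; rewrite /GRing.scale/=; field.
  - by rewrite /cos_test cos0 !expr0n/=; ring.
have := c3 e (ltW e0); have e4 : 0 < e ^+ 4 by exact: exprn_gt0.
have e5 : e ^+ 5 <= e ^+ 4 by rewrite exprS ler_piMl// ltW.
by move: e4 e5; move: (e ^+ 4) (e ^+ 5) (cos_test e) => a b c; lra.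
Qed.

(** The left side is the mean of the test function under the centered normal law of variance [v].
    The bound follows from exp (- x) <= 1 / (1 + x) <= 1 - x + x^2 at x = v / 2. *)
Lemma cos_test_limit (v : R) : 0 <= v -> v / 2 - 1 + expR (- (v / 2)) <= v ^+ 2 / 4.
Proof.
move=> v0; have h := expR_ge1Dx (v / 2).
have : expR (- (v / 2)) <= (1 + v / 2)^-1 by rewrite expRN lef_pV2 ?posrE ?expR_gt0//; lra.
have : (1 + v / 2)^-1 <= 1 - v / 2 + v ^+ 2 / 4.
  by rewrite -[leLHS]mul1r ler_pdivrMr; last lra; nra.
lra.
Qed.

End CosineTest.

(** * The martingale property against events of a time grid *)

Section CellMaximal.
Context {R : realType} {d : measure_display} {Om : measurableType d} (P : probability Om R).
Variables (xis : nat -> R -> Om -> R) (psi : R -> R) (s : nat -> R).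
Hypothesis Lx : forall i, levy_process P (xis i).
Hypothesis indx : indep_processes P xis.
Hypothesis mom : forall i u t, 0 <= t -> itg P (fun w => expR (u * xis i t w)) /\
  Ex P (fun w => expR (u * xis i t w)) = expR (t * psi u).

Let mX i t : 0 <= t -> measurable_fun setT (xis i t).
Proof. by case: (Lx i) => m _; exact: m. Qed.

Definition martingale (N : nat) (t : R) (w : Om) : R :=
  \sum_(i < N) centered_particle xis psi s t N i w.

Lemma centered_particle_itg t N i : 0 <= s N + t -> itg P (centered_particle xis psi s t N i).
Proof.
by move=> st; apply/itgZ/itgB; [exact: (emart_itg (mom i) st)|exact: itg_cst].
Qed.

Lemma martingale_itg t N : 0 <= s N + t -> itg P (martingale N t).
Proof. by move=> st; apply: itg_sum => i; exact: centered_particle_itg. Qed.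

Section Grid.
Variables (tau : nat -> R) (N : nat).
Hypothesis tau0 : tau 0%N = 0.
Hypothesis tau_mono : forall k, tau k < tau k.+1.
Let C (m j : nat) := grid_cylinder (xis j) tau m.
Let CT m j : C m j setT. Proof. exact: grid_cylinderT. Qed.

Lemma grid_value_past m j k : (j < N)%N -> (k <= m)%N ->
  @measurable_fun _ _ (past (C m) N) R setT (xis j (tau k)).
Proof.
move=> jN; elim: k => [_|k IH km].
  rewrite (_ : xis j (tau 0) = fun=> 0)//.
  by apply/funext => w; rewrite tau0; case: (Lx j) => _ [->].
rewrite (_ : xis j (tau k.+1) =
    fun w => xis j (tau k) w + grid_increment (xis j) tau k w); last first.
  by apply/funext => w; rewrite /grid_increment subrKC.
apply: (@measurable_funD _ (past (C m) N)); first exact: IH (ltnW km).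
apply: past_measurable_fun => B mB; apply: (product_system1 (CT m) jN).
exact: grid_cylinder1.
Qed.

(** The past is generated by products over particles of cylinders up to [tau m]. Only the factor of
    particle [i] involves the same process as the later increment, and there the Lévy property
    applies. *)
Lemma grid_increment_indep m i (F : Om -> R) (r : R) : (i < N)%N -> tau m < r ->
  @measurable_fun _ _ (past (C m) N) R setT F ->
  indep2 P F (fun w => xis i r w - xis i (tau m) w).
Proof.
move=> iN mr mF; have r0 : 0 <= r by exact: le_trans (grid_ge0 tau0 tau_mono m) (ltW mr).
have mV : measurable_fun setT (fun w => xis i r w - xis i (tau m) w).
  by apply: measurable_funB; apply: mX => //; exact: (grid_ge0 tau0 tau_mono).
have CIm : forall j, setI_closed (C m j) by move=> j; exact: grid_cylinderI.
have CSm : forall j, C m j `<=` process_sigma (xis j) by move=> j; exact: grid_cylinder_sigma.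
apply: (past_indep2 mX CSm CIm (CT m) mF mV) => A B GA mB.
apply: (product_system_increment indx CSm iN _ _ GA).
  pose U := process_space (xis i).
  have := @measurable_funB _ U R setT _ _ (@measurable_process_value _ _ _ xis i _ r0)
    (@measurable_process_value _ _ _ xis i _ (grid_ge0 tau0 tau_mono m)).
  by move=> /(_ measurableT B mB); rewrite setTI.
by move=> E CE; exact: (grid_cylinder_indep (Lx i) tau0 tau_mono CE mr mB).
Qed.

(** Replaces conditional expectations: particle by particle, the difference is a factor measurable
    for the past times an independent ratio minus 1, which has mean 0. *)
Lemma martingale_orthogonal m (r b M : R) (chi : Om -> R) : tau m = s N + b -> b < r ->
  @measurable_fun _ _ (past (C m) N) R setT chi -> (forall w, `|chi w| <= M) ->
  Ex P (fun w => chi w * martingale N r w) = Ex P (fun w => chi w * martingale N b w).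
Proof.
move=> tb br mchi chiM; have sb0 : 0 <= s N + b by rewrite -tb; exact: (grid_ge0 tau0 tau_mono).
have sr0 : 0 <= s N + r by rewrite (le_trans sb0)// lerD2l ltW.
have CSm : forall j, C m j `<=` process_sigma (xis j) by move=> j; exact: grid_cylinder_sigma.
have mchi' : measurable_fun setT chi := past_measurable mX CSm mchi.
have ichi (F : Om -> R) : itg P F -> itg P (fun w => chi w * F w).
  move=> iF; apply: (itg_le _ (itgZ M (itg_norm iF))).
    by apply: measurable_funM => //; exact: (itg_meas iF).
  by move=> w; rewrite normrM ler_wpM2r// chiM.
have iMr := martingale_itg sr0; have iMb := martingale_itg sb0.
apply/eqP; rewrite -subr_eq0 -ExB; [|exact: ichi|exact: ichi].
pose u := r - b; have u0 : 0 <= u by rewrite subr_ge0 ltW.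
pose D i w := kap psi s N * ((chi w * emart (xis i) psi (s N + b) w) *
   (emart_ratio (xis i) psi (s N + b) u w - 1)).
have iem i := emart_itg (mom i) sb0.
have [irat erat] : (forall i, itg P (emart_ratio (xis i) psi (s N + b) u)) /\
    (forall i, Ex P (emart_ratio (xis i) psi (s N + b) u) = 1).
  by split=> i; have [] := emart_ratio_law (Lx i) (mom i) sb0 u0.
have mexp a : measurable_fun setT (fun x : R => expR (x - a) - 1).
  by apply: measurable_funB => //; apply: measurableT_comp => //; exact: measurable_funB.
have key i : (i < N)%N -> itg P (D i) /\ Ex P (D i) = 0.
  move=> iN.
  have mF : @measurable_fun _ _ (past (C m) N) R setT
      (fun w => chi w * emart (xis i) psi (s N + b) w).
    apply: (@measurable_funM _ (past (C m) N)) => //.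
    apply: measurableT_comp => //; apply: (@measurable_funB _ (past (C m) N)) => //.
    by rewrite -tb; exact: grid_value_past.
  have mr : tau m < s N + r by rewrite tb ltrD2l.
  have ind0 := grid_increment_indep iN mr mF.
  have sbu : s N + b + u = s N + r by rewrite -addrA subrKC.
  have ind : indep2 P (fun w => chi w * emart (xis i) psi (s N + b) w)
      (fun w => emart_ratio (xis i) psi (s N + b) u w - 1).
    apply: (indep2_comp ind0 (p := id) (q := fun x => expR (x - psi 1 * u) - 1)) => //.
    by apply/funext => w; rewrite /emart_ratio sbu tb.
  have i1 := itgB (irat i) (itg_cst P 1).
  have [ii ee] := Ex_indep2 ind (ichi _ (iem i)) i1.
  split; first exact: itgZ.
  by rewrite /D ExZ// ee (ExB (irat i) (itg_cst P 1)) erat Ex_cst subrr !mulr0.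
have -> : (fun w => chi w * martingale N r w - chi w * martingale N b w) =
    fun w => \sum_(i < N) D i w.
  apply/funext => w; rewrite -mulrBr /martingale -sumrB big_distrr/=; apply: eq_bigr => i _.
  rewrite /D /centered_particle (_ : s N + r = s N + b + u) ?emartD; last by rewrite -addrA subrKC.
  by ring.
rewrite Ex_sum => [|i]; last by have [] := key i (ltn_ord i).
by rewrite big1// => i _; have [] := key i (ltn_ord i).
Qed.

End Grid.

End CellMaximal.

(** * Suprema over dyadic grids *)

Section GridExceedance.
Context {R : realType} {d : measure_display} {U : measurableType d} (m : probability U R).
Variables (Z : R -> U -> R) (a b : R).
Hypothesis ab : a < b.

Definition grid_point (n l : nat) : R := a + l%:R * ((b - a) / n%:R).

Lemma grid_point_end n : (0 < n)%N -> grid_point n n = b.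
Proof.
by move=> n0; rewrite /grid_point mulrC divfK ?subrKC// pnatr_eq0 -lt0n.
Qed.

Lemma grid_point_ge n l : a <= grid_point n l.
Proof. by rewrite lerDl mulr_ge0// divr_ge0// subr_ge0 ltW. Qed.

Lemma grid_point_le n l : (l <= n)%N -> grid_point n l <= b.
Proof.
case: n => [|n ln]; first by rewrite leqn0 => /eqP ->; rewrite /grid_point mul0r addr0 ltW.
rewrite -[leRHS](grid_point_end (ltn0Sn n)) lerD2l ler_wpM2r ?ler_nat// divr_ge0//.
by rewrite subr_ge0 ltW.
Qed.

Hypothesis mZ : forall t, a <= t -> t <= b -> measurable_fun setT (Z t).

Definition grid_exceed (e : R) (j : nat) : set U :=
  [set w | exists2 l, (l <= 2 ^ j)%N & e <= `|Z (grid_point (2 ^ j) l) w - Z a w|].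

Lemma grid_exceed_measurable e j : measurable (grid_exceed e j).
Proof.
have -> : grid_exceed e j = \bigcup_(l in [set l | (l <= 2 ^ j)%N])
    ((fun w => `|Z (grid_point (2 ^ j) l) w - Z a w|) @^-1` `[e, +oo[%classic).
  apply/seteqP; split => w.
    by move=> [l ln el]; exists l => //=; rewrite in_itv/= el.
  by move=> [l ln /=]; rewrite in_itv/= andbT => el; exists l.
apply: bigcup_measurable => l ln.
have mf : measurable_fun setT (fun w => `|Z (grid_point (2 ^ j) l) w - Z a w|).
  apply: measurableT_comp => //; apply: measurable_funB; apply: mZ => //.
  - exact: grid_point_ge.
  - exact: grid_point_le.
  - exact: ltW.
by rewrite -[X in measurable X]setTI; apply: mf.
Qed.

(** Dyadic grids are nested, so the exceedance events increase with [j], and continuity from below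
    carries their common bound to the union. *)
Lemma grid_exceed_sup e C : (forall j, m (grid_exceed e j) <= C)%E ->
  exists A : set U, [/\ measurable A, (m A <= C)%E &
    forall w, ~ A w -> forall j l, (l <= 2 ^ j)%N ->
      `|Z (grid_point (2 ^ j) l) w - Z a w| < e].
Proof.
move=> mC; exists (\bigcup_j grid_exceed e j).
have mE j := grid_exceed_measurable e j.
have nd : nondecreasing_seq (grid_exceed e).
  (* Point l of one grid is point 2 l of the next. *)
  apply/nondecreasing_seqP => j; apply/subsetPset => w [l ln el]; exists (2 * l)%N.
    by rewrite expnS leq_mul2l ln orbT.
  rewrite (_ : grid_point (2 ^ j.+1) (2 * l) = grid_point (2 ^ j) l)//.
  rewrite /grid_point; congr (_ + _); rewrite expnS !natrM; field.
  by rewrite pnatr_eq0 -lt0n expn_gt0.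
split; first exact: bigcupT_measurable.
- have cv := nondecreasing_cvg_mu (mu := m) mE (bigcupT_measurable _ mE) nd.
  rewrite -(cvg_lim (@ereal_hausdorff R) cv); apply: lime_le.
    by apply/cvg_ex; eexists; exact: cv.
  exact: nearW.
- move=> w nA j l ln; rewrite ltNge; apply/negP => el; apply: nA; exists j => //.
  by exists l.
Qed.

End GridExceedance.

(** * The maximal bound on one time cell *)

Section CellOscillation.
Context {R : realType} {d : measure_display} {Om : measurableType d} (P : probability Om R).
Variables (xis : nat -> R -> Om -> R) (psi : R -> R) (s : nat -> R).
Hypothesis Lx : forall i, levy_process P (xis i).
Hypothesis indx : indep_processes P xis.
Hypothesis mom : forall i u t, 0 <= t -> itg P (fun w => expR (u * xis i t w)) /\
  Ex P (fun w => expR (u * xis i t w)) = expR (t * psi u).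
Local Notation M := (martingale xis psi s).

Section Cell.
Variables (N : nat) (a b : R).
Hypothesis sa : 0 < s N + a.
Hypothesis ab : a < b.
Hypothesis iM2 : itg P (fun w => (M N b w - M N a w) ^+ 2).

Local Notation grid_point := (grid_point a b).

Definition cell_dev (sg : R) (n l : nat) (w : Om) : R :=
  sg * (M N (grid_point n l) w - M N a w).

(** The sign [sg] selects upward or downward excursions; as the test function is even, both are
    bounded by the same expectation. The martingale condition is an identity at the last grid point
    and follows from orthogonality at the earlier ones. *)
Lemma cell_maximal (sg e : R) (n : nat) : sg ^+ 2 = 1 -> 0 <= e -> (0 < n)%N ->
  cos_test e * Ex P (fun w => 1 - below (cell_dev sg n) e n.+1 w) <=
  Ex P (fun w => cos_test (M N b w - M N a w)).
Proof.
move=> sg1 e0 n0; pose h := (b - a) / n%:R.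
have h0 : 0 < h by rewrite divr_gt0 ?ltr0n// subr_gt0.
(* The Lévy grid must begin at time 0, so the cell grid is shifted by one index; this is why the
   past up to point [l] uses [l.+1] increments, and why s N + a must be positive. *)
pose tau k : R := if k is k'.+1 then s N + grid_point n k' else 0.
have tau0 : tau 0%N = 0 by [].
have tau_mono k : tau k < tau k.+1.
  case: k => [|k]; first by rewrite /tau /grid_point mul0r addr0.
  by rewrite /tau /grid_point !ltrD2l ltr_pM2r// ltr_nat.
have sq k : 0 <= s N + grid_point n k.
  by rewrite (le_trans (ltW sa))// lerD2l grid_point_ge.
have iM k : itg P (M N (grid_point n k)) by exact: (martingale_itg mom).
have iMa : itg P (M N a) by apply: (martingale_itg mom); exact: ltW.
have sgE x : cos_test (sg * x) = cos_test x.
  have /orP[/eqP->|/eqP->] : (sg == 1) || (sg == -1) by rewrite -sqrf_eq1 sg1.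
    by rewrite mul1r.
  by rewrite mulN1r /cos_test sqrrN cosN.
have -> : (fun w => cos_test (M N b w - M N a w)) = fun w => cos_test (cell_dev sg n n w).
  by apply/funext => w; rewrite /cell_dev sgE grid_point_end.
have iD k : itg P (cell_dev sg n k) by apply: itgZ; exact: itgB.
apply: (@maximal_inequality _ _ _ P (cell_dev sg n) (@cos_test R) n e (cos_test e)
  (e - sin e)).
- by move=> k _; exact: iD.
- rewrite (_ : (fun w => _) = fun w => 2^-1 * (M N b w - M N a w) ^+ 2 - 1 +
     cos (M N b w - M N a w)); last first.
    apply/funext => w; rewrite /cell_dev sgE grid_point_end// /cos_test.
    by congr (_ - _ + _); rewrite mulrC.
  apply: itgD; first by apply: itgB; [exact: itgZ|exact: itg_cst].
  have imb := itgB (iM n) iMa; rewrite grid_point_end// in imb.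
  apply: (itg_bounded P (measurableT_comp measurable_cos (itg_meas imb)) (M := 1)) => w.
  exact: cos_max.
- exact: cos_test_ge0.
- exact: cos_test_slope.
- exact: cos_test_line.
move=> l; rewrite leq_eqVlt => /predU1P[->//|ln].
pose chi w := below (cell_dev sg n) e l w * (e <= cell_dev sg n l w)%R%:R.
have chi1 w : `|chi w| <= 1.
  rewrite /chi normrM; case: (below01 (cell_dev sg n) e l w) => ->.
    by rewrite normr0 mul0r.
  by rewrite normr1 mul1r; case: (e <= _); rewrite ?normr1 ?normr0.
pose C (j : nat) := grid_cylinder (xis j) tau l.+1.
have mM k : (k <= l)%N -> @measurable_fun _ _ (past C N) R setT (M N (grid_point n k)).
  move=> kl; apply: (@measurable_sum _ (past C N)) => i.
  apply: (@measurable_funM _ (past C N)) => //; apply: (@measurable_funB _ (past C N)) => //.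
  apply: measurableT_comp => //; apply: (@measurable_funB _ (past C N)) => //.
  by have := @grid_value_past _ _ _ P xis Lx tau N tau0 l.+1 i k.+1 (ltn_ord i) kl.
have mMa : @measurable_fun _ _ (past C N) R setT (M N a).
  by have := mM 0%N (leq0n l); rewrite /grid_point mul0r addr0.
have mDev k : (k <= l)%N -> @measurable_fun _ _ (past C N) R setT (cell_dev sg n k).
  move=> kl; apply: (@measurable_funM _ (past C N)) => //.
  by apply: (@measurable_funB _ (past C N)) => //; exact: mM.
have mchi : @measurable_fun _ _ (past C N) R setT chi.
  apply: (@measurable_funM _ (past C N)).
    by apply: (@measurable_below _ _ (past C N)) => k kl; apply: mDev; exact: ltnW.
  rewrite (_ : (fun w => _) = fun w => 1 - (cell_dev sg n l w < e)%R%:R); last first.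
    by apply/funext => w; rewrite ltNge; case: (e <= _); rewrite ?subr0 ?subrr.
  apply: (@measurable_funB _ (past C N)) => //.
  by apply: (@measurable_ind_lt _ _ (past C N)); exact: mDev.
have gl : grid_point n l < b.
  rewrite -[ltRHS](grid_point_end a b n0) /grid_point ltrD2l ltr_pM2r// ltr_nat//.
have orth := martingale_orthogonal Lx indx mom tau0 tau_mono (m := l.+1) (b := grid_point n l)
  erefl gl mchi chi1.
have mchi' : measurable_fun setT chi.
  apply: measurable_funM; first by apply: measurable_below => k _; exact: (itg_meas (iD k)).
  rewrite (_ : (fun w => _) = fun w => 1 - (cell_dev sg n l w < e)%R%:R); last first.
    by apply/funext => w; rewrite ltNge; case: (e <= _); rewrite ?subr0 ?subrr.
  by apply: measurable_funB => //; apply: measurable_ind_lt; exact: (itg_meas (iD l)).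
have ichi (F : Om -> R) : itg P F -> itg P (fun w => chi w * F w).
  move=> iF; apply: (itg_le _ (itg_norm iF)).
    by apply: measurable_funM => //; exact: (itg_meas iF).
  by move=> w; rewrite normrM ler_piMl// chi1.
have E k : Ex P (fun w => chi w * cell_dev sg n k w) =
    sg * (Ex P (fun w => chi w * M N (grid_point n k) w) - Ex P (fun w => chi w * M N a w)).
  rewrite -(ExB (ichi _ (iM k)) (ichi _ iMa)) -ExZ; last exact: (itgB (ichi _ (iM k)) (ichi _ iMa)).
  by congr Ex; apply/funext => w; rewrite /cell_dev; ring.
have hfin : Ex P (fun w => chi w * M N (grid_point n n) w) =
    Ex P (fun w => chi w * M N (grid_point n l) w) by rewrite (grid_point_end a b n0); exact orth.
exact (eq_trans (E n) (eq_trans (congr1 (fun z => sg * (z - Ex P (fun w => chi w * M N a w))) hfin)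
  (esym (E l)))).
Qed.

Let mM t : a <= t -> measurable_fun setT (M N t).
Proof.
move=> at_; apply: itg_meas; apply: (martingale_itg mom).
by rewrite (le_trans (ltW sa))// lerD2l.
Qed.

(** An exceedance in absolute value is one for the sign 1 or for the sign -1, whence the factor
    2. *)
Lemma cell_exceed_prob e j : 0 < e -> e <= 1 ->
  (P (grid_exceed (M N) a b e j) <= (2 * Ex P (fun w => cos_test (M N b w - M N a w)) / cos_test e)%:E)%E.
Proof.
move=> e0 e1; have c0 := cos_test_gt0 e0 e1.
have n0 : (0 < 2 ^ j)%N by rewrite expn_gt0.
have h1 := cell_maximal (sg := 1) (expr1n _ 2) (ltW e0) n0.
have sgN : (-1 : R) ^+ 2 = 1 by rewrite sqrrN expr1n.
have h2 := cell_maximal sgN (ltW e0) n0.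
have iB sg : itg P (below (cell_dev sg (2 ^ j)) e (2 ^ j).+1).
  apply: (@itg_bounded _ _ _ _ _ 1) => [|w].
    apply: measurable_below => k _; apply: measurable_funM => //.
    by apply: measurable_funB; apply: mM => //; exact: grid_point_ge.
  by case: (below01 (cell_dev sg (2 ^ j)) e (2 ^ j).+1 w) => ->; rewrite ?normr0 ?normr1.
have i1 sg := itgB (itg_cst P 1) (iB sg).
rewrite -Ex_indic ?lee_fin; last exact: (grid_exceed_measurable ab (fun t at_ _ => mM at_)).
apply: (@le_trans _ _ (Ex P (fun w => (1 - below (cell_dev 1 (2 ^ j)) e (2 ^ j).+1 w) +
    (1 - below (cell_dev (-1) (2 ^ j)) e (2 ^ j).+1 w)))).
  apply: Ex_le; [|exact: itgD|move=> w].
    exact: (itg_indic _ (grid_exceed_measurable ab (fun t at_ _ => mM at_) e j)).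
  have b1 sg : 0 <= 1 - below (cell_dev sg (2 ^ j)) e (2 ^ j).+1 w.
    by case: (below01 (cell_dev sg (2 ^ j)) e (2 ^ j).+1 w) => ->; rewrite ?subrr ?subr0.
  rewrite indicE; have [|_] := boolP (w \in _); last by rewrite addr_ge0.
  rewrite inE => -[l ln el].
  have : exists2 sg : R, sg = 1 \/ sg = -1 & e <= cell_dev sg (2 ^ j) l w.
    rewrite /cell_dev; move: el; set x := M N _ w - _.
    have [x0|/ltW x0] := leP 0 x.
      by rewrite ger0_norm// => el; exists 1; [left|rewrite mul1r].
    by rewrite ler0_norm// => el; exists (-1); [right|rewrite mulN1r].
  move=> [sg sgP el'].
  have b0 : below (cell_dev sg (2 ^ j)) e (2 ^ j).+1 w = 0.
    have [//|h] := below01 (cell_dev sg (2 ^ j)) e (2 ^ j).+1 w.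
    by have := below_eq1 h ln; rewrite ltNge el'.
  have := b1 1; have := b1 (-1).
  by case: sgP b0 => -> ->; rewrite subr0 => ? ?; rewrite ?lerDl ?lerDr.
rewrite (ExD (i1 _) (i1 _)) ler_pdivlMr//.
set x := Ex P _ in h1 *; set y := Ex P _ in h2 *; set z := Ex P _ in h1 h2 *.
by rewrite mulrDl mulr_natl mulr2n lerD// mulrC.
Qed.

Lemma cell_exceed_sup e : 0 < e -> e <= 1 ->
  exists A : set Om, [/\ measurable A,
    (P A <= (2 * Ex P (fun w => cos_test (M N b w - M N a w)) / cos_test e)%:E)%E &
    forall w, ~ A w -> forall j l, (l <= 2 ^ j)%N ->
      `|M N (grid_point (2 ^ j) l) w - M N a w| < e].
Proof.
move=> e0 e1; apply: (grid_exceed_sup ab (fun t at_ _ => mM at_)) => j.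
exact: cell_exceed_prob.
Qed.

End Cell.

End CellOscillation.

(** * From grid times to all times by right continuity *)

Section GridDensity.
Context {R : realType}.
Implicit Types (a b c e t : R) (f : R -> R).

Lemma grid_point_dense a b t e : a <= t -> t < b -> 0 < e ->
  exists j l, [/\ (l <= 2 ^ j)%N, t < grid_point a b (2 ^ j) l & grid_point a b (2 ^ j) l < t + e].
Proof.
move=> at_ tb e0; pose mu := Num.min e (b - t).
have mu0 : 0 < mu by rewrite lt_min e0 subr_gt0.
have ab : 0 < b - a by rewrite subr_gt0 (le_lt_trans at_).
(* Since 2^j > j > (b - a) / mu, the mesh is below both [e] and b - t; the latter keeps the chosen
   point inside the grid. *)
pose j := (Num.truncn ((b - a) / mu)).+1.
have n0 : 0 < (2 ^ j)%N%:R :> R by rewrite ltr0n expn_gt0.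
pose h := (b - a) / (2 ^ j)%N%:R.
have h0 : 0 < h by rewrite divr_gt0.
have hmu : h < mu.
  rewrite ltr_pdivrMr// mulrC -ltr_pdivrMr//.
  apply: (@lt_trans _ _ j%:R); last by rewrite ltr_nat ltn_expl.
  by rewrite /j truncnS_gt.
have [he hb] : h < e /\ h < b - t by move: hmu; rewrite lt_min => /andP.
pose m := Num.truncn ((t - a) / h).
have m0 : 0 <= (t - a) / h by rewrite divr_ge0 ?subr_ge0 ?(ltW h0).
have [m1 m2] : m%:R * h <= t - a /\ t - a < m.+1%:R * h.
  by have /andP[] := truncn_itv m0; rewrite ler_pdivlMr// ltr_pdivrMr.
have E : m.+1%:R * h = m%:R * h + h by rewrite -natr1 mulrDl mul1r.
exists j, m.+1; rewrite /grid_point -/h; split; [|lra|lra].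
rewrite -(ler_nat R) -(ler_pM2r h0) {2}/h mulrC (mulrC _ (_ / _)) divfK ?lt0r_neq0//.
rewrite mulrC; lra.
Qed.

Lemma right_cvg_grid a b c e t f : a <= t -> t < b -> f x @[x --> t^'+] --> f t ->
  (forall j l, (l <= 2 ^ j)%N -> `|f (grid_point a b (2 ^ j) l) - c| <= e) ->
  `|f t - c| <= e.
Proof.
move=> at_ tb ft fe; rewrite leNgt; apply/negP => lt.
have cv : `|f x - c| @[x --> t^'+] --> `|f t - c|.
  by apply: cvg_norm; apply: (@cvgB _ R^o) => //; exact: cvg_cst.
have [r /= r0 H] := cvgr_gt _ cv _ lt.
have [j [l [ln l1 l2]]] := grid_point_dense at_ tb r0.
have := fe j l ln; rewrite leNgt => /negP; apply; apply: H => //=.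
by rewrite distrC ger0_norm; lra.
Qed.

Lemma at_right_shift a t : (fun x => a + x) @ t^'+ --> (a + t)^'+.
Proof.
move=> V [r /= r0 H]; exists r => //= x /= xr tx; apply: H => /=; last by rewrite ltrD2l.
by rewrite opprD addrACA subrr add0r.
Qed.

Lemma at_left_shift a t : (fun x => a + x) @ t^'- --> (a + t)^'-.
Proof.
move=> V [r /= r0 H]; exists r => //= x /= xr tx; apply: H => /=; last by rewrite ltrD2l.
by rewrite opprD addrACA subrr add0r.
Qed.

End GridDensity.

(** * Increments of the exponential and of the inverse square root *)

Section Analysis.
Context {R : realType}.

Lemma expR_sub_le (x y : R) : expR y - expR x <= expR y * (y - x).
Proof.
have -> : expR x = expR y * expR (x - y) by rewrite -expRD subrKC.
rewrite -{1}[expR y]mulr1 -mulrBr ler_pM2l ?expR_gt0//.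
by have := expR_ge1Dx (x - y); lra.
Qed.

(** With a and b the two roots, 1 / a - 1 / b = (b^2 - a^2) / (a b (a + b)), whose denominator is at
    least mu^3. *)
Lemma sqrtV_lipschitz (mu x y : R) : 0 < mu -> 0 <= x -> 0 <= y ->
  mu <= Num.sqrt x -> mu <= Num.sqrt y ->
  `|(Num.sqrt x)^-1 - (Num.sqrt y)^-1| <= `|x - y| / mu ^+ 3.
Proof.
move=> mu0 x0 y0; rewrite -{3}(sqr_sqrtr x0) -{3}(sqr_sqrtr y0).
move: (Num.sqrt x) (Num.sqrt y) => a b ma mb.
have a0 : 0 < a := lt_le_trans mu0 ma; have b0 : 0 < b := lt_le_trans mu0 mb.
have -> : a^-1 - b^-1 = (b - a) / (a * b) by field; rewrite !lt0r_neq0.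
rewrite subr_sqr !normrM normfV distrC -mulrA ler_wpM2l//.
rewrite (ger0_norm (ltW (addr_gt0 a0 b0))) (ger0_norm (ltW (mulr_gt0 a0 b0))).
have -> : mu ^+ 3 = mu * (mu * mu) by rewrite !exprS expr0 mulr1.
rewrite ler_pdivlMr ?mulr_gt0// mulrC ler_pdivrMr ?mulr_gt0//.
rewrite ler_pM ?mulr_ge0 ?(ltW mu0)//; last by rewrite ler_pM// ltW.
by rewrite (le_trans ma)// lerDl ltW.
Qed.

End Analysis.

(** * Splitting [-T, T] into cells *)

Section Cells.
Context {R : realType} {d : measure_display} {U : measurableType d} (m : probability U R).
Variables (T : R) (W : U -> R -> R) (K : nat).
Hypothesis T0 : 0 < T.
Hypothesis K0 : (0 < K)%N.

Definition cell_start (k : nat) : R := grid_point (- T) T K (minn k K).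
(** Capped at [K.-1] so that t = T belongs to the last cell. *)
Definition cell_index (t : R) : nat := minn (Num.truncn ((t + T) / ((T - - T) / K%:R))) K.-1.

Let h0 : 0 < (T - - T) / K%:R.
Proof. by have t0 := T0; rewrite divr_gt0 ?ltr0n//; lra. Qed.

Lemma cell_start_itv k : - T <= cell_start k <= T.
Proof.
have TT : - T < T by have := T0; lra.
rewrite /cell_start grid_point_ge//= -[leRHS](grid_point_end (- T) T K0) /grid_point.
by rewrite lerD2l ler_pM2r// ler_nat geq_minr.
Qed.

Lemma cell_index_lt t : (cell_index t < K)%N.
Proof. by rewrite /cell_index (leq_ltn_trans (geq_minr _ _))// prednK. Qed.

Lemma cell_startS k : (k < K)%N -> cell_start k.+1 = cell_start k + (T - - T) / K%:R.
Proof.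
move=> kK; rewrite /cell_start (minn_idPl kK) (minn_idPl (ltnW kK)) /grid_point -natr1.
by rewrite mulrDl mul1r addrA.
Qed.

Lemma cell_index_itv t : - T <= t <= T ->
  cell_start (cell_index t) <= t <= cell_start (cell_index t).+1.
Proof.
move=> /andP[Tt tT]; set k := cell_index t; have kK : (k < K)%N := cell_index_lt t.
have q0 : 0 <= (t + T) / ((T - - T) / K%:R) by rewrite divr_ge0 ?(ltW h0)//; lra.
have /andP[m1 m2] := truncn_itv q0; rewrite ler_pdivlMr// in m1; rewrite ltr_pdivrMr// in m2.
rewrite cell_startS// /cell_start (minn_idPl (ltnW kK)) /grid_point.
apply/andP; split.
  have : k%:R * ((T - - T) / K%:R) <= t + T; last by lra.
  by apply: le_trans m1; rewrite ler_pM2r// ler_nat geq_minl.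
have [kE|kE] : k = Num.truncn ((t + T) / ((T - - T) / K%:R)) \/ k = K.-1.
- by rewrite /k /cell_index; case: (leqP (Num.truncn ((t + T) / ((T - - T) / K%:R))) K.-1); auto.
- by move: m2; rewrite -kE -natr1 mulrDl; lra.
have : k.+1%:R * ((T - - T) / K%:R) = T - - T.
  by rewrite kE prednK// mulrC divfK// lt0r_neq0// ltr0n.
by rewrite -natr1 mulrDl; lra.
Qed.

(** Union bound: K cells of length 2 T / K, each bad with probability at most C (2 T / K)^2. *)
Lemma cells_small_oscillation (C eps : R) :
  (forall k, (k < K)%N -> exists A : set U, [/\ measurable A,
     (m A <= (C * (cell_start k.+1 - cell_start k) ^+ 2)%:E)%E &
     forall w, ~ A w -> forall t, cell_start k <= t <= cell_start k.+1 ->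
       `|W w t - W w (cell_start k)| <= eps]) ->
  small_oscillation T m W cell_start cell_index eps (C * (2 * T) ^+ 2 / K%:R).
Proof.
move=> H; have /choice[A AP] : forall k, exists A : set U, (k < K)%N -> [/\ measurable A,
     (m A <= (C * (cell_start k.+1 - cell_start k) ^+ 2)%:E)%E &
     forall w, ~ A w -> forall t, cell_start k <= t <= cell_start k.+1 ->
       `|W w t - W w (cell_start k)| <= eps].
  move=> k; have [kK|kK] := boolP (k < K)%N; last by exists set0.
  by have [A AP] := H k kK; exists A.
have mA k : (k < K)%N -> measurable (A k) by move=> /AP[].
have mU : measurable (\big[setU/set0]_(k < K) A k).
  by apply: bigsetU_measurable => k _; exact: mA.
exists (\big[setU/set0]_(k < K) A k); split => //.
- apply: (@le_trans _ _ (\sum_(k < K) m (A k))%E).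
    exact: (@content_subadditive _ _ _ m _ A K mA mU).
  apply: (@le_trans _ _ (\sum_(k < K) (C * ((T - - T) / K%:R) ^+ 2)%:E)%E).
    apply: lee_sum => k _; have [_ + _] := AP k (ltn_ord k).
    by rewrite cell_startS// addrAC subrr add0r.
  rewrite sumEFin lee_fin sumr_const card_ord -mulr_natr opprK.
  have Kn : K%:R != 0 :> R by rewrite pnatr_eq0 -lt0n.
  rewrite le_eqVlt; apply/orP; left; apply/eqP; field.
  exact: Kn.
move=> w nA t tT; have [_ _] := AP _ (cell_index_lt t).
apply; last exact: cell_index_itv.
move=> Aw; apply: nA; rewrite -bigcup_mkord.
by exists (cell_index t) => //; exact: cell_index_lt.
Qed.

End Cells.

(** * Transfer of oscillation bounds to the limit process *)

Section OscillationFunctional.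
Context {R : realType}.
Implicit Types (n : nat) (v : nat -> R).

Definition oscillation n v : R := \big[Num.max/0]_(l < n) `|v l - v 0%N|.

Lemma oscillation_le n v e : 0 <= e -> (forall l, (l < n)%N -> `|v l - v 0%N| <= e) ->
  oscillation n v <= e.
Proof. by move=> e0 h; apply/bigmax_leP; split => // l _; exact: h. Qed.

Lemma le_oscillation n v l : (l < n)%N -> `|v l - v 0%N| <= oscillation n v.
Proof. by move=> ln; exact: (le_bigmax _ (fun l : 'I_n => `|v l - v 0%N|) (Ordinal ln)). Qed.

Lemma oscillation_lipschitz n : (0 < n)%N -> lipschitz_coords n 2 (oscillation n).
Proof.
move=> n0; have h u v e : 0 <= e -> (forall k, (k < n)%N -> `|u k - v k| <= e) ->
    oscillation n u <= oscillation n v + 2 * e.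
  move=> e0 uv; have o0 : 0 <= oscillation n v.
    exact: (le_trans (normr_ge0 _) (le_oscillation _ n0)).
  apply: oscillation_le => [|l ln]; first by rewrite addr_ge0// mulr_ge0.
  have h1 := uv l ln; have h2 := uv 0%N n0; have h3 := le_oscillation v ln.
  have -> : u l - u 0%N = (u l - v l) + (v l - v 0%N) - (u 0%N - v 0%N) by ring.
  have := ler_normB (u l - v l + (v l - v 0%N)) (u 0%N - v 0%N).
  have := ler_normD (u l - v l) (v l - v 0%N); lra.
move=> u v e e0 uv; have h1 := h u v e e0 uv.
have h2 : oscillation n v <= oscillation n u + 2 * e.
  by apply: h => // k kn; rewrite distrC uv.
by rewrite ler_norml; apply/andP; split; lra.
Qed.

Definition clip (x : R) : R := Num.min 1 (Num.max 0 x).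

Lemma clip_itv x : 0 <= clip x <= 1.
Proof. by rewrite /clip le_min ler01 ge_min lexx/= le_max lexx. Qed.

Lemma clip_lipschitz x y : `|clip x - clip y| <= `|x - y|.
Proof.
have h (u v : R) : clip u <= clip v + `|u - v|.
  have := ler_norm (u - v); have := normr_ge0 (u - v); move: `|u - v| => e.
  rewrite /clip /Num.min /Num.max => e0 ue.
  by case: (ltP 0 u) => ?; case: (ltP 0 v) => ?; case: (ltP 1 u) => ?;
    case: (ltP 1 v) => ?; rewrite ?ltr10; lra.
have h1 := h x y; have h2 := h y x; rewrite distrC in h2.
by rewrite ler_norml; apply/andP; split; lra.
Qed.

End OscillationFunctional.

Section OscillationTransfer.
Context {R : realType} {d d' : measure_display} {Om : measurableType d}
  {Om' : measurableType d'} (P : probability Om R) (Q : probability Om' R).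
Variables (T : R) (V : nat -> R -> Om -> R) (X : R -> Om' -> R).
Hypothesis mV : \forall N \near \oo, forall t, -T <= t <= T -> measurable_fun setT (V N t).
Hypothesis mX : forall t, -T <= t <= T -> measurable_fun setT (X t).
Hypothesis rX : forall w t, -T <= t < T -> X x w @[x --> t^'+] --> X t w.
Hypothesis fdd : forall (ts : nat -> R) (n : nat) (K M : R) g,
  (forall k, -T <= ts k <= T) -> 0 <= K -> lipschitz_coords n K g -> (forall v, `|g v| <= M) ->
  Ex P (fun w => g (fun k => V N (ts k) w)) @[N --> \oo] --> Ex Q (fun w => g (fun k => X (ts k) w)).

(** A Lipschitz function of the oscillation over a finite grid is squeezed between two indicators,
    so finite-dimensional convergence bounds the probability that the limit exceeds 2 eps on the
    grid. Nested grids and right continuity reach all times of the cell; the gap between the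
    indicators is why [eps] doubles. *)
Lemma cell_transfer (a b eps C : R) : -T <= a -> a < b -> b <= T -> 0 < eps ->
  (\forall N \near \oo, exists A : set Om, [/\ measurable A, (P A <= C%:E)%E &
     forall w, ~ A w -> forall t, a <= t <= b -> `|V N t w - V N a w| <= eps]) ->
  exists A : set Om', [/\ measurable A, (Q A <= C%:E)%E &
     forall w, ~ A w -> forall t, a <= t <= b -> `|X t w - X a w| <= 2 * eps].
Proof.
move=> Ta ab bT eps0 cellV.
have mXab t : a <= t -> t <= b -> measurable_fun setT (X t).
  by move=> at_ tb; apply: mX; rewrite (le_trans Ta at_) (le_trans tb bT).
suff exc j : (Q (grid_exceed X a b (2 * eps) j) <= C%:E)%E.
  have [A [mA QA nA]] := grid_exceed_sup ab mXab exc.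
  exists A; split => // w /nA h t /andP[at_]; rewrite le_eqVlt => /predU1P[->|tb].
    by have := h 0%N 1%N (leqnn _); rewrite grid_point_end// => /ltW.
  apply: (right_cvg_grid (f := fun t => X t w) at_ tb).
    by apply: rX; rewrite (le_trans Ta at_) (lt_le_trans tb bT).
  by move=> j l ln; apply/ltW/h.
pose n := (2 ^ j)%N; pose ts k := grid_point a b n (minn k n).
have tsab k : a <= ts k <= b by rewrite grid_point_ge// grid_point_le// geq_minr.
have tsT k : -T <= ts k <= T.
  by have /andP[h1 h2] := tsab k; rewrite (le_trans Ta h1) (le_trans h2 bT).
have ts0 : ts 0%N = a by rewrite /ts min0n /grid_point mul0r addr0.
(* Equal to 0 when the oscillation is at most [eps] and to 1 when it is at least 2 eps. *)
pose g v := clip (oscillation n.+1 v / eps - 1).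
have gL : lipschitz_coords n.+1 (2 / eps) g.
  move=> u v e e0 uv; apply: (le_trans (clip_lipschitz _ _)).
  rewrite opprB addrA subrK -mulrBl normrM normfV (gtr0_norm eps0) mulrAC.
  by rewrite ler_pM2r ?invr_gt0//; exact: (oscillation_lipschitz (ltn0Sn n) e0 uv).
have K0 : 0 <= 2 / eps by rewrite divr_ge0// ltW.
have g01 v : 0 <= g v <= 1 by exact: clip_itv.
have gM v : `|g v| <= 1 by have /andP[h1 h2] := g01 v; rewrite ger0_norm.
have EgQ : Ex Q (fun w => g (fun k => X (ts k) w)) <= C.
  apply: (cvgr_to_le (fdd tsT K0 gL gM)); near=> N.
  have mVN : forall t, -T <= t <= T -> measurable_fun setT (V N t) by near: N.
  have [A [mA PA nA]] : exists A : set Om, [/\ measurable A, (P A <= C%:E)%E &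
     forall w, ~ A w -> forall t, a <= t <= b -> `|V N t w - V N a w| <= eps] by near: N.
  have ig : itg P (fun w => g (fun k => V N (ts k) w)).
    exact: (itg_lipschitz P (fun k => mVN _ (tsT k)) K0 gL gM).
  rewrite -lee_fin; apply: le_trans PA; rewrite -(Ex_indic P mA) lee_fin.
  apply: Ex_le => //; first exact: itg_indic.
  move=> w; rewrite indicE; have [wA|wA] := boolP (w \in A).
    by have /andP[] := g01 (fun k => V N (ts k) w).
  have nAw : ~ A w by move=> Aw; move/negP: wA; apply; rewrite inE.
  have : oscillation n.+1 (fun k => V N (ts k) w) <= eps.
    by apply: oscillation_le => [|l _]; [exact: ltW|rewrite ts0; exact: nA].
  rewrite /g -(ler_pM2r (x := eps^-1)) ?invr_gt0// divff ?lt0r_neq0// => le1.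
  rewrite /clip (_ : Num.max 0 _ = 0) ?ge_min ?lexx ?orbT//.
  by apply/max_idPl; lra.
apply: le_trans (_ : ((Ex Q (fun w => g (fun k => X (ts k) w)))%:E <= _)%E); last first.
  by rewrite lee_fin.
have mE := grid_exceed_measurable ab mXab (2 * eps) j.
rewrite -(Ex_indic Q mE) lee_fin; apply: Ex_le; first exact: itg_indic.
  exact: (itg_lipschitz Q (fun k => mX (tsT k)) K0 gL gM).
move=> w; rewrite indicE; have [|_] := boolP (w \in _); last first.
  by have /andP[] := g01 (fun k => X (ts k) w).
rewrite inE => -[l ln el].
have := le_oscillation (fun k => X (ts k) w) (ln : (l < n.+1)%N).
rewrite ts0 /ts (minn_idPl ln) => h.
have : 2 <= oscillation n.+1 (fun k => X (ts k) w) / eps.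
  by rewrite ler_pdivlMr//; exact: le_trans h.
rewrite /g /clip => le2; rewrite le_min lexx/= le_max; apply/orP; right; lra.
Unshelve. all: by end_near. Qed.

End OscillationTransfer.

(** * Cosines and second moments under Gaussian laws *)

Section CosineLaws.
Context {R : realType} {d : measure_display} {Om : measurableType d} (Q : probability Om R).

Lemma Ex_cos_normal (L : Om -> R) (v b : R) : measurable_fun setT L -> 0 < v ->
  (forall B, measurable B -> Q (L @^-1` B) = normal_prob 0 (Num.sqrt v) B) ->
  Ex Q (fun w => cos (b + L w)) = cos b * expR (- (v / 2)).
Proof.
move=> mL v0 LQ.
have mc : measurable_fun setT (fun x : R => cos (b + x)).
  by apply: (measurableT_comp measurable_cos); exact: measurable_funD.
have ic : itg Q (fun w => cos (b + L w)).
  by apply: (itg_bounded Q (measurableT_comp mc mL) (M := 1)) => w; exact: cos_max.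
have [_ ->] := Ex_same_law (Q := normal_prob 0 (Num.sqrt v)) (G := id) mL (@measurable_id _ _ _) LQ mc ic.
rewrite /Ex /Rintegral integral_cos_normal_prob; last by rewrite lt0r_neq0// sqrtr_gt0.
by rewrite /= sqr_sqrtr ?ltW// mulNr.
Qed.

Lemma Ex_cos_zero (L : Om -> R) (b : R) : measurable_fun setT L ->
  Q (L @^-1` [set 0]) = 1%E -> Ex Q (fun w => cos (b + L w)) = cos b.
Proof.
move=> mL L0; pose A := L @^-1` [set 0].
have mA : measurable A by rewrite -[A]setTI; apply: mL.
have mc : measurable_fun setT (fun w => cos (b + L w)).
  by apply: (measurableT_comp measurable_cos); exact: measurable_funD.
have ic : itg Q (fun w => cos (b + L w)).
  by apply: (itg_bounded Q mc (M := 1)) => w; exact: cos_max.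
have mAc : measurable (~` A) by exact: measurableC.
apply/eqP; rewrite -subr_eq0 -normr_le0 -[X in _ - X](Ex_cst Q) -(ExB ic (itg_cst Q _)).
apply: (@le_trans _ _ (Ex Q (fun w => 2 * \1_(~` A) w))).
  apply: normr_Ex_le; [exact: itgB ic (itg_cst Q _)|exact/itgZ/itg_indic|move=> w].
  have [Aw|nAw] := pselect (A w).
    by rewrite Aw addr0 subrr normr0 mulr_ge0// indicE; case: (_ \in _).
  rewrite indicE mem_set// mulr1 (le_trans (ler_normB _ _))//.
  by rewrite [leRHS](_ : _ = 1 + 1)// lerD// cos_max.
have Q0 : Ex Q \1_(~` A) = 0.
  have := Ex_indic Q mAc; rewrite probability_setC// [X in (1 - X)%E]L0 subee// => -[]//.
by rewrite (ExZ _ (itg_indic Q mAc)) Q0 mulr0.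
Qed.

(* Fatou along [2 n^2 (1 - cos (L / n))], which tends to [L^2]. *)
Lemma Ex_sqr_le_cos (L : Om -> R) (v : R) : measurable_fun setT L ->
  (forall a, Ex Q (fun w => cos (a * L w)) = expR (- (a ^+ 2 * v / 2))) ->
  itg Q (fun w => L w ^+ 2) /\ Ex Q (fun w => L w ^+ 2) <= v.
Proof.
move=> mL EL.
have n0 n : 0 < n.+1%:R :> R by rewrite ltr0n.
pose f n w := 2 * n.+1%:R ^+ 2 * (1 - cos (n.+1%:R^-1 * L w)).
have mfn a : measurable_fun setT (fun w => cos (a * L w)).
  by apply: (measurableT_comp measurable_cos); exact: measurable_funM.
have icos a : itg Q (fun w => cos (a * L w)).
  by apply: (itg_bounded Q (mfn a) (M := 1)) => w; exact: cos_max.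
have i1 a := itgB (itg_cst Q 1) (icos a).
have fcvg w : (f n w)%:E @[n --> \oo] --> (L w ^+ 2)%:E.
  apply: cvg_EFin; first exact: nearW.
  rewrite -[X in _ --> X]add0r.
  have -> : fine \o (fun n => (f n w)%:E) = fun n => (f n w - L w ^+ 2) + L w ^+ 2.
    by apply/funext => n /=; rewrite subrK.
  apply: (@cvgD _ R^o); last exact: cvg_cst.
  have c0 : 2 * `|L w| ^+ 3 * n.+1%:R^-1 @[n --> \oo] --> 0.
    by rewrite -[X in _ --> X](mulr0 (2 * `|L w| ^+ 3)); apply: cvgM; [exact: cvg_cst|exact: cvg_harmonic].
  apply: (norm_squeeze0 _ c0) => n; set x := L w; set k := n.+1%:R.
  have k0 : 0 < k by exact: n0.
  have -> : f n w - x ^+ 2 = - (2 * k ^+ 2 * (cos (k^-1 * x) - (1 - (k^-1 * x) ^+ 2 / 2))).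
    by rewrite /f -/x -/k; field; rewrite lt0r_neq0.
  rewrite normrN normrM ger0_norm ?mulr_ge0 ?sqr_ge0//.
  have -> : 2 * `|x| ^+ 3 * k^-1 = 2 * k ^+ 2 * (k^-1 * `|x|) ^+ 3.
    by field; rewrite lt0r_neq0.
  rewrite ler_wpM2l ?mulr_ge0 ?sqr_ge0//; apply: (le_trans (cos_taylor _)).
  by rewrite /rho ge_min normrM normfV (gtr0_norm k0) lexx orbT.
have := @fatou _ _ _ Q setT measurableT (fun n w => (f n w)%:E).
rewrite (_ : (fun w => limn_einf _) = fun w => (L w ^+ 2)%:E); last first.
  by apply/funext => w; exact: (cvg_limn_einf_sup (fcvg w)).1.
have ifn n : itg Q (f n) by exact/itgZ/i1.
move=> /(_ (fun n => (measurable_EFinP _ _).2 (itg_meas (ifn n)))) h.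
have {}h : (\int[Q]_w (L w ^+ 2)%:E <= v%:E)%E.
  apply: (le_trans (h _)) => [n w _|].
    by rewrite lee_fin mulr_ge0 ?mulr_ge0 ?sqr_ge0// subr_ge0 cos_le1.
  rewrite limn_einf_lim; apply: lime_le; first exact: is_cvg_einfs.
  apply: nearW => n; apply: (@le_trans _ _ (\int[Q]_w (f n w)%:E)%E).
    by apply: ereal_inf_lbound; exists n => //=.
  rewrite -EFin_Ex// lee_fin /f ExZ// (ExB (itg_cst Q 1) (icos _)) Ex_cst EL.
  have := expR_ge1Dx (- (n.+1%:R^-1 ^+ 2 * v / 2)).
  move: (expR _) => e he; have k0 := n0 n; set k := n.+1%:R in he k0 *.
  have k2 : 0 < k ^+ 2 by rewrite exprn_gt0.
  apply: (@le_trans _ _ (2 * k ^+ 2 * (k^-1 ^+ 2 * v / 2))).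
    by rewrite ler_wpM2l ?mulr_ge0 ?sqr_ge0// lerBlDr -lerBlDl.
  by rewrite le_eqVlt; apply/orP; left; apply/eqP; field; rewrite lt0r_neq0.
have i2 : itg Q (fun w => L w ^+ 2).
  apply: itg_ge0P => [|w|]; [exact: measurable_funX|exact: sqr_ge0|].
  exact: (le_lt_trans h (ltry _)).
by split => //; rewrite -lee_fin EFin_Ex.
Qed.

End CosineLaws.

Section GaussianProcess.
Context {R : realType} {d : measure_display} {Om : measurableType d} (Q : probability Om R).
Variables (X : R -> Om -> R) (C : R -> R -> R).
Hypothesis GX : centered_gaussian_process Q X C.

Lemma gaussian_process_cos (n : nat) (t a : nat -> R) (b : R) :
  let v := \sum_(j < n) \sum_(k < n) a j * a k * C (t j) (t k) in 0 <= v ->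
  Ex Q (fun w => cos (b + \sum_(k < n) a k * X (t k) w)) = cos b * expR (- (v / 2)).
Proof.
move=> v v0; have [mX GL] := GX.
have mL : measurable_fun setT (fun w => \sum_(k < n) a k * X (t k) w).
  by apply: measurable_sum => k; exact: measurable_funM.
have [Lpos L0] := GL n (fun k => t k) (fun k => a k).
move: v0; rewrite le_eqVlt => /predU1P[ve|v0].
  by rewrite -ve mul0r oppr0 expR0 mulr1; apply: Ex_cos_zero => //; apply: L0.
by apply: (Ex_cos_normal _ mL v0) => B mB; exact: Lpos.
Qed.

Lemma gaussian_process_sqr (t : R) : 0 <= C t t ->
  itg Q (fun w => X t w ^+ 2) /\ Ex Q (fun w => X t w ^+ 2) <= C t t.
Proof.
move=> C0; have [mX _] := GX; apply: Ex_sqr_le_cos => // a.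
have := gaussian_process_cos (n := 1) (t := fun=> t) (a := fun=> a) 0.
rewrite /= !big_ord1 -expr2 => /(_ (mulr_ge0 (sqr_ge0 a) C0)).
rewrite cos0 mul1r => <-; congr Ex; apply/funext => w; by rewrite add0r big_ord1.
Qed.

End GaussianProcess.

(** * The normalized process: convergence, oscillation, tightness *)

Section FluctuationLimit.
Context {R : realType} {d d' : measure_display} {Om : measurableType d}
  {Om' : measurableType d'} (P : probability Om R) (Q : probability Om' R).
Variables (xis : nat -> R -> Om -> R) (psi : R -> R) (s : nat -> R) (X : R -> Om' -> R).
Hypothesis Lx : forall i, levy_process P (xis i).
Hypothesis indx : indep_processes P xis.
Hypothesis mom : forall i u t, 0 <= t -> itg P (fun w => expR (u * xis i t w)) /\
  Ex P (fun w => expR (u * xis i t w)) = expR (t * psi u).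
Hypothesis s_cvg : s N @[N --> \oo] --> +oo.
Hypothesis psi12 : 2 * psi 1 < psi 2.
Variables (p lam lam' : R).
Hypothesis p23 : 2 < p /\ p <= 3.
Hypothesis psip : psi p - p * psi 2 / 2 <= (p / 2 - 1) * lam.
Hypothesis lamlam' : lam < lam'.
Hypothesis lnN : \forall N \near \oo, lam' * s N <= ln N%:R.
Hypothesis GX : centered_gaussian_process Q X
  (fun t1 t2 => expR ((psi 1 - psi 2 / 2) * `|t2 - t1|)).
Hypothesis cX : forall w T, cadlag_on T (X^~ w).
Local Notation M := (martingale xis psi s).
Local Notation c2 := (psi 2 - 2 * psi 1).
Variable T : R.
Hypothesis T0 : 0 < T.

Let s_gt (x : R) : \forall N \near \oo, x < s N.
Proof. by move/cvgryPgt : s_cvg; exact. Qed.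

Let s_ge (x : R) : \forall N \near \oo, x <= s N.
Proof. by apply: filterS (s_gt x) => N; exact: ltW. Qed.

Let c20 : 0 < c2. Proof. by rewrite subr_gt0. Qed.

Lemma sum_particle_row (n : nat) (t : nat -> R) (a : nat -> nat -> R) N w :
  \sum_(i < N) particle_row xis psi s n t a N i w = \sum_(k < n) a N k * M N (t k) w.
Proof.
rewrite exchange_big/=; apply: eq_bigr => k _.
by rewrite /martingale big_distrr.
Qed.

Lemma martingale_clt (n : nat) (t : nat -> R) (a : nat -> nat -> R) (A : nat -> R) :
  (forall k, - T <= t k) -> (forall k, a N k @[N --> \oo] --> A k) ->
  [/\ \forall N \near \oo, itg P (fun w => (\sum_(k < n) a N k * M N (t k) w) ^+ 2),
    Ex P (fun w => (\sum_(k < n) a N k * M N (t k) w) ^+ 2) @[N --> \oo] -->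
      limit_var psi n t A &
    forall b, Ex P (fun w => cos (b + \sum_(k < n) a N k * M N (t k) w)) @[N --> \oo] -->
      cos b * expR (- (limit_var psi n t A / 2))].
Proof.
move=> tT aA.
have [B [_ row clt]] := particle_row_clt Lx indx mom s_cvg psi12 p23 psip lamlam' lnN n tT aA.
have rv : \forall N \near \oo, itg P (fun w => (\sum_(k < n) a N k * M N (t k) w) ^+ 2) /\
    Ex P (fun w => (\sum_(k < n) a N k * M N (t k) w) ^+ 2) = N%:R * row_var psi s n t a N.
  near=> N; under eq_fun do rewrite -sum_particle_row.
  apply: (row_variance (r := row_rho psi s p n t B N)); near: N; exact: row.
split.
- by apply: filterS rv => N [].
- apply: cvg_trans (row_var_cvg s_cvg psi12 (n := n) (t := t) aA); apply: near_eq_cvg.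
  by apply: filterS rv => N [].
- move=> b; under eq_fun => N do (under eq_fun do rewrite -sum_particle_row).
  exact: clt.
Unshelve. all: by end_near. Qed.

Lemma martingale_variance N t : T <= s N -> (0 < N)%N -> - T <= t ->
  itg P (fun w => M N t w ^+ 2) /\
  Ex P (fun w => M N t w ^+ 2) = expR (c2 * t) - expR (- (c2 * s N)).
Proof.
move=> sT N0 tT.
have n1 (k : nat) : (k < 1)%N -> `|1| <= 1 :> R by rewrite normr1.
have rho1 := @centered_particle_row _ _ _ _ _ _ _ Lx indx mom _ p23 T 1 (fun=> t) (fun _ _ => 1)
  (fun=> tT) N sT 1 (lexx _) n1.
have [i e] := row_variance rho1; move: i e.
have -> : (fun w => (\sum_(i < N) particle_row xis psi s 1 (fun=> t) (fun _ _ => 1) N i w) ^+ 2) =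
    fun w => M N t w ^+ 2.
  by apply/funext => w; rewrite sum_particle_row big_ord1 mul1r.
move=> i ->; split => //; rewrite /row_var !big_ord1 minxx mulrA natM_kap_sqr// !mul1r.
rewrite mulrBr mulr1 -expRD; congr (expR _ - _); ring.
Qed.

(** Stated for a general filter so that it yields both right continuity and the existence of left
    limits. *)
Lemma martingale_cvg (F : set_system R) N t w (l : nat -> R) : Filter F ->
  x @[x --> F] --> t -> (forall i, xis i (s N + x) w @[x --> F] --> l i) ->
  M N x w @[x --> F] -->
    \sum_(i < N) kap psi s N * (expR (l i - psi 1 * (s N + t)) - 1).
Proof.
move=> FF Ft Fl; apply: (cvg_sum_ord (f := fun i x => centered_particle xis psi s x N i w)
  (l := fun i => kap psi s N * (expR (l i - psi 1 * (s N + t)) - 1))) => i.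
apply: cvgM; first exact: cvg_cst.
apply: (@cvgB _ R^o); last exact: cvg_cst.
apply: continuous_cvg; first exact: continuous_expR.
apply: (@cvgB _ R^o); first exact: Fl.
by apply: cvgM; first exact: cvg_cst; apply: (@cvgD _ R^o) => //; exact: cvg_cst.
Qed.

Lemma levy_right_cvg N i t w : 0 <= s N + t ->
  xis i (s N + x) w @[x --> t^'+] --> xis i (s N + t) w.
Proof.
move=> st; have [_ [_ [cl _]]] := Lx i; have [cr _] := cl w.
have h := cvg_comp _ _ (@at_right_shift _ (s N) t) (cr _ st); exact h.
Qed.

Lemma levy_left_cvg N i t w : 0 < s N + t -> cvg (xis i (s N + x) w @[x --> t^'-]).
Proof.
move=> st; have [_ [_ [cl _]]] := Lx i; have [_ cr] := cl w.
have /cvg_ex[l hl] := cr _ st.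
have h := cvg_comp _ _ (@at_left_shift _ (s N) t) hl; apply/cvg_ex; exists l; exact h.
Qed.

Lemma martingale_right_cvg N t w : 0 <= s N + t ->
  M N x w @[x --> t^'+] --> M N t w.
Proof.
move=> st; apply: (martingale_cvg (l := fun i => xis i (s N + t) w)) => [|i]; last exact: levy_right_cvg.
exact: cvg_at_right_filter.
Qed.

(** The mean of the test function of the increment tends to v / 2 - 1 + exp (- v / 2), with v the
    limiting variance: its quadratic part by the variance computation, its cosine part by the
    central limit theorem. The maximal inequality turns this into a bound of order v^2 on the grid,
    and right continuity extends it to the cell. *)
Lemma cell_oscillation a b e : - T <= a -> a < b -> 0 < e -> e <= 1 ->
  \forall N \near \oo, exists A : set Om, [/\ measurable A,
    (P A <= ((expR (c2 * b) - expR (c2 * a)) ^+ 2 / cos_test e)%:E)%E &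
    forall w, ~ A w -> forall t, a <= t <= b -> `|M N t w - M N a w| <= e].
Proof.
move=> Ta ab e0 e1; set v := expR (c2 * b) - _.
have v0 : 0 < v by rewrite subr_gt0 ltr_expR ltr_pM2l.
(* The increment from [a] to [b] as a linear form with coefficients 1 and -1. *)
pose tt (k : nat) := if k is 0%N then b else a.
pose aa (N k : nat) : R := if k is 0%N then 1 else -1.
have ttT k : - T <= tt k by case: k => [|k]//=; rewrite (le_trans Ta)// ltW.
have aaA k : aa N k @[N --> \oo] --> aa 0%N k by exact: cvg_cst.
have [isq vcv ccv] := martingale_clt 2 ttT aaA.
have E N w : \sum_(k < 2) aa N k * M N (tt k) w = M N b w - M N a w.
  by rewrite !big_ord_recl big_ord0/= mul1r mulN1r addr0.
have lv : limit_var psi 2 tt (aa 0%N) = v.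
  rewrite /limit_var !big_ord_recl !big_ord0/= !addr0 !minxx (min_l (ltW ab)) (min_r (ltW ab)).
  by rewrite /v; ring.
have cvt : Ex P (fun w => cos_test (M N b w - M N a w)) @[N --> \oo] -->
    v / 2 - 1 + expR (- (v / 2)).
  have cv : 2^-1 * Ex P (fun w => (\sum_(k < 2) aa N k * M N (tt k) w) ^+ 2) - 1 +
     Ex P (fun w => cos (0 + \sum_(k < 2) aa N k * M N (tt k) w)) @[N --> \oo] -->
     2^-1 * v - 1 + cos 0 * expR (- (v / 2)).
    rewrite -lv; apply: (@cvgD _ R^o); last exact: ccv.
    apply: (@cvgB _ R^o); last exact: cvg_cst.
    by apply: cvgM; [exact: cvg_cst|exact: vcv].
  rewrite cos0 mul1r (mulrC 2^-1) in cv.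
  apply: cvg_trans cv; apply: near_eq_cvg; near=> N.
  have i2 : itg P (fun w => (M N b w - M N a w) ^+ 2).
    by under eq_fun do rewrite -E; near: N.
  have sT : T <= s N by near: N; exact: s_ge.
  have iM t : a <= t -> itg P (M N t) by move=> at_; apply: (martingale_itg mom); lra.
  have iD : itg P (fun w => M N b w - M N a w) by apply: itgB; apply: iM => //; exact: ltW.
  have ic : itg P (fun w => cos (M N b w - M N a w)).
    apply: (itg_bounded P (measurableT_comp measurable_cos (itg_meas iD)) (M := 1)) => w.
    exact: cos_max.
  under [in X in _ * X]eq_fun do rewrite E.
  under [in X in _ + X]eq_fun do rewrite E add0r.
  rewrite -[X in _ - X](Ex_cst P) -(ExZ _ i2) -(ExB (itgZ _ i2) (itg_cst P _)).
  rewrite -(ExD (itgB (itgZ _ i2) (itg_cst P _)) ic); congr Ex; apply/funext => w.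
  by rewrite /cos_test (mulrC 2^-1).
(* The limit is at most v^2 / 2; the spare factor makes the inequality strict, so it holds for all
   large N. *)
have lt : 2 * (v / 2 - 1 + expR (- (v / 2))) < v ^+ 2.
  have := cos_test_limit (ltW v0); have : 0 < v ^+ 2 by rewrite exprn_gt0.
  lra.
have ev : \forall N \near \oo, 2 * Ex P (fun w => cos_test (M N b w - M N a w)) < v ^+ 2.
  by apply: (cvgr_lt _ _ _ lt); apply: cvgM; [exact: cvg_cst|exact: cvt].
near=> N.
have sa : 0 < s N + a by have : 1 - a <= s N by [near: N; exact: s_ge]; lra.
have i2 : itg P (fun w => (M N b w - M N a w) ^+ 2).
  by under eq_fun do rewrite -E; near: N.
have [A [mA PA nA]] := cell_exceed_sup Lx indx mom sa ab i2 e0 e1.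
exists A; split => //.
  apply: (le_trans PA); rewrite lee_fin ler_wpM2r//.
    by rewrite invr_ge0 ltW// cos_test_gt0.
  by apply/ltW; near: N.
move=> w /nA h t /andP[at_]; rewrite le_eqVlt => /predU1P[->|tb].
  by have := h 0%N 1%N (leqnn _); rewrite grid_point_end// => /ltW.
apply: (right_cvg_grid (f := fun t => M N t w) at_ tb).
  by apply: martingale_right_cvg; lra.
by move=> j l ln; apply/ltW/h.
Unshelve. all: by end_near. Qed.

Definition martingale_var (N : nat) (t : R) : R := expR (c2 * t) - expR (- (c2 * s N)).
Definition normalized (N : nat) (t : R) (w : Om) : R :=
  (Num.sqrt (martingale_var N t))^-1 * M N t w.

(** The sum of particles is r M + m with deterministic r > 0 and m its mean; centering removes m,
    and dividing by the standard deviation cancels r. *)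
Lemma normalized_particles N t w : T <= s N -> (0 < N)%N -> - T <= t ->
  let Z := fun w => \sum_(i < N) expR (xis i (s N + t) w) in
  (Z w - mean P Z) / Num.sqrt (var P Z) = normalized N t w.
Proof.
move=> sT N0 tT Z; have st : 0 <= s N + t by lra.
pose m := N%:R * expR (psi 1 * (s N + t)); pose r := expR (psi 1 * (s N + t)) / kap psi s N.
have k0 : 0 < kap psi s N by exact: expR_gt0.
have r0 : 0 < r by rewrite divr_gt0// expR_gt0.
have ZE v : Z v = r * M N t v + m.
  rewrite /Z /martingale /centered_particle -big_distrr/= /r mulrA divfK ?lt0r_neq0//.
  rewrite sumrB sumr_const card_ord mulrBr big_distrr/= -mulr_natr mul1r /m.
  rewrite [X in _ - X]mulrC subrK; apply: eq_bigr => i _.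
  by rewrite /emart -expRD subrKC.
have iM : itg P (M N t) by exact: (martingale_itg mom).
have EM : Ex P (M N t) = 0.
  rewrite /martingale Ex_sum => [|i]; last exact: (centered_particle_itg mom).
  apply: big1 => i _; rewrite /centered_particle.
  have i1 := emart_itg (mom i) st; rewrite (ExZ _ (itgB i1 (itg_cst P 1))).
  by rewrite (ExB i1 (itg_cst P 1)) (Ex_emart (mom i) st) Ex_cst subrr mulr0.
have mZ : mean P Z = m.
  rewrite -[LHS]/(Ex P Z) (_ : Z = fun v => r * M N t v + m); last exact/funext.
  by rewrite (ExD (itgZ r iM) (itg_cst P m)) (ExZ _ iM) EM Ex_cst mulr0 add0r.
have [i2 e2] := martingale_variance sT N0 tT.
have vZ : var P Z = r ^+ 2 * martingale_var N t.
  rewrite /var mZ -[LHS]/(Ex P (fun v => (Z v - m) ^+ 2)) -[martingale_var N t]e2 -(ExZ _ i2).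
  by congr Ex; apply/funext => v; rewrite ZE addrK exprMn.
rewrite mZ vZ ZE addrK sqrtrM ?sqr_ge0// sqrtr_sqr gtr0_norm//.
rewrite /normalized invfM mulrACA divff ?mul1r ?lt0r_neq0// mulrC//.
Qed.

Lemma martingale_var_gt0 N t : - s N < t -> 0 < martingale_var N t.
Proof. by move=> st; rewrite subr_gt0 ltr_expR -mulrN ltr_pM2l. Qed.

Lemma normalized_cvg (F : set_system R) N t w (l : nat -> R) : Filter F -> - s N < t ->
  x @[x --> F] --> t -> (forall i, xis i (s N + x) w @[x --> F] --> l i) ->
  normalized N x w @[x --> F] --> (Num.sqrt (martingale_var N t))^-1 *
    \sum_(i < N) kap psi s N * (expR (l i - psi 1 * (s N + t)) - 1).
Proof.
move=> FF st Ft Fl; apply: cvgM; last exact: martingale_cvg.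
apply: cvgV; first by rewrite lt0r_neq0// sqrtr_gt0 martingale_var_gt0.
apply: continuous_cvg; first exact: sqrt_continuous.
apply: (@cvgB _ R^o); last exact: cvg_cst.
apply: continuous_cvg; first exact: continuous_expR.
by apply: cvgM => //; exact: cvg_cst.
Qed.

Lemma normalized_cadlag N w : T < s N -> cadlag_on T (fun t => normalized N t w).
Proof.
move=> sT; split => t /andP[t1 t2].
  apply: (normalized_cvg (l := fun i => xis i (s N + t) w)) => [||i]; first by lra.
    exact: cvg_at_right_filter.
  by apply: (levy_right_cvg); lra.
have st : 0 < s N + t by lra.
pose l i := lim (xis i (s N + x) w @[x --> t^'-]).
have hl i : xis i (s N + x) w @[x --> t^'-] --> l i by exact: (levy_left_cvg).
have tl : x @[x --> t^'-] --> t by exact: cvg_at_left_filter.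
have sNt : - s N < t by lra.
exact: cvgP (normalized_cvg _ sNt tl hl).
Qed.

(** The limiting variance exp (c2 t) is smallest at t = - T; half of that value is a lower bound on
    the variances for all large N, uniformly in t >= - T. *)
Let mu : R := Num.sqrt (expR (- (c2 * T)) / 2).

Let mu0 : 0 < mu.
Proof. by rewrite sqrtr_gt0 divr_gt0// expR_gt0. Qed.

Lemma martingale_var_ge : \forall N \near \oo, forall t, - T <= t ->
  0 < martingale_var N t /\ mu <= Num.sqrt (martingale_var N t).
Proof.
have e0 : 0 < expR (- (c2 * T)) / 2 by rewrite divr_gt0// expR_gt0.
have ev : \forall N \near \oo, expR (0 - c2 * s N) < expR (- (c2 * T)) / 2.
  exact: (cvgr_lt _ (expR_linear_cvg0 s_cvg 0 c20) _ e0).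
apply: filterS ev => N h t tT; rewrite sub0r in h.
have le : expR (- (c2 * T)) / 2 <= martingale_var N t.
  have : expR (- (c2 * T)) <= expR (c2 * t) by rewrite ler_expR -mulrN ler_pM2l.
  rewrite /martingale_var; lra.
by split; [exact: lt_le_trans le|exact: ler_wsqrtr].
Qed.

(** With sd the standard deviation, the increment of M / sd is the increment of M over sd_t plus (1
    / sd_t - 1 / sd_a) M_a. The first term is the cell bound for M. In the second the bracket is of
    order b - a, so it is large only if |M_a| exceeds a multiple of 1 / (b - a), which Chebyshev's
    inequality makes an event of probability of order (b - a)^2. *)
Lemma normalized_cell eps : 0 < eps -> exists2 C, 0 <= C & forall a b,
  - T <= a -> a < b -> b <= T -> \forall N \near \oo, exists A : set Om, [/\ measurable A,
    (P A <= (C * (b - a) ^+ 2)%:E)%E &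
    forall w, ~ A w -> forall t, a <= t <= b -> `|normalized N t w - normalized N a w| <= eps].
Proof.
(* Capped at 1, where the test function is known to be positive; eps mu / 2 makes the first term at
   most eps / 2 after division by a standard deviation of at least [mu]. *)
move=> eps0; pose e := Num.min 1 (eps * mu / 2).
have e0 : 0 < e by rewrite lt_min ltr01/= divr_gt0// mulr_gt0.
have e1 : e <= 1 by rewrite ge_min lexx.
have emu : e <= eps * mu / 2 by rewrite ge_min lexx orbT.
pose L := c2 * expR (c2 * T); have L0 : 0 < L by rewrite mulr_gt0 ?expR_gt0.
have expL x y : x <= y -> y <= T -> 0 <= expR (c2 * y) - expR (c2 * x) <= L * (y - x).
  move=> xy yT; rewrite subr_ge0 ler_expR ler_pM2l// xy/=.
  apply: (le_trans (expR_sub_le _ _)); rewrite -mulrBr mulrA ler_wpM2r ?subr_ge0//.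
  by rewrite /L mulrC ler_pM2l// ler_expR ler_pM2l.
have c0 := cos_test_gt0 e0 e1; have mu3 : 0 < mu ^+ 3 by rewrite exprn_gt0.
(* [C1] pays for the increments of the martingale, [C2] for its value at [a], whose variance is at
   most exp (c2 T). *)
pose C1 := L ^+ 2 / cos_test e; pose C2 := expR (c2 * T) * (2 * L / (eps * mu ^+ 3)) ^+ 2.
have C10 : 0 <= C1 by rewrite divr_ge0 ?sqr_ge0// ltW.
have C20 : 0 <= C2 by rewrite mulr_ge0 ?sqr_ge0 ?expR_ge0.
exists (C1 + C2); first exact: addr_ge0.
move=> a b Ta ab bT.
have cellM := cell_oscillation Ta ab e0 e1.
have vge := martingale_var_ge.
near=> N.
have sT : T <= s N by near: N; exact: s_ge.
have N0 : (0 < N)%N by near: N; exact: nbhs_infty_gt.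
have vg : forall t, - T <= t -> 0 < martingale_var N t /\ mu <= Num.sqrt (martingale_var N t).
  by near: N.
have [A [mA PA nA]] : exists A : set Om, [/\ measurable A,
    (P A <= ((expR (c2 * b) - expR (c2 * a)) ^+ 2 / cos_test e)%:E)%E &
    forall w, ~ A w -> forall t, a <= t <= b -> `|M N t w - M N a w| <= e] by near: N.
(* Solves L (b - a) r / mu^3 = eps / 2, the budget of the second term. *)
pose r := eps * mu ^+ 3 / (2 * L * (b - a)).
have ba : 0 < b - a by rewrite subr_gt0.
have r0 : 0 < r := divr_gt0 (mulr_gt0 eps0 mu3) (mulr_gt0 (mulr_gt0 (ltr0Sn R 1) L0) ba).
pose B := (fun w => `|M N a w|) @^-1` `[r, +oo[%classic.
have [i2 e2] := martingale_variance sT N0 Ta.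
have sa : 0 <= s N + a by lra.
have mM : measurable_fun setT (M N a) by exact: (itg_meas (martingale_itg mom sa)).
have mB : measurable B.
  have mf : measurable_fun setT (fun w => `|M N a w|) by exact: measurableT_comp.
  by rewrite -[B]setTI; apply: mf.
have PB : (P B <= (C2 * (b - a) ^+ 2)%:E)%E.
  rewrite -Ex_indic// lee_fin.
  apply: (@le_trans _ _ (Ex P (fun w => (r ^+ 2)^-1 * M N a w ^+ 2))).
    apply: Ex_le; [exact: itg_indic|exact: itgZ|move=> w].
    rewrite indicE; have [|_] := boolP (w \in B); last first.
      by rewrite mulr_ge0 ?invr_ge0 ?sqr_ge0.
    rewrite inE /B /= in_itv/= andbT => rM.
    rewrite mulrC ler_pdivlMr ?exprn_gt0// mul1r -(real_normK (num_real (M N a w))).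
    by rewrite ler_sqr ?nnegrE// ltW.
  rewrite ExZ// e2 /C2 mulrC -mulrA; apply: ler_pM.
  - by have [h _] := vg a Ta; exact: ltW.
  - by rewrite invr_ge0 sqr_ge0.
  - apply: (@le_trans _ _ (expR (c2 * a))); first by rewrite gerBl expR_ge0.
    by rewrite ler_expR ler_pM2l//; lra.
  - rewrite -exprMn -exprVn (_ : r^-1 = 2 * L / (eps * mu ^+ 3) * (b - a))//.
    rewrite /r invf_div mulrAC//.
exists (A `|` B); split; first exact: measurableU.
- apply: (le_trans (measureU2 _ mA mB)).
  rewrite mulrDl EFinD; apply: leeD => //; apply: (le_trans PA).
  rewrite lee_fin /C1 [leRHS]mulrAC ler_wpM2r ?invr_ge0 ?(ltW c0)// -exprMn.
  by have /andP[h1 h2] := expL a b (ltW ab) bT; rewrite ler_sqr ?nnegrE// (le_trans h1).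
move=> w nAB t /andP[at_ tb].
have tT : - T <= t by rewrite (le_trans Ta).
have h1 : `|M N t w - M N a w| <= e by apply: nA; [move=> Aw; apply: nAB; left|rewrite at_].
have h2 : `|M N a w| <= r.
  rewrite leNgt; apply/negP => lt; apply: nAB; right.
  by rewrite /B /= in_itv/= andbT ltW.
have [vt mt] := vg t tT; have [va ma] := vg a Ta.
have E : normalized N t w - normalized N a w =
  (Num.sqrt (martingale_var N t))^-1 * (M N t w - M N a w) +
  ((Num.sqrt (martingale_var N t))^-1 - (Num.sqrt (martingale_var N a))^-1) * M N a w.
  by rewrite /normalized; ring.
rewrite E (le_trans (ler_normD _ _))// !normrM [eps]splitr; apply: lerD.
  have st0 : 0 < Num.sqrt (martingale_var N t) := lt_le_trans mu0 mt.
  rewrite normfV (gtr0_norm st0) mulrC ler_pdivrMr// (le_trans h1)// (le_trans emu)//.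
  by rewrite mulrAC ler_pM2l// divr_gt0.
apply: (@le_trans _ _ (L * (b - a) / mu ^+ 3 * r)).
  apply: ler_pM => //; apply: (le_trans (sqrtV_lipschitz mu0 (ltW vt) (ltW va) mt ma)).
  have -> : martingale_var N t - martingale_var N a = expR (c2 * t) - expR (c2 * a).
    by rewrite /martingale_var; ring.
  rewrite ler_pM2r ?invr_gt0//.
  have /andP[g1 g2] := expL a t at_ (le_trans tb bT).
  by rewrite ger0_norm// (le_trans g2)// ler_pM2l//; lra.
rewrite le_eqVlt; apply/orP; left; apply/eqP; rewrite /r; field.
by rewrite !lt0r_neq0// subr_gt0.
Unshelve. all: by end_near. Qed.

Local Notation Y := normalized.

Lemma normalization_cvg t :
  (Num.sqrt (martingale_var N t))^-1 @[N --> \oo] --> expR (- (c2 / 2 * t)).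
Proof.
have -> : expR (- (c2 / 2 * t)) = (Num.sqrt (expR (c2 * t)))^-1.
  have -> : expR (c2 * t) = expR (c2 / 2 * t) ^+ 2.
    by rewrite -expRM_natl; congr expR; field.
  by rewrite sqrtr_sqr ger0_norm ?expR_ge0// expRN.
apply: cvgV; first by rewrite lt0r_neq0// sqrtr_gt0 expR_gt0.
apply: continuous_cvg; first exact: sqrt_continuous.
rewrite -[X in _ --> X]subr0; apply: (@cvgB _ R^o); first exact: cvg_cst.
have := expR_linear_cvg0 s_cvg 0 c20; under eq_fun do rewrite sub0r; exact.
Qed.

(** A linear form of normalized values is one of the martingale with convergent coefficients. The
    limiting exponents combine by c2 min (t1, t2) - c2 (t1 + t2) / 2 = - c2 |t2 - t1| / 2. *)
Lemma normalized_cos_cvg (ts : nat -> R) b l : (forall k, - T <= ts k) ->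
  Ex P (fun w => cos (b + linform l (fun k => Y N (ts k) w))) @[N --> \oo] -->
  Ex Q (fun w => cos (b + linform l (fun k => X (ts k) w))).
Proof.
move=> tsT; pose z k := nth (0, 0%N) l k; pose t k := ts (z k).2.
pose a N k := (z k).1 * (Num.sqrt (martingale_var N (t k)))^-1.
pose A k := (z k).1 * expR (- (c2 / 2 * t k)).
have lE (x : nat -> R) : linform l x = \sum_(k < size l) (z k).1 * x (z k).2.
  by rewrite /linform (big_nth (0, 0%N)) big_mkord.
have tT k : - T <= t k by exact: tsT.
have aA k : a N k @[N --> \oo] --> A k.
  by apply: cvgM; [exact: cvg_cst|exact: normalization_cvg].
have [isq vcv ccv] := martingale_clt (size l) tT aA.
have v0 : 0 <= limit_var psi (size l) t A.
  apply: (cvgr_to_ge vcv); apply: nearW => N; apply: Ex_ge0 => w; exact: sqr_ge0.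
have vE : limit_var psi (size l) t A = \sum_(j < size l) \sum_(k < size l) (z j).1 * (z k).1 *
    expR ((psi 1 - psi 2 / 2) * `|t k - t j|).
  apply: eq_bigr => j _; apply: eq_bigr => k _.
  rewrite /A mulrACA -[LHS]mulrA -!expRD; congr (_ * expR _).
  have [le|/ltW le] := leP (t j) (t k).
    by rewrite ger0_norm ?subr_ge0//; field.
  by rewrite ler0_norm ?subr_le0//; field.
have -> : (fun w => cos (b + linform l (fun k => X (ts k) w))) =
    fun w => cos (b + \sum_(k < size l) (z k).1 * X (t k) w) by apply/funext => w; rewrite lE.
rewrite vE in v0.
rewrite (gaussian_process_cos GX (t := t) (a := fun k => (z k).1) b v0) -vE.
apply: cvg_trans (ccv b); apply: near_eq_cvg; apply: nearW => N.
congr Ex; apply/funext => w; rewrite lE; congr (cos (_ + _)); apply: eq_bigr => k _.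
by rewrite /a /normalized mulrA.
Qed.

Lemma normalized_fdd (ts : nat -> R) (n : nat) (K m : R) g :
  (forall k, - T <= ts k <= T) -> 0 <= K -> lipschitz_coords n K g -> (forall v, `|g v| <= m) ->
  Ex P (fun w => g (fun k => Y N (ts k) w)) @[N --> \oo] --> Ex Q (fun w => g (fun k => X (ts k) w)).
Proof.
move=> tsT K0 gL gm; have Tts k : - T <= ts k by have /andP[] := tsT k.
apply: (lipschitz_cvg (V := fun N k => Y N (ts k)) (X := fun k => X (ts k)) (C := 1) _ _ _ K0 gL gm).
- near=> N => k.
  have sT : T < s N by apply: (@lt_le_trans _ _ (T + 1)); [rewrite ltrDl|near: N; exact: s_ge].
  have N0 : (0 < N)%N by near: N; exact: nbhs_infty_gt.
  have [i2 e2] := martingale_variance (ltW sT) N0 (Tts k).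
  have v0 : 0 < martingale_var N (ts k).
    by apply: martingale_var_gt0 => //; have := Tts k; lra.
  have iM : itg P (M N (ts k)) by apply: (martingale_itg mom); have := Tts k; lra.
  have E : (fun w => Y N (ts k) w ^+ 2) = fun w => (martingale_var N (ts k))^-1 * M N (ts k) w ^+ 2.
    by apply/funext => w; rewrite /normalized exprMn exprVn sqr_sqrtr// ltW.
  rewrite E; split; first by apply: measurable_funM => //; exact: (itg_meas iM).
  split; first exact: itgZ.
  by rewrite ExZ// e2 mulVf// lt0r_neq0.
- move=> k; have [mX _] := GX; have := gaussian_process_sqr GX (t := ts k).
  rewrite subrr normr0 mulr0 expR0 => /(_ ler01)[i e].
  by split; [exact: mX|split].
- by move=> b l; exact: normalized_cos_cvg.
Unshelve. all: by end_near. Qed.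

Lemma normalized_measurable N t : - T <= t -> T < s N -> measurable_fun setT (Y N t).
Proof.
move=> tT sT; apply: measurable_funM => //.
by apply: itg_meas; apply: (martingale_itg mom); lra.
Qed.

Lemma normalized_tight eps eta : 0 < eps -> 0 < eta ->
  exists n (ts : nat -> R) (idx : R -> nat), [/\ forall k, -T <= ts k <= T,
    forall t, (idx t < n)%N, small_oscillation T Q (fun w t => X t w) ts idx eps eta &
    \forall N \near \oo, small_oscillation T P (fun w t => Y N t w) ts idx eps eta].
Proof.
(* The transfer to the limit process doubles the oscillation, so cells are controlled at eps / 2. *)
move=> eps0 eta0; have e0 : 0 < eps / 2 by rewrite divr_gt0.
have [C C0 cellY] := normalized_cell e0.
(* Large enough for the union bound C (2 T)^2 / K to stay below [eta]. *)
pose K := (Num.truncn (C * (2 * T) ^+ 2 / eta)).+1.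
have K0 : (0 < K)%N by [].
have CK : C * (2 * T) ^+ 2 / K%:R <= eta.
  rewrite ler_pdivrMr ?ltr0n// [leRHS]mulrC -ler_pdivrMr//; apply/ltW; exact: truncnS_gt.
have mono (e : measure_display) (U : measurableType e) (m : probability U R)
      (W : U -> R -> R) ts idx e1 e2 h1 h2 :
    e1 <= e2 -> h1 <= h2 -> small_oscillation T m W ts idx e1 h1 ->
    small_oscillation T m W ts idx e2 h2.
  move=> e12 h12 [A [mA mA1 nA]]; exists A; split => //.
    by rewrite (le_trans mA1)// lee_fin.
  by move=> w /nA h t /h /le_trans; exact.
have cellT k : (k < K)%N -> [/\ - T <= cell_start T K k, cell_start T K k < cell_start T K k.+1 &
    cell_start T K k.+1 <= T].
  move=> kK; have /andP[h1 _] := cell_start_itv T0 K0 k.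
  have /andP[_ h2] := cell_start_itv T0 K0 k.+1.
  split => //; rewrite cell_startS// ltrDl divr_gt0 ?ltr0n//.
  by have := T0; lra.
exists K, (cell_start T K), (cell_index T K); split.
- exact: cell_start_itv.
- by move=> t; exact: cell_index_lt.
- apply: (mono _ _ _ _ _ _ _ _ _ _ (lexx _) CK); apply: cells_small_oscillation => // k kK.
  have [h1 h2 h3] := cellT k kK.
  have := cell_transfer (P := P) (Q := Q) (T := T) (V := Y) (X := X) _ _ _ _ h1 h2 h3 e0 (cellY _ _ h1 h2 h3).
  rewrite [2 * _]mulrC divfK ?pnatr_eq0//; apply.
  + near=> N => t /andP[t1 _]; apply: normalized_measurable => //; near: N; exact: s_gt.
  + by move=> t _; have [mX _] := GX; exact: mX.
  + by move=> w t tT; have [cr _] := cX w T; exact: cr.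
  + move=> ts n L m g tsT L0 gL gm.
    exact: (normalized_fdd tsT L0 gL gm).
- have : \forall N \near \oo, forall k : 'I_K, exists A : set Om, [/\ measurable A,
     (P A <= (C * (cell_start T K k.+1 - cell_start T K k) ^+ 2)%:E)%E &
     forall w, ~ A w -> forall t, cell_start T K k <= t <= cell_start T K k.+1 ->
       `|Y N t w - Y N (cell_start T K k) w| <= eps / 2].
    apply: filter_forall => k; have [h1 h2 h3] := cellT k (ltn_ord k).
    exact: cellY.
  apply: filterS => N h.
  have e12 : eps / 2 <= eps by lra.
  apply: (mono _ _ _ _ _ _ _ _ _ _ e12 CK); apply: cells_small_oscillation => // k kK.
  exact: (h (Ordinal kK)).
Unshelve. all: by end_near. Qed.

(** [Z] agrees with the normalized process on t > - s N, an open set of times that eventually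
    contains [-T, T]; one-sided limits at its points therefore agree as well. *)
Lemma normalized_weak_cvg (Z : nat -> Om -> R -> R) :
  (\forall N \near \oo, forall w t, - s N < t -> Z N w t = Y N t w) ->
  D_weak_cvg P Q T Z (fun w t => X t w).
Proof.
move=> ZY.
have ZT : \forall N \near \oo, forall w t, - T <= t <= T -> Z N w t = Y N t w.
  near=> N => w t /andP[t1 t2].
  have sT : T < s N by near: N; exact: s_gt.
  have h : forall w t, - s N < t -> Z N w t = Y N t w by near: N.
  by apply: h; lra.
apply: weak_cvg_tight.
- near=> N => w.
  have sT : T < s N by near: N; exact: s_gt.
  have h : forall t, - s N < t -> Z N w t = Y N t w.
    by have h : forall w t, - s N < t -> Z N w t = Y N t w by [near: N]; exact: h.
  have [c1 c2] := normalized_cadlag w sT.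
  split => t tT.
    have st : - s N < t by have /andP[t1 t2] := tT; lra.
    rewrite (h t st); apply: cvg_trans (c1 t tT); apply: near_eq_cvg; near=> x.
    by rewrite h// (lt_trans st).
  have st : - s N < t by have /andP[t1 t2] := tT; lra.
  have /cvg_ex[l hl] := c2 t tT; apply/cvg_ex; exists l.
  apply: cvg_trans hl; apply: near_eq_cvg; near=> x.
  by rewrite h//; near: x; exact: nbhs_left_gt.
- by move=> w; exact: cX.
- near=> N => t tT.
  have sT : T < s N by near: N; exact: s_gt.
  have h : forall w t, - T <= t <= T -> Z N w t = Y N t w by near: N.
  rewrite (_ : (fun w => Z N w t) = Y N t); last by apply/funext => w; exact: h.
  by apply: normalized_measurable => //; have /andP[] := tT.
- by move=> t _; have [mX _] := GX; exact: mX.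
- move=> ts n K m g tsT K0 gL gm.
  have := normalized_fdd tsT K0 gL gm.
  apply: cvg_trans; apply: near_eq_cvg; near=> N.
  have h : forall w t, - T <= t <= T -> Z N w t = Y N t w by near: N.
  congr Ex; apply/funext => w; congr g; apply/funext => k; rewrite h//.
- move=> eps eta eps0 eta0.
  have [n [ts [idx [tsT idxn oX oY]]]] := normalized_tight eps0 eta0.
  exists n, ts, idx; split => //; near=> N.
  have [A [mA PA nA]] : small_oscillation T P (fun w t => Y N t w) ts idx eps eta by near: N.
  have h : forall w t, - T <= t <= T -> Z N w t = Y N t w by near: N.
  exists A; split => // w nAw t tT; rewrite !h//; exact: nA.
Unshelve. all: by end_near. Qed.

End FluctuationLimit.


(** * From the growth assumption on ln N / s_N to the limit theorem *)

Lemma lt_limn_einf {R : realType} (u : (\bar R)^nat) (l : \bar R) : (l < limn_einf u)%E ->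
  \forall n \near \oo, (l < u n)%E.
Proof.
rewrite limn_einf_lim (cvg_lim (@ereal_hausdorff R) (@cvg_einfs_sup R u)).
move=> /ereal_sup_gt[_ [n _ <-] ln]; near=> k; apply: (lt_le_trans ln).
by apply: ereal_inf_lbound; exists k => //=; near: k; exact: nbhs_infty_ge.
Unshelve. all: by end_near. Qed.

(** Two intermediate numbers are needed: [lam] fixes the exponent p, and the gap lam' - lam is the
    exponential rate in the Lyapunov condition. The limit inferior may be infinite. *)
Lemma ereal_lt_between {R : realType} (l : R) (x : \bar R) : (l%:E < x)%E ->
  exists lam lam', [/\ l < lam, lam < lam' & (lam'%:E < x)%E].
Proof.
case: x => [r| |]//=.
  rewrite lte_fin => lr; exists ((2 * l + r) / 3), ((l + 2 * r) / 3).
  by split; [lra|lra|rewrite lte_fin; lra].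
by move=> _; exists (l + 1), (l + 2); split; [lra|lra|exact: ltry].
Qed.

Theorem theorem1p2 (R : realType) (d : measure_display) (Omega : measurableType d)
  (P : probability Omega R)
  (xi : R -> Omega -> R) (xis : nat -> R -> Omega -> R) (s : nat -> R) :
  levy_process P xi ->
  (forall u : R, (\int[P]_w (expR (u * xi 1 w))%:E < +oo)%E) ->
  ~ (exists c : R, P (xi 1 @^-1` [set c]) = 1%E) ->
  (forall i, levy_process P (xis i)) ->
  (forall i, same_fdd P (xis i) xi) ->
  indep_processes P xis ->
  (forall N, 0 <= s N) ->
  s N @[N --> \oo] --> +oo ->
  let psi := fun u : R => ln (fine (\int[P]_w (expR (u * xi 1 w))%:E)) in
  let lambda2 := 2 * derive1 psi 2 - psi 2 in
  (lambda2%:E < limn_einf (fun N : nat => (ln N%:R / s N)%:E))%E ->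
  let Z := fun (N : nat) (t : R) (w : Omega) =>
             \sum_(i < N) expR (xis i (s N + t) w) in
  let Y := fun (N : nat) (w : Omega) (t : R) =>
             (Z N t w - mean P (Z N t)) / Num.sqrt (var P (Z N t)) in
  forall (d' : measure_display) (Omega' : measurableType d')
    (Q : probability Omega' R) (X : R -> Omega' -> R),
  centered_gaussian_process Q X
    (fun t1 t2 => expR ((psi 1 - psi 2 / 2) * `|t2 - t1|)) ->
  (forall w T, cadlag_on T (fun t => X t w)) ->
  forall T : R, 0 < T ->
  D_weak_cvg P Q T Y (fun w t => X t w).
Proof.
move=> Lxi ixi ncst Lx fdd indx s0 s_cvg psi lambda2 lam_lt Z Y d' Om' Q X GX cX T T0.
have mxi1 : measurable_fun setT (xi 1) by case: Lxi => m _; exact: m.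
have mxis1 i : measurable_fun setT (xis i 1) by case: (Lx i) => m _; exact: m.
have iX1 u : itg P (fun w => expR (u * xi 1 w)).
  apply: itg_ge0P => [|w|]; [exact: (measurableT_comp (measurable_expRZ u))|exact: expR_ge0|exact: ixi].
(* Equality of the laws at time 1 fixes [psi] for every copy; the Lévy property then gives the
   exponential moments at all times. *)
have law1 i : same_law P P (xi 1) (xis i 1).
  move=> B mB; have := fdd i 1%N (fun=> 1) (fun=> B) (fun=> ler01) (fun=> mB).
  have I1 (F : set Omega) : \bigcap_(k in [set: 'I_1]) F = F.
    by apply/seteqP; split => [w /(_ ord0)|w Fw k _]; [apply|].
  by rewrite !I1.
have mom i u t : 0 <= t -> itg P (fun w => expR (u * xis i t w)) /\
    Ex P (fun w => expR (u * xis i t w)) = expR (t * psi u).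
  have law := fun v => Ex_same_law mxi1 (mxis1 i) (@law1 i) (measurable_expRZ v) (iX1 v).
  have iXi v : itg P (fun w => expR (v * xis i 1 w)) by have [] := law v.
  move=> t0; split; first exact: (levy_itg_expR (Lx i) iXi).
  have [_ e] := law u.
  exact (eq_trans (levy_mgf (Lx i) iXi u t0) (congr1 (fun z => expR (t * ln z)) (esym e))).
have psi12 : 2 * psi 1 < psi 2 by exact: (cgf_strictly_convex12 iX1 ncst).
have [lam [lam' [l1 l2 l3]]] : exists lam lam', [/\ lambda2 < lam, lam < lam' &
    (lam'%:E < limn_einf (fun N : nat => (ln N%:R / s N)%:E))%E].
  exact: ereal_lt_between lam_lt.
have lnN : \forall N \near \oo, lam' * s N <= ln N%:R.
  have ev := lt_limn_einf l3; near=> N.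
  have sN : 0 < s N by near: N; move/cvgryPgt : s_cvg; exact.
  by rewrite -ler_pdivlMr//; apply/ltW; rewrite -lte_fin; near: N.
have [p [p2 p3 psip]] := cgf_exponent iX1 l1.
apply: (normalized_weak_cvg Lx indx mom s_cvg psi12 (conj p2 p3) psip l2 lnN GX cX T0).
near=> N => w t st.
have N0 : (0 < N)%N by near: N; exact: nbhs_infty_gt.
(* The horizon of that lemma is taken to be [s N], so its condition on times reads - s N <= t. *)
exact: (normalized_particles Lx indx mom (conj p2 p3) w (lexx (s N)) N0 (ltW st)).
Unshelve. all: by end_near. Qed.
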